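(* Let $n\ge3$, let $\Omega\subset\mathbb{R}^n$ be a bounded domain with $0\in\Omega$ and let $\Omega'\Subset\Omega$. Assume $V\in M(W^{1,2}(\Omega)\to W^{-1,2}(\Omega))$, $\vec f\in L^2(\Omega)^n$ is such that $|\vec f|^2$ is an admissible measure for $W_0^{1,2}(\Omega)$, and $g\in W^{-1,2}(\Omega)$. Suppose there is $0<R\le\min\{1,\operatorname{dist}(\Omega',\partial\Omega)\}$ with $B_R(x_0)\subset\Omega$ for every $x_0\in\Omega'$, and Dini moduli of continuity $\omega_1,\omega_2$, i.e. $\int_0^R\frac{\omega_i(r)}rdr<\infty$ for $i=1,2$, such that for every $x_0\in\Omega'$, every $0<r\le\frac R2$, every $\psi\in W^{1,2}(\Omega)$ and $\varphi\in W_0^{1,2}(\Omega)$ with $\operatorname{supp}\varphi\subset\overline{B_r(x_0)}$, $$|\langle V\psi,\varphi\rangle|\le\omega_1(s)\|\psi(\cdot+x_0)\|_{L^{1,2}_{r,s}}\|\nabla\varphi\|_{L^2(B_r(x_0))}\quad\text{for all } r<s\le2r,$$ $$\int_{B_r(x_0)}|\vec f|^2|\varphi|^2dx\le(\omega_2(r))^2\int_{B_r(x_0)}|\nabla\varphi|^2dx,\qquad|\langle g,\varphi\rangle|\le\frac{\omega_2(r)}{r^2}|B_r|^{\frac{n+2}{2n}}\|\nabla\varphi\|_{L^2(B_r(x_0))}.$$ If $u\in W^{1,2}(\Omega)$ is a weak solution of $-\Delta u+Vu=-\operatorname{div}\vec f+g$ in $\Omega$, then $u$ is continuous in $\Omega'$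 in the classical sense after modification on a set of measure zero. It follows that $u\in L^\infty(\Omega')$ and $$\|u\|_{L^\infty(\Omega')}\le C\left(\frac{\|u\|_{L^2(\Omega)}}{|B_{\bar r}|^{\frac12}}+\omega_2(R)+\int_0^R\frac{\omega_2(r)}rdr\right),$$ where $\bar r\in(0,R]$ is the solution of $C_0|B_1|^{\frac{n+2}{2n}}\left(\omega_1(\bar r)+\frac1{1-\lambda}\int_0^{\bar r}\frac{\omega_1(s)}sds\right)=\frac{\delta_0}{128}$, with $C_0,\lambda,\delta_0$ the constants fixed in the context, and $C$ depends on $n,\omega_1,\Omega,R$ and $\bar r$.
   Context: Notation: $B_r(x_0)\subset\mathbb{R}^n$ is the ball of radius $r$ centered at $x_0$, $B_r=B_r(0)$. $W^{-1,2}(\Omega)$ is the dual of $W_0^{1,2}(\Omega)$ (so $|\langle g,v\rangle|\le C\|\nabla v\|_{L^2(\Omega)}$), with pairing $\langle\cdot,\cdot\rangle$. $V\in M(W^{1,2}(\Omega)\to W^{-1,2}(\Omega))$ means: $V$ is a linear operator from $W^{1,2}(\Omega)$ to $W^{-1,2}(\Omega)$ such that $|\langle Vu,v\rangle|\le C\|u\|_{W^{1,2}(\Omega)}\|\nabla v\|_{L^2(\Omega)}$ for all $u\in W^{1,2}(\Omega)$, $v\in W_0^{1,2}(\Omega)$, with $C$ independent of $u,v$. A nonnegative density $q\in L^1(\Omega)$ is an admissible measure for $W_0^{1,2}(\Omega)$ if $\int_\Omega|\varphi|^2q\,dx\le C\|\nabla\varphi\|_{L^2(\Omega)}^2$ for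 all $\varphi\in W_0^{1,2}(\Omega)$, with $C$ independent of $\varphi$. Weak solution of $-\Delta u+Vu=-\operatorname{div}\vec f+g$ in $\Omega$: $u\in W^{1,2}(\Omega)$ with $\int_\Omega\nabla u\cdot\nabla\varphi\,dx+\langle Vu,\varphi\rangle=\int_\Omega\vec f\cdot\nabla\varphi\,dx+\langle g,\varphi\rangle$ for all $\varphi\in W_0^{1,2}(\Omega)$. For $0<r<s$: $\|\psi\|_{L^{1,2}_{r,s}}=\frac{\|\psi\|_{L^2(B_s)}}{s-r}+\|\nabla\psi\|_{L^2(B_s)}$; thus $\|\psi(\cdot+x_0)\|_{L^{1,2}_{r,s}}=\frac{\|\psi\|_{L^2(B_s(x_0))}}{s-r}+\|\nabla\psi\|_{L^2(B_s(x_0))}$. A modulus of continuity $\omega$ is a non-decreasing, subadditive, continuous function with $\omega(0)=0$; it is Dini if $\int_0^R\frac{\omega(r)}r dr<\infty$. The constants $C_0>0$, $0<\lambda<1$, $\delta_0>0$ are fixed constants (depending only on $n$) with the following property: whenever $V\in M(W^{1,2}(B_1)\to W^{-1,2}(B_1))$, $\vec f\in L^2(B_1)^n$ with $|\vec f|^2$ admissible for $W_0^{1,2}(B_1)$, $g\in W^{-1,2}(B_1)$, and $u$ is a weak solution of $-\Delta u+Vu=-\operatorname{div}\vec f+g$ in $B_1$ with $\frac1{|B_1|}\int_{B_1}u^2dx\le1$, and for all $0<\rho\le\frac12$, $\psi\in W^{1,2}(B_1)$, $\varphi\in W_0^{1,2}(B_1)$ with $\operatorname{supp}\varphi\subset\overline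 B_\rho$ one has $|\langle V\psi,\varphi\rangle|\le\delta_0\|\psi\|_{L^{1,2}_{\rho,\theta}}\|\nabla\varphi\|_{L^2(B_\rho)}$ for all $\rho<\theta\le2\rho$, $|\langle g,\varphi\rangle|\le\delta_0\|\nabla\varphi\|_{L^2(B_\rho)}$, and $\int_{B_\rho}|\vec f|^2\varphi^2dx\le\delta_0^2\int_{B_\rho}|\nabla\varphi|^2dx$, then there is $l(x)=a+\vec b\cdot x$ with $\left(\frac1{|B_\lambda|}\int_{B_\lambda}|u-l|^2dx\right)^{1/2}\le\frac12\lambda$ and $|a|+|\vec b|\le C_0$. Such constants exist. *)

(* Defs.v *)
From HB Require Import structures.
From mathcomp Require Import all_boot all_order all_algebra.
From mathcomp Require Import all_classical all_reals all_analysis.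

Set Implicit Arguments.
Unset Strict Implicit.
Unset Printing Implicit Defensive.

Import Order.TTheory GRing.Theory Num.Theory.
Import numFieldNormedType.Exports.

Local Open Scope classical_set_scope.
Local Open Scope ring_scope.

(* R^n is ['rV[R]_n] with the sigma-algebra generated by the coordinate maps
   (i.e. the Borel sigma-algebra), as the library does for [n.-tuple T]. *)
Section measurable_rV.
Context (R : realType) (n : nat).

Definition rV_coord (i : 'I_n) (x : 'rV[R]_n) : measurableTypeR R := x 0 i.

Let rV_set0 : g_sigma_preimage rV_coord set0.
Proof. exact: sigma_algebra0. Qed.

Let rV_setC A : g_sigma_preimage rV_coord A -> g_sigma_preimage rV_coord (~` A).
Proof. exact: sigma_algebraC. Qed.

Let rV_bigcup (F : (set 'rV[R]_n)^nat) :
  (forall i, g_sigma_preimage rV_coord (F i)) ->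
  g_sigma_preimage rV_coord (\bigcup_i (F i)).
Proof. exact: sigma_algebra_bigcup. Qed.

HB.instance Definition _ := @isMeasurable.Build default_measure_display
  'rV[R]_n (g_sigma_preimage rV_coord) rV_set0 rV_setC rV_bigcup.

End measurable_rV.

Section cons_rV.
Context (R : realType) (n : nat).

Definition cons_rV (p : measurableTypeR R * 'rV[R]_n) : 'rV[R]_n.+1 :=
  \row_i oapp (p.2 0) p.1 (unlift ord0 i).

Lemma measurable_rV_coord m (i : 'I_m) :
  measurable_fun [set: 'rV[R]_m] (@rV_coord R m i).
Proof.
move=> _ Y mY; rewrite setTI; apply: sub_sigma_algebra => /=.
rewrite -bigcup_seq/=; exists i => /=; first by rewrite mem_index_enum.
by exists Y => //; rewrite setTI.
Qed.

Lemma measurable_cons_rV : measurable_fun setT cons_rV.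
Proof.
move=> _ A mA; rewrite setTI.
pose F := [set B : set 'rV[R]_n.+1 | measurable (cons_rV @^-1` B)].
suff : @measurable _ 'rV[R]_n.+1 `<=` F by apply.
apply: smallest_sub.
  split; rewrite /F /=.
  - by rewrite preimage_set0.
  - by move=> B mB; rewrite setTD preimage_setC; exact: measurableC.
  - by move=> G mG; rewrite preimage_bigcup; exact: bigcup_measurable.
rewrite -bigcup_seq => B [i _ [Y mY <-]]; rewrite /F /= setTI.
rewrite -comp_preimage -[X in measurable X]setTI.
suff mi : measurable_fun setT (rV_coord i \o cons_rV) by exact: mi.
case: (unliftP ord0 i) => [j ->|->].
  rewrite (_ : _ \o _ = rV_coord j \o snd); last first.
    by apply/funext => p; rewrite /= /rV_coord mxE liftK.
  by apply: measurableT_comp => //; exact: measurable_rV_coord.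
rewrite (_ : _ \o _ = fst) //.
by apply/funext => p; rewrite /= /rV_coord mxE unlift_none.
Qed.

Variable m : {sigma_finite_measure set 'rV[R]_n -> \bar R}.

Definition cons_measure : set 'rV[R]_n.+1 -> \bar R :=
  pushforward (lebesgue_measure \x m)%E cons_rV.

Let cons_measure0 : cons_measure set0 = 0%E.
Proof. by rewrite /cons_measure /pushforward preimage_set0 measure0. Qed.

Let cons_measure_ge0 A : (0 <= cons_measure A)%E.
Proof. by rewrite /cons_measure /pushforward; exact: measure_ge0. Qed.

Let cons_measure_sigma_additive : semi_sigma_additive cons_measure.
Proof.
have mf B : measurable B -> measurable (cons_rV @^-1` B).
  by move=> mB; rewrite -[X in measurable X]setTI; exact: measurable_cons_rV.
move=> F mF tF mUF; rewrite /cons_measure /pushforward preimage_bigcup.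
apply: measure_semi_sigma_additive.
- by move=> k; exact: mf.
- apply/trivIsetP => /= i j _ _ ij; rewrite -preimage_setI.
  by move/trivIsetP : tF => /(_ _ _ _ _ ij) ->//; rewrite preimage_set0.
- by rewrite -preimage_bigcup; exact: mf.
Qed.

HB.instance Definition _ := isMeasure.Build _ _ _ cons_measure
  cons_measure0 cons_measure_ge0 cons_measure_sigma_additive.

Let cons_measure_sigma_finite : sigma_finite setT cons_measure.
Proof.
have [F FT Foo] := sigma_finiteT (@lebesgue_measure R).
have [G GT Goo] := sigma_finiteT m.
pose H (k : nat * nat) : set 'rV[R]_n.+1 :=
  [set x | F k.1 (x 0 ord0) /\ G k.2 (\row_j x 0 (lift ord0 j))].
have HE k : cons_rV @^-1` (H k) = F k.1 `*` G k.2.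
  apply/seteqP; split=> -[x y]; rewrite /H /cons_rV /= mxE unlift_none /=.
    move=> [Fx Gy]; split=> //; congr (G _ _): Gy.
    by apply/rowP => j; rewrite !mxE liftK.
  move=> [Fx Gy]; split=> //; congr (G _ _): Gy.
  by apply/rowP => j; rewrite !mxE liftK.
have mH k : measurable (H k).
  have -> : H k = (rV_coord ord0 @^-1` F k.1) `&`
      ((fun x : 'rV[R]_n.+1 => \row_j x 0 (lift ord0 j)) @^-1` G k.2) by [].
  apply: measurableI.
    rewrite -[X in measurable X]setTI; apply: measurable_rV_coord => //.
    by have [] := Foo k.1.
  have [mG _] := Goo k.2.
  pose S := [set B : set 'rV[R]_n |
    measurable ((fun x : 'rV[R]_n.+1 => \row_j x 0 (lift ord0 j)) @^-1` B)].
  suff : @measurable _ 'rV[R]_n `<=` S by apply.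
  apply: smallest_sub.
    split; rewrite /S /=.
    - by rewrite preimage_set0.
    - by move=> B mB; rewrite setTD preimage_setC; exact: measurableC.
    - by move=> K mK; rewrite preimage_bigcup; exact: bigcup_measurable.
  rewrite -bigcup_seq => B [i _ [Y mY <-]]; rewrite /S /= setTI -comp_preimage.
  rewrite (_ : _ \o _ = rV_coord (lift ord0 i)).
    by rewrite -[X in measurable X]setTI; exact: measurable_rV_coord.
  by apply/funext => x; rewrite /= /rV_coord mxE.
pose dec k := odflt (0, 0)%N (unpickle k : option (nat * nat)).
exists (fun k => H (dec k)).
  apply/seteqP; split=> // x _.
  have [i _ Fi] : (\bigcup_i F i) (x 0 ord0) by rewrite -FT.
  have [j _ Gj] : (\bigcup_j G j) (\row_j x 0 (lift ord0 j)) by rewrite -GT.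
  by exists (pickle (i, j)) => //; rewrite /dec pickleK.
move=> k; split=> //; rewrite /cons_measure /pushforward HE.
have [mF Ffin] := Foo (dec k).1; have [mG Gfin] := Goo (dec k).2.
rewrite product_measure1E//; apply: lte_mul_pinfty => //.
by rewrite ge0_fin_numE.
Qed.

HB.instance Definition _ := Measure_isSigmaFinite.Build _ _ _ cons_measure
  cons_measure_sigma_finite.

End cons_rV.

Fixpoint lebesgue_rV (R : realType) (n : nat) :
    {sigma_finite_measure set 'rV[R]_n -> \bar R} :=
  match n with
  | 0 => \d_(0 : 'rV[R]_0)
  | k.+1 => cons_measure (lebesgue_rV R k)
  end.

(* The library norm and balls of ['rV[R]_n] are those of the sup norm, which
   induces the same topology as [enorm]. *)
Section euclidean.
Context (R : realType) (n : nat).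
Implicit Types (x y : 'rV[R]_n) (A B D : set 'rV[R]_n).

Definition dot x y : R := \sum_(i < n) x 0 i * y 0 i.

Definition enorm x : R := Num.sqrt (dot x x).

Definition eball x (r : R) : set 'rV[R]_n := [set y | enorm (y - x) < r].

Definition bdry A : set 'rV[R]_n := closure A `\` interior A.

Definition dist A B : \bar R :=
  ereal_inf [set (enorm (x - y))%:E | x in A & y in B].

Definition vol D : R := fine (lebesgue_rV R n D).

Definition compactly_contained A B := compact (closure A) /\ closure A `<=` B.

Definition bounded_domain D := [/\ open D, connected D & bounded_set D].

End euclidean.

Section sobolev.
Context (R : realType) (n : nat).
Local Notation E := 'rV[R]_n.
Local Notation mu := (lebesgue_rV R n).
Implicit Types (Om D : set E) (u v phi : E -> R) (F : E -> E).

Definition L2norm D u : R := fine 'N[mu]_2%:E[EFin \o (u \_ D)].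

Definition L2 D u :=
  measurable_fun D u /\ ('N[mu]_2%:E[EFin \o (u \_ D)] < +oo)%E.

Definition L2vec D F := forall i, L2 D (fun x => F x 0 i).

Definition Linfty_norm D u : \bar R := 'N[mu]_+oo[EFin \o (u \_ D)].

Definition average D u : R := (vol D)^-1 * \int[mu]_(x in D) u x.

Definition partial (i : 'I_n) u : E -> R := fun x => 'D_(delta_mx 0 i) u x.

Definition smooth u := forall s : seq 'I_n,
  let w := foldr partial u s in
  continuous w /\ forall i x, derivable w x (delta_mx 0 i).

Definition test_function Om phi :=
  [/\ smooth phi,
      compact (closure [set x | phi x != 0]) &
      closure [set x | phi x != 0] `<=` Om].

Definition is_weak_gradient Om u F := forall phi (i : 'I_n),
  test_function Om phi ->
  \int[mu]_(x in Om) (u x * partial i phi x) =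
  - \int[mu]_(x in Om) (F x 0 i * phi x).

(* Elements of Sobolev spaces are represented by functions on R^n of which only
   the restriction to [Om], up to null sets, is relevant. *)
Definition W12 Om u :=
  L2 Om u /\ exists F, L2vec Om F /\ is_weak_gradient Om u F.

Definition grad Om u : E -> E :=
  xget (fun=> 0) [set F | L2vec Om F /\ is_weak_gradient Om u F].

(* L^2 norm on [D], a subset of [Om], of the weak gradient of [u] in [Om] *)
Definition gradnorm Om D u : R := L2norm D (fun x => enorm (grad Om u x)).

Definition W12norm Om u : R :=
  Num.sqrt (L2norm Om u ^+ 2 + gradnorm Om Om u ^+ 2).

Definition W120 Om v := W12 Om v /\
  forall e : R, 0 < e -> exists phi,
    test_function Om phi /\ W12norm Om (fun x => v x - phi x) < e.

(* The support of [phi] as an a.e. class: the smallest closed set off which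
   [phi] vanishes almost everywhere in [Om]. *)
Definition esupp Om phi : set E :=
  [set x | forall U : set E, open U -> U x ->
     ~ {ae mu, forall y, (Om `&` U) y -> phi y = 0}].

(* Functionals and operators; [g v] and [V u v] stand for the pairings
    <g, v> and <V u, v>. Their boundedness makes them compatible with a.e.
    equality. *)

Definition W12dual Om (g : (E -> R) -> R) :=
  (forall (a : R) v w, W120 Om v -> W120 Om w ->
     g (fun x => a * v x + w x) = a * g v + g w) /\
  exists C : R, forall v, W120 Om v -> `|g v| <= C * gradnorm Om Om v.

Definition W12multiplier Om (V : (E -> R) -> (E -> R) -> R) :=
  [/\ forall u, W12 Om u -> W12dual Om (V u),
      forall (a : R) u w v, W12 Om u -> W12 Om w -> W120 Om v ->
        V (fun x => a * u x + w x) v = a * V u v + V w v &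
      exists C : R, forall u v, W12 Om u -> W120 Om v ->
        `|V u v| <= C * W12norm Om u * gradnorm Om Om v].

Definition admissible Om (q : E -> R) :=
  [/\ mu.-integrable Om (EFin \o q),
      forall x, Om x -> 0 <= q x &
      exists C : R, forall phi, W120 Om phi ->
        (\int[mu]_(x in Om) (phi x ^+ 2 * q x)%:E <=
         (C * gradnorm Om Om phi ^+ 2)%:E)%E].

Definition weak_solution Om V (f : E -> E) (g : (E -> R) -> R) u :=
  W12 Om u /\ forall phi, W120 Om phi ->
    \int[mu]_(x in Om) dot (grad Om u x) (grad Om phi x) + V u phi =
    \int[mu]_(x in Om) dot (f x) (grad Om phi x) + g phi.

(* [L12norm Om x0 r s psi] is the norm of psi(. + x0) in L^{1,2}_{r,s}, for
   [psi] in W^{1,2}(Om) and B_s(x0) included in [Om]. *)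
Definition L12norm Om (x0 : E) (r s : R) u : R :=
  L2norm (eball x0 s) u / (s - r) + gradnorm Om (eball x0 s) u.

End sobolev.

Section moduli.
Context (R : realType).
Implicit Type omega : R -> R.

Definition modulus omega :=
  [/\ omega 0 = 0,
      forall r s, 0 <= r -> r <= s -> omega r <= omega s,
      forall r s, 0 <= r -> 0 <= s -> omega (r + s) <= omega r + omega s &
      {within `[0, +oo[, continuous omega}].

Definition dini omega (R0 : R) :=
  (\int[lebesgue_measure]_(r in `]0%R, R0]) (omega r / r)%:E < +oo)%E.

Definition dini_integral omega (R0 : R) : R :=
  \int[lebesgue_measure]_(r in `]0, R0]) (omega r / r).

End moduli.

Definition approximation_constants (R : realType) (n : nat)
    (C0 lam delta0 : R) : Prop :=
  let B := eball (0 : 'rV[R]_n) in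
  [/\ 0 < C0, 0 < lam < 1, 0 < delta0 &
  forall (V : ('rV[R]_n -> R) -> ('rV[R]_n -> R) -> R)
    (f : 'rV[R]_n -> 'rV[R]_n) (g : ('rV[R]_n -> R) -> R) (u : 'rV[R]_n -> R),
  W12multiplier (B 1) V ->
  L2vec (B 1) f -> admissible (B 1) (fun x => enorm (f x) ^+ 2) ->
  W12dual (B 1) g ->
  weak_solution (B 1) V f g u ->
  average (B 1) (fun x => u x ^+ 2) <= 1 ->
  (forall (rho : R) (psi phi : 'rV[R]_n -> R),
     0 < rho -> rho <= 1 / 2 ->
     W12 (B 1) psi -> W120 (B 1) phi ->
     esupp (B 1) phi `<=` closure (B rho) ->
     [/\ forall theta : R, rho < theta -> theta <= 2 * rho ->
           `|V psi phi| <= delta0 * L12norm (B 1) 0 rho theta psi *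
                           gradnorm (B 1) (B rho) phi,
         `|g phi| <= delta0 * gradnorm (B 1) (B rho) phi &
         (\int[lebesgue_rV R n]_(x in B rho) (enorm (f x) ^+ 2 * phi x ^+ 2)%:E
          <= (delta0 ^+ 2)%:E *
             \int[lebesgue_rV R n]_(x in B rho)
                (enorm (grad (B 1) phi x) ^+ 2)%:E)%E]) ->
  exists (a : R) (b : 'rV[R]_n),
    Num.sqrt (average (B lam) (fun x => `|u x - (a + dot b x)| ^+ 2))
      <= lam / 2 /\
    `|a| + enorm b <= C0].

(* Main.v *)
Require Import Defs.
From HB Require Import structures.
From mathcomp Require Import all_boot all_order all_algebra.
From mathcomp Require Import all_classical all_reals all_analysis.
From mathcomp Require Import measurable_realfun ess_sup_inf ring lra.

Set Implicit Arguments.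
Unset Strict Implicit.
Unset Printing Implicit Defensive.

Import Order.TTheory GRing.Theory Num.Theory.
Import numFieldNormedType.Exports.

Local Open Scope classical_set_scope.
Local Open Scope ring_scope.

(** The solution is compared with affine functions on the balls of radius [r * lam ^+ k]
    around a point of [Om'], and the values of these functions at the centre converge at a
    rate that does not depend on the centre.

    A step of the comparison ([scaled_step]) subtracts the current affine function [l] from
    [u], divides by the size [N] of the error and rescales the ball to the unit ball. The
    result solves an equation of the same type, with source [g - V l], and the hypotheses
    at radius at most [r / 2] become the smallness required by the approximation property
    of the constants [C0], [lam], [delta0], provided that [N] dominates a multiple of
    [omega2] and of [omega1] times the size of [l]. This property is about operators on the
    unit ball only; [unit_step] transfers it to a larger domain by composing the operator
    with a cutoff and by extending test functions by zero ([wgrad_cutoff], [W120_ext0]). One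
    obtains a better affine function, whose error is halved relative to the new radius.

    Iterating, the errors obey [N (k+1) = N k / 2 + c2 omega2 + c1 omega1 L (k+1)], where
    [L (k+1) = L k + C0 N k] bounds the affine functions and the moduli are taken at the
    radius of the step. The Dini condition says exactly that the moduli are summable along
    a geometric sequence of radii ([dini_sum]). Starting from a radius below which the sum
    for [omega1] is small, the last term is absorbed and the sum of the [N k] is controlled
    by the initial error and the sum for [omega2] ([Nseq_sum]). Hence the constants converge
    uniformly, and so do the slopes, measured at the scale of the ball, to zero.

    It remains to identify the limit [ut]. Two centres closer than half the radius share
    a ball on which both constants approximate [u], so they differ little: [ut] is
    continuous ([limit_continuous]). Constants chosen on the cubes of a fine grid give
    functions that converge to [u] in L2 and to [ut] pointwise, so that [u] and [ut] agree
    almost everywhere ([limit_ae]). The bound on [ut] is [C0] times the sum of the [N k].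

    The Sobolev calculus rests on explicit smooth functions built from [exp (-1/t)], on the
    behaviour of the Lebesgue measure under dilations, on integration by parts for test
    functions by translation invariance, and on the fundamental lemma, which makes weak
    gradients unique almost everywhere. *)

(** * Boxes, affine changes of variables and Lebesgue measure *)

Section boxes.
Context (R : realType).


Lemma eq_ler (a b : R) : a = b -> a <= b.
Proof. by move=> ->. Qed.

Definition box n (a b : 'rV[R]_n) : set 'rV[R]_n :=
  [set x | forall i, a 0 i < x 0 i < b 0 i].

Definition rV_tail n (x : 'rV[R]_n.+1) : 'rV[R]_n := \row_j x 0 (lift ord0 j).

Lemma measurable_fun_rV d (T : measurableType d) n (D : set T)
    (f : T -> 'rV[R]_n) :
  measurable D ->
  (forall i, measurable_fun D (fun x => f x 0 i)) -> measurable_fun D f.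
Proof.
move=> mD mf.
apply: (measurability (\big[setU/set0]_(i < n)
  preimage_set_system setT (@rV_coord R n i) measurable)) => //.
move=> _ [A + <-]; rewrite -bigcup_seq => -[i _ [Y mY <-]].
move=> /=; rewrite setTI -comp_preimage; exact: mf.
Qed.

Lemma measurable_coord n (i : 'I_n) (D : set 'rV[R]_n) :
  measurable_fun D (fun x : 'rV[R]_n => x 0 i).
Proof. by apply: measurable_funTS; exact: measurable_rV_coord. Qed.

Lemma measurable_box n (a b : 'rV[R]_n) : measurable (box a b).
Proof.
rewrite (_ : box a b = \big[setI/setT]_(i < n)
    ((fun x : 'rV[R]_n => x 0 i) @^-1` `]a 0 i, b 0 i[)).
  apply: bigsetI_measurable => i _; rewrite -[X in measurable X]setTI.
  by apply: measurable_coord => //; exact: measurable_itv.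
apply/seteqP; split=> x; rewrite -bigcap_seq /=.
  by move=> xab i _ /=; rewrite in_itv/= xab.
by move=> + i => /(_ i); rewrite /= in_itv/=; apply; rewrite mem_index_enum.
Qed.

Lemma box_setI n (a b c d : 'rV[R]_n) :
  box a b `&` box c d = box (\row_i Num.max (a 0 i) (c 0 i))
                            (\row_i Num.min (b 0 i) (d 0 i)).
Proof.
apply/seteqP; split=> x /=.
  move=> [h1 h2] i; rewrite !mxE gt_max lt_min.
  by have /andP[-> ->] := h1 i; have /andP[-> ->] := h2 i.
by move=> h; split=> i; have := h i; rewrite !mxE gt_max lt_min;
  move=> /andP[/andP[? ?] /andP[? ?]]; apply/andP.
Qed.

Definition boxes n : set (set 'rV[R]_n) := [set box p.1 p.2 | p in setT].

Lemma boxes_setI n : setI_closed (@boxes n).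
Proof.
move=> _ _ [[a b] _ <-] [[c d] _ <-] /=; rewrite box_setI.
by exists (\row_i Num.max (a 0 i) (c 0 i), \row_i Num.min (b 0 i) (d 0 i)).
Qed.

Lemma coord_le_norm n (x : 'rV[R]_n) i : `|x 0 i| <= `|x|.
Proof.
rewrite [leRHS]/Num.norm /= mx_normrE.
by rewrite (le_bigmax_cond _ (fun j : 'I_1 * 'I_n => `|x j.1 j.2|) (j := (0, i))).
Qed.

Lemma sup_rV n (x : 'rV[R]_n) : exists k : nat, forall i, `|x 0 i| < k%:R.
Proof.
exists (Num.truncn `|x|).+1 => i; apply: le_lt_trans (truncnS_gt _).
exact: coord_le_norm.
Qed.

Lemma boxes_gen n : @measurable _ 'rV[R]_n = <<s @boxes n >>.
Proof.
apply/seteqP; split; last first.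
  apply: smallest_sub; first by split;
    [exact: measurable0|move=> *; rewrite setTD; exact: measurableC|
     move=> *; exact: bigcupT_measurable].
  by move=> _ [[a b] _ <-]; exact: measurable_box.
apply: smallest_sub; first exact: smallest_sigma_algebra.
rewrite -bigcup_seq => _ [i _ [Y mY <-]]; rewrite setTI.
pose H : set (set R) := [set Y | <<s @boxes n >> (@rV_coord R n i @^-1` Y)].
suff HY : (@measurable _ (measurableTypeR R)) `<=` H by exact: HY.
rewrite (RGenOInfty.measurableE R); apply: smallest_sub.
  split; rewrite /H /=.
  - by rewrite preimage_set0; exact: sigma_algebra0.
  - move=> A hA; rewrite setTD preimage_setC -setTD; exact: sigma_algebraCD.
  - by move=> F hF; rewrite preimage_bigcup; exact: sigma_algebra_bigcup.
move=> _ [c ->]; rewrite /H /=.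
rewrite (_ : _ @^-1` _ = \bigcup_k box (\row_j if j == i then c else - k%:R)
   (const_mx k%:R)); last first.
  apply/seteqP; split=> x /=.
    rewrite /rV_coord in_itv/= andbT => cx.
    have [k hk] := sup_rV x; exists k => // j; rewrite !mxE.
    have := hk j; rewrite ltr_norml => /andP[h1 ->]; rewrite andbT.
    by case: eqP => // ->.
  move=> [k _ /(_ i)]; rewrite !mxE eqxx /rV_coord in_itv/= andbT.
  by move=> /andP[].
apply: sigma_algebra_bigcup => k; apply: sub_sigma_algebra.
by exists (\row_j (if j == i then c else - k%:R), const_mx k%:R).
Qed.

Lemma box_measure n (a b : 'rV[R]_n) :
  lebesgue_rV R n (box a b) = (\prod_(i < n) Num.max 0 (b 0 i - a 0 i))%:E.
Proof.
elim: n a b => [|n IH] a b.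
  rewrite big_ord0 /= /dirac indicE mem_set//.
  by move=> [].
rewrite /= /cons_measure /pushforward.
rewrite (_ : _ @^-1` _ = `]a 0 ord0, b 0 ord0[%classic `*` box (rV_tail a) (rV_tail b)).
  rewrite product_measure1E//; last exact: measurable_box.
  have -> := IH (rV_tail a) (rV_tail b).
  rewrite big_ord_recl [X in (X * _)%E](_ : _ = (Num.max 0 (b 0 ord0 - a 0 ord0))%:E).
    rewrite -EFinM; congr (_ * _)%:E.
    by apply: eq_bigr => i _; rewrite !mxE.
  apply: etrans (lebesgue_measure_itv `]a 0 ord0, b 0 ord0[) _.
  rewrite /= lte_fin.
  have [ab|ba] := ltP (a 0 ord0) (b 0 ord0).
    by rewrite -EFinD; congr EFin; apply/esym/max_idPr; rewrite subr_ge0 ltW.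
  by congr EFin; apply/esym/max_idPl; rewrite subr_le0.
apply/seteqP; split=> -[x y] /=.
  move=> h; split; first by have := h ord0; rewrite !mxE unlift_none/= in_itv.
  by move=> i; have := h (lift ord0 i); rewrite !mxE liftK.
rewrite in_itv/= => -[h1 h2] i; rewrite !mxE.
case: (unliftP ord0 i) => [j|] -> /=; last exact: h1.
by have := h2 j; rewrite !mxE.
Qed.

Definition aff n (c : 'rV[R]_n) (r : R) (x : 'rV[R]_n) := c + r *: x.

Lemma affK n (c : 'rV[R]_n) (r : R) : r != 0 ->
  cancel (aff c r) (aff (- (r^-1 *: c)) r^-1).
Proof.
by move=> r0 x; rewrite /aff scalerDr scalerA mulVf// scale1r addKr.
Qed.

Lemma affKV n (c : 'rV[R]_n) (r : R) : r != 0 ->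
  cancel (aff (- (r^-1 *: c)) r^-1) (aff c r).
Proof.
move=> r0 x; rewrite /aff scalerDr scalerN !scalerA mulfV// !scale1r.
by rewrite addrA subrr add0r.
Qed.

Lemma measurable_aff n (c : 'rV[R]_n) (r : R) : measurable_fun setT (aff c r).
Proof.
apply: measurable_fun_rV => // i.
rewrite (_ : (fun x => _) = (fun x : 'rV[R]_n => c 0 i + r * x 0 i)); last first.
  by apply/funext => x; rewrite !mxE.
apply: measurable_funD => //; apply: measurable_funM => //.
exact: measurable_coord.
Qed.

(** Both sides are measures in [A], so it is enough to compare them on boxes. *)
Lemma measure_aff n (c : 'rV[R]_n) (r : R) (A : set 'rV[R]_n) :
  0 < r -> measurable A ->
  lebesgue_rV R n A = ((r ^+ n)%:E * lebesgue_rV R n (aff c r @^-1` A))%E.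
Proof.
move=> r0 mA.
have rn0 : 0 <= r ^+ n by rewrite exprn_ge0// ltW.
have mf := measurable_aff c r.
pose m1 : {measure set _ -> \bar R} := pushforward (lebesgue_rV R n) (aff c r).
pose m2 := mscale (NngNum rn0) (m1 mf).
suff -> : lebesgue_rV R n A = m2 A by [].
apply: (measure_unique (@boxes n)
  (fun k => box (const_mx (- k%:R)) (const_mx k%:R))) => //.
- exact: boxes_gen.
- exact: boxes_setI.
- by move=> k; exists (const_mx (- k%:R), const_mx k%:R).
- apply/seteqP; split=> // x _; have [k hk] := sup_rV x.
  by exists k => // i; rewrite !mxE -ltr_norml.
- move=> _ [[a b] _ <-] /=; rewrite /m2 /mscale /= /m1 /= /pushforward.
  rewrite (_ : _ @^-1` _ = box (r^-1 *: (a - c)) (r^-1 *: (b - c))).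
    rewrite !box_measure -EFinM; congr EFin.
    rewrite -[n in r ^+ n]card_ord -prodr_const -big_split /=.
    apply: eq_bigr => i _; rewrite !mxE maxr_pMr ?ltW// mulr0 -mulrBr mulrA.
    by rewrite mulfV ?gt_eqF// mul1r; congr Num.max; ring.
  apply/seteqP; split=> x /= h i; have := h i; rewrite !mxE;
    by rewrite ltr_pdivrMl// ltr_pdivlMl// ltrBlDl ltrBrDl.
- move=> k; have E := box_measure (const_mx (- k%:R) : 'rV[R]_n) (const_mx k%:R).
  by apply: (eq_ind_r (fun z => z < +oo)%E _ E); exact: ltry.
Qed.

End boxes.

(** * The Euclidean norm, balls and measurability *)

Section euclid.
Context (R : realType) (n : nat).
Local Notation E := 'rV[R]_n.
Local Notation mu := (lebesgue_rV R n).
Implicit Types (x y c : E) (r s : R).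

Lemma dotC x y : dot x y = dot y x.
Proof. by apply: eq_bigr => i _; rewrite mulrC. Qed.

Lemma dotDl x y z : dot (x + y) z = dot x z + dot y z.
Proof. by rewrite -big_split; apply: eq_bigr => i _; rewrite mxE mulrDl. Qed.

Lemma dotZl r x y : dot (r *: x) y = r * dot x y.
Proof. by rewrite /dot mulr_sumr; apply: eq_bigr => i _; rewrite mxE mulrA. Qed.

Lemma dotDr x y z : dot z (x + y) = dot z x + dot z y.
Proof. by rewrite dotC dotDl !(dotC z). Qed.

Lemma dotZr r x y : dot y (r *: x) = r * dot y x.
Proof. by rewrite dotC dotZl (dotC y). Qed.

Lemma dot_ge0 x : 0 <= dot x x.
Proof. by apply: sumr_ge0 => i _; rewrite -expr2 sqr_ge0. Qed.

Lemma enorm_ge0 x : 0 <= enorm x.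
Proof. exact: sqrtr_ge0. Qed.

Lemma enorm_sqr x : enorm x ^+ 2 = dot x x.
Proof. by rewrite sqr_sqrtr// dot_ge0. Qed.

Lemma enorm_sum x : enorm x ^+ 2 = \sum_(i < n) x 0 i ^+ 2.
Proof. by rewrite enorm_sqr; apply: eq_bigr => i _; rewrite expr2. Qed.

Lemma enormZ r x : enorm (r *: x) = `|r| * enorm x.
Proof.
rewrite /enorm dotZl dotZr mulrA -expr2 sqrtrM ?sqr_ge0//.
by rewrite sqrtr_sqr.
Qed.

Lemma enorm0 : enorm (0 : E) = 0.
Proof. by rewrite -(scale0r (0 : E)) enormZ normr0 mul0r. Qed.

Lemma enormN x : enorm (- x) = enorm x.
Proof. by rewrite -scaleN1r enormZ normrN1 mul1r. Qed.

Lemma enormB x y : enorm (x - y) = enorm (y - x).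
Proof. by rewrite -enormN opprB. Qed.

Lemma coord_le_enorm x i : `|x 0 i| <= enorm x.
Proof.
rewrite -(ler_pXn2r (ltn0Sn 1)) ?nnegrE ?enorm_ge0// enorm_sum real_normK ?num_real//.
by rewrite (bigD1 i)//= lerDl sumr_ge0// => j _; exact: sqr_ge0.
Qed.

Lemma enorm_le x (M : R) : (forall i, `|x 0 i| <= M) -> enorm x <= n%:R * M.
Proof.
have [n0|n0] := eqVneq n 0%N.
  move=> _; rewrite (_ : n%:R = 0 :> R) ?n0// mul0r /enorm (_ : dot x x = 0) ?sqrtr0//.
  by rewrite /dot big1// => -[i hi]; exfalso; move: hi; rewrite n0.
move=> h; have M0 : 0 <= M.
  have : (0 < n)%N by rewrite lt0n.
  by move=> i0; apply: le_trans (h (Ordinal i0)).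
have nM : 0 <= n%:R * M by rewrite mulr_ge0.
rewrite -(ler_pXn2r (ltn0Sn 1)) ?nnegrE ?enorm_ge0// enorm_sum.
apply: (@le_trans _ _ (\sum_(i < n) M ^+ 2)).
  apply: ler_sum => i _; rewrite -real_normK ?num_real//.
  by rewrite ler_pXn2r ?nnegrE.
rewrite sumr_const card_ord -[leLHS]mulr_natl exprMn ler_wpM2r ?sqr_ge0//.
by rewrite expr2 -natrM ler_nat leq_pmull// lt0n.
Qed.

Lemma enorm_eq0 x : enorm x = 0 -> x = 0.
Proof.
move=> x0; apply/rowP => i; rewrite mxE; apply/eqP; rewrite -normr_le0 -x0.
exact: coord_le_enorm.
Qed.

Lemma cauchy_schwarz x y : dot x y <= enorm x * enorm y.
Proof.
have [x0|x0] := eqVneq (enorm x) 0.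
  rewrite x0 mul0r /dot big1// => i _.
  by rewrite (enorm_eq0 x0) mxE mul0r.
have [y0|y0] := eqVneq (enorm y) 0.
  rewrite y0 mulr0 /dot big1// => i _.
  by rewrite (enorm_eq0 y0) mxE mulr0.
have xy : 0 < enorm x * enorm y by rewrite mulr_gt0// lt0r ?x0 ?y0 enorm_ge0.
have := dot_ge0 (enorm y *: x - enorm x *: y).
rewrite -scaleN1r !(dotDl, dotDr, dotZl, dotZr) -!enorm_sqr (dotC y x) => h.
rewrite -(ler_pM2r xy).
by move: (enorm x) (enorm y) (dot x y) h => a b d h; lra.
Qed.

Lemma enormD x y : enorm (x + y) <= enorm x + enorm y.
Proof.
rewrite -(ler_pXn2r (ltn0Sn 1)) ?nnegrE ?addr_ge0 ?enorm_ge0//.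
rewrite enorm_sqr !(dotDl, dotDr) (dotC y x) -!enorm_sqr.
have := cauchy_schwarz x y.
by move: (enorm x) (enorm y) (dot x y) => a b d h; lra.
Qed.

Lemma normr_dot_le x y : `|dot x y| <= enorm x * enorm y.
Proof.
rewrite ler_norml cauchy_schwarz andbT lerNl -mulN1r -dotZl scaleN1r.
by rewrite -(enormN x) cauchy_schwarz.
Qed.

Lemma eball_center c r : 0 < r -> eball c r c.
Proof. by rewrite /eball /= subrr enorm0. Qed.

Lemma le_eball c r s : r <= s -> eball c r `<=` eball c s.
Proof. by move=> rs x /lt_le_trans; apply. Qed.

Lemma eball_sub c y r s : enorm (y - c) + r <= s -> eball y r `<=` eball c s.
Proof.
rewrite /eball => h x /= xy; have := enormD (x - y) (y - c).
by rewrite addrA subrK => h2; apply: le_lt_trans h2 _; lra.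
Qed.

Lemma eball_open c r : open (eball c r).
Proof.
rewrite openE => x xc; rewrite /interior.
apply/nbhs_ballP; exists ((r - enorm (x - c)) / n.+1%:R) => /=.
  by rewrite divr_gt0// subr_gt0.
move=> y [e0 xy]; have : enorm (y - x) <= n%:R * ((r - enorm (x - c)) / n.+1%:R).
  apply: enorm_le => i; rewrite !mxE distrC ltW//; exact: xy.
move=> h; have h2 : enorm (y - x) < r - enorm (x - c).
  apply: le_lt_trans h _; rewrite mulrA ltr_pdivrMr// mulrC ltr_pM2l ?subr_gt0//.
  by rewrite ltr_nat.
by rewrite /eball /= in xc *; have := enormD (y - x) (x - c);
  rewrite addrA subrK => h3; lra.
Qed.

Lemma bounded_eball c r : exists M, forall x, eball c r x -> forall i, `|x 0 i| < M.
Proof.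
exists (enorm c + r) => x; rewrite /eball /= => xc i.
apply: le_lt_trans (coord_le_enorm _ _) _.
by have := enormD (x - c) c; rewrite subrK => h; lra.
Qed.

Definition cbox (a b : E) : set E := [set x | forall i, a 0 i <= x 0 i <= b 0 i].

(** The boxes with rational centre and inverse integer size form a countable
    basis of neighbourhoods, even with their closures. *)
Lemma box_basis : exists p : nat -> E * E, forall (A : set E) x, open A -> A x ->
  exists k, box (p k).1 (p k).2 x /\ cbox (p k).1 (p k).2 `<=` A.
Proof.
have [d [d0 dlim]] : exists d : nat -> R, (forall m, 0 < d m) /\
    forall e, 0 < e -> exists m, d m < e.
  exists (fun m => m.+1%:R^-1); split; first by move=> m; rewrite invr_gt0.
  move=> e e0; have [m _ hm] := near_infty_natSinv_lt (PosNum e0).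
  by exists m; apply: hm; rewrite /=.
pose B (p : 'rV[rat]_n * nat) : E * E :=
  (\row_i (ratr (p.1 0 i) - d p.2), \row_i (ratr (p.1 0 i) + d p.2)).
exists (fun k => if (unpickle k : option ('rV[rat]_n * nat)) is Some p then B p else (0, 0)).
move=> A x oA Ax; have /nbhs_ballP[e /= e0 he] := open_nbhs_nbhs (conj oA Ax).
have [m hm] := dlim (e / 2) (divr_gt0 e0 (ltr0n R 2)).
have hq i : exists q : rat, `|x 0 i - ratr q| < d m.
  have m0 := d0 m.
  have [|q] := @rat_in_itvoo R (x 0 i - d m) (x 0 i + d m); first lra.
  rewrite in_itv/= => /andP[h1 h2]; exists q; rewrite ltr_norml; apply/andP; split; lra.
pose q := \row_i xchoose (hq i).
have qP i : `|x 0 i - ratr (q 0 i)| < d m by rewrite mxE; exact: (xchooseP (hq i)).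
exists (pickle (q, m)); rewrite pickleK /=; split.
  by move=> i; rewrite !mxE; have := qP i; rewrite mxE ltr_norml => /andP[h1 h2];
    apply/andP; split; lra.
move=> y yB; apply: he; split=> // j i; rewrite !ord1 /ball /=.
have := yB i; rewrite !mxE /=; have := qP i; rewrite mxE.
by rewrite !ltr_norml => /andP[h1 h2] /andP[h3 h4]; apply/andP; split; lra.
Qed.

Lemma open_measurable_rV (A : set E) : open A -> measurable A.
Proof.
move=> oA; have [p hp] := box_basis.
pose P k := if pselect (cbox (p k).1 (p k).2 `<=` A) then box (p k).1 (p k).2 else set0.
rewrite (_ : A = \bigcup_k P k).
  apply: bigcup_measurable => k _; rewrite /P.
  by case: pselect => h //=; exact: measurable_box.
apply/seteqP; split=> x.
  move=> Ax; have [k [kx kA]] := hp _ _ oA Ax; exists k => //.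
  by rewrite /P; case: pselect.
move=> [k _]; rewrite /P; case: pselect => [h /= xB|//]; apply: h => i.
by have /andP[h1 h2] := xB i; rewrite !ltW.
Qed.

Lemma measurable_eball c r : measurable (eball c r).
Proof. by apply: open_measurable_rV; exact: eball_open. Qed.

Lemma continuous_measurable_rV (f : E -> R) : continuous f -> measurable_fun setT f.
Proof.
move=> /continuousP cf; apply: (measurability _ (RGenOpens.measurableE R)).
move=> _ [_ [a [b ->] <-]]; rewrite setTI.
by apply: open_measurable_rV; apply: cf; exact: interval_open.
Qed.

Lemma aff_continuous c r : continuous (@aff R n c r).
Proof.
move=> x; apply: (@continuousD _ _ _ (cst c) ( *:%R r)).
  exact: cst_continuous.
exact: scaler_continuous.
Qed.

Lemma aff_eball c y r s : 0 < r -> aff c r @^-1` (eball (aff c r y) (r * s)) = eball y s.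
Proof.
move=> r0; apply/seteqP; split=> x; rewrite /eball /aff /=;
  by rewrite opprD addrACA subrr add0r -scalerBr enormZ gtr0_norm// ltr_pM2l.
Qed.

Lemma measure_bounded (A : set E) (M : R) : measurable A ->
  (forall x, A x -> forall i, `|x 0 i| < M) -> (mu A < +oo)%E.
Proof.
move=> mA hA; apply: (@le_lt_trans _ _ (mu (box (const_mx (- M)) (const_mx M)))).
  apply: le_measure; rewrite ?inE//; first exact: measurable_box.
  by move=> x /hA h i; rewrite !mxE -ltr_norml.
by rewrite box_measure ltry.
Qed.

Lemma measure_eball_lty c r : (mu (eball c r) < +oo)%E.
Proof.
have [M hM] := bounded_eball c r.
by apply: (measure_bounded _ hM); exact: measurable_eball.
Qed.

Lemma measure_eball_fin c r : mu (eball c r) \is a fin_num.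
Proof. by rewrite ge0_fin_numE// measure_eball_lty. Qed.

Lemma measure_eball c r : 0 < r ->
  mu (eball c r) = ((r ^+ n)%:E * mu (eball 0 1))%E.
Proof.
move=> r0; rewrite (@measure_aff R n c r)//; last exact: measurable_eball.
congr (_ * mu _)%E; rewrite -(@aff_eball c 0 r 1)//.
by rewrite mulr1 /aff scaler0 addr0.
Qed.

Lemma vol_eball c r : 0 < r -> vol (eball c r) = r ^+ n * vol (eball (0 : E) 1).
Proof. by move=> r0; rewrite /vol (measure_eball c r0) fineM// measure_eball_fin. Qed.

Lemma vol_eball_gt0 c r : 0 < r -> 0 < vol (eball c r).
Proof.
move=> r0; rewrite vol_eball// mulr_gt0 ?exprn_gt0// /vol fine_gt0// measure_eball_lty andbT.
pose e : R := n.+1%:R^-1.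
have e0 : 0 < e by rewrite /e invr_gt0.
apply: (@lt_le_trans _ _ (mu (box (const_mx (- e)) (const_mx e)))).
  rewrite box_measure lte_fin prodr_gt0// => i _; rewrite !mxE lt_max opprK.
  by rewrite addr_gt0// orbT.
apply: le_measure; rewrite ?inE//; [exact: measurable_box|exact: measurable_eball|].
move=> x hx; rewrite /eball /= subr0; apply: (@le_lt_trans _ _ (n%:R * e)).
  by apply: enorm_le => i; have := hx i; rewrite !mxE -ltr_norml => /ltW.
by rewrite /e ltr_pdivrMr// mul1r ltr_nat.
Qed.

End euclid.

(** * Smooth functions, cutoffs and bumps *)

Section flat_functions.
Context (R : realType).

(** Reduces directional derivatives to derivatives in one real variable, to which the
    chain rule of the real line applies. *)
Lemma is_derive_line (V : normedModType R) (f : V -> R) (x v : V) (d : R) :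
  is_derive x v f d <-> is_derive (0 : R) 1 (fun h : R => f (h *: v + x)) d.
Proof.
have E : (fun h : R => h^-1 *: ((f \o shift x) (h *: v) - f x)) =
         (fun h : R => h^-1 *: (((fun h : R => f (h *: v + x)) \o shift 0) (h *: (1 : R))
            - (fun h : R => f (h *: v + x)) 0)).
  by apply/funext => h /=; rewrite scale0r add0r addr0 [h *: 1]mulr1.
by split=> -[h1 h2]; split; move: h1 h2; rewrite /derivable /derive ?E // -?E.
Qed.

Lemma is_derive_chain (V : normedModType R) (g : R -> R) (f : V -> R) (x v : V) (a b : R) :
  is_derive (f x) 1 g a -> is_derive x v f b -> is_derive x v (g \o f) (a * b).
Proof.
move=> ha /is_derive_line hb; apply/is_derive_line.
by apply: (@is_derive1_comp _ g (fun h => f (h *: v + x))) hb; rewrite scale0r add0r.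
Qed.

(** The functions [t^-j exp (-1/t)], extended by zero to [t <= 0], form a family
    closed under differentiation, up to linear combinations. *)
Definition flat (j : nat) (t : R) : R := if 0 < t then t ^- j * expR (- t^-1) else 0.

Lemma flat_ge0 j t : 0 <= flat j t.
Proof. by rewrite /flat; case: ltP => // t0; rewrite mulr_ge0 ?expR_ge0// invr_ge0 exprn_ge0// ltW. Qed.

Lemma flat_gt0 j t : 0 < t -> 0 < flat j t.
Proof. by move=> t0; rewrite /flat t0 mulr_gt0 ?expR_gt0// invr_gt0 exprn_gt0. Qed.

Lemma flat_le0 j t : t <= 0 -> flat j t = 0.
Proof. by move=> t0; rewrite /flat ltNge t0. Qed.

Lemma flat0_le1 t : flat 0 t <= 1.
Proof.
rewrite /flat; case: ltP => // t0; rewrite expr0 invr1 mul1r -expR0 ler_expR.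
by rewrite oppr_le0 invr_ge0 ltW.
Qed.

(** The exponential dominates every power; a quadratic bound is enough for the
    derivative at zero to vanish. *)
Lemma flat_le_sqr j t : flat j t <= (j.+2)`!%:R * t ^+ 2.
Proof.
rewrite /flat; case: ltP => [t0|_]; last by rewrite mulr_ge0// sqr_ge0.
have h : (t^-1) ^+ j.+2 / (j.+2)`!%:R <= expR t^-1.
  have t1 : 0 <= t^-1 by rewrite invr_ge0 ltW.
  by apply: le_trans (expR_ge1Dxn j.+1 t1); rewrite lerDr.
have f0 : 0 < (j.+2)`!%:R :> R by rewrite ltr0n fact_gt0.
rewrite expRN ler_pdivrMr ?expR_gt0//.
rewrite ler_pdivrMr// in h; have := ler_wpM2r (sqr_ge0 t) h.
rewrite (_ : t^-1 ^+ j.+2 * t ^+ 2 = t ^- j); last first.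
  by rewrite -[j.+2]addn2 exprD exprVn; field; rewrite expf_neq0 gt_eqF.
by move=> /le_trans; apply; apply: eq_ler; ring.
Qed.

Lemma is_derive_flat j (t : R) :
  is_derive t 1 (flat j) (- j%:R * flat j.+1 t + flat j.+2 t).
Proof.
have [t0|t0|->] := ltgtP t 0.
- rewrite !flat_le0 ?ltW// mulr0 addr0.
  apply: (@near_eq_is_derive _ _ _ (cst 0)).
  by near=> x; rewrite flat_le0//; apply/ltW; near: x; exact: lt_nbhsl.
- have tn : t != 0 by rewrite gt_eqF.
  have tj : t ^+ j != 0 by rewrite expf_neq0.
  have d1 : is_derive t 1 (fun t : R => t ^+ j) (j%:R * t ^+ j.-1).
    have -> : (fun t : R => t ^+ j) = id ^+ j by apply/funext => y; rewrite exprfctE.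
    by apply: is_derive_eq; rewrite [_ *: _]mulr1 /= mulr_natl.
  have d2 := @is_deriveV R (fun t => t ^+ j) t _ 1 tj d1.
  have d3 : is_derive t 1 (fun t : R => - t^-1) (t ^- 2).
    have d4 := @is_deriveV R id t 1 1 tn (is_derive_id _ _).
    have -> : (fun t : R => - t^-1) = - (fun t : R => t^-1) by [].
    by apply: is_derive_eq; rewrite [_ *: _]mulr1 opprK.
  have d4 := @is_derive1_comp R expR _ t _ _ (is_derive_expR _) d3.
  have D : is_derive t 1 ((fun t => (t ^+ j)^-1) * (expR \o (fun t => - t^-1)))
      (- j%:R * flat j.+1 t + flat j.+2 t).
    apply: is_derive_eq; rewrite /flat t0 /= /GRing.scale /=.
    case: j tj d1 d2 => [|j] tj d1 d2; first by rewrite !mul0r; field.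
    by rewrite /= !exprS; field; rewrite tn expf_neq0.
  apply: (near_eq_is_derive _ D); near=> x; rewrite /flat /= (_ : 0 < x)//.
  by near: x; exact: lt_nbhsr.
- rewrite !flat_le0// mulr0 addr0.
  have cv : (fun h : R => h^-1 *: ((flat j \o shift 0) (h *: (1 : R)) - flat j 0)) @ 0^' --> (0 : R).
    apply/cvgr0Pnorm_lt => e e0; have f0 : 0 < (j.+2)`!%:R :> R by rewrite ltr0n fact_gt0.
    near=> h; have h0 : h != 0 by near: h; exact: nbhs_dnbhs_neq.
    rewrite /= addr0 [h *: 1]mulr1 (flat_le0 j (lexx 0)) subr0 normrM normfV.
    rewrite (ger0_norm (flat_ge0 _ _)) mulrC ltr_pdivrMr ?normr_gt0//.
    apply: le_lt_trans (flat_le_sqr _ _) _;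
    rewrite -(@real_normK _ h) ?num_real// expr2 mulrA ltr_pM2r ?normr_gt0// -ltr_pdivlMl//.
    near: h; apply: dnbhs0_lt; by rewrite mulr_gt0// invr_gt0.
  by split; [exact: (cvgP _ cv)|exact: cvg_lim].
Unshelve. all: by end_near. Qed.

Lemma flat_continuous j : continuous (flat j).
Proof.
move=> t; apply: differentiable_continuous; apply/derivable1_diffP.
by have [] := is_derive_flat j t.
Qed.

End flat_functions.

Section smooth_calculus.
Context (R : realType) (n : nat).
Local Notation E := 'rV[R]_n.
Implicit Types (u v : E -> R) (k : nat).

(** A graded version of [smooth], suited to inductions in which the derivative of
    a function involves the function itself. *)
Fixpoint Ck k u : Prop :=
  (continuous u /\ forall i x, derivable u x (delta_mx 0 i)) /\
  (if k is k'.+1 then forall i, Ck k' (partial i u) else True).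

Lemma Ck_continuous k u : Ck k u -> continuous u.
Proof. by case: k => [|k] [[]]. Qed.

Lemma Ck_derivable k u : Ck k u -> forall i x, derivable u x (delta_mx 0 i).
Proof. by case: k => [|k] [[]]. Qed.

Lemma Ck_S k u : Ck k.+1 u -> Ck k u.
Proof.
elim: k u => [|k IH] u; first by move=> [? _]; split.
by move=> [h1 h2]; split=> // i; apply: IH; exact: h2.
Qed.

Lemma smooth_partial u i : smooth u -> smooth (partial i u).
Proof. by move=> su s; have := su (rcons s i); rewrite foldr_rcons. Qed.

Lemma smoothP u : smooth u <-> forall k, Ck k u.
Proof.
split.
  move=> su k; elim: k u su => [|k IH] u su.
    by split=> //; split; have [] := su [::].
  split; first by split; have [] := su [::].
  by move=> i; apply: IH; exact: smooth_partial.
move=> Cu s; elim/last_ind: s u Cu => [|s i IH] u Cu.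
  by split; [exact: Ck_continuous (Cu 0%N)|exact: Ck_derivable (Cu 0%N)].
by rewrite foldr_rcons; apply: IH => k; have [_] := Cu k.+1; apply.
Qed.

Lemma smooth_continuous u : smooth u -> continuous u.
Proof. by move=> /smoothP /(_ 0%N) /Ck_continuous. Qed.

Lemma smooth_is_derive u : smooth u -> forall i x,
  is_derive x (delta_mx 0 i) u (partial i u x).
Proof.
by move=> /smoothP /(_ 0%N) /Ck_derivable h i x; exact: derivableP.
Qed.

Lemma partialE u i (d : E -> R) :
  (forall x, is_derive x (delta_mx 0 i) u (d x)) -> partial i u = d.
Proof. by move=> h; apply/funext => x; rewrite /partial; have [_] := h x. Qed.

Lemma Ck_intro k u (d : 'I_n -> E -> R) : continuous u ->
  (forall i x, is_derive x (delta_mx 0 i) u (d i x)) ->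
  (forall i, Ck k (d i)) -> Ck k.+1 u.
Proof.
move=> cu du Cd; split; first by split=> // i x; have [] := du i x.
by move=> i; rewrite (partialE (du i)).
Qed.

Lemma Ck0_intro u (d : 'I_n -> E -> R) : continuous u ->
  (forall i x, is_derive x (delta_mx 0 i) u (d i x)) -> Ck 0 u.
Proof. by move=> cu du; split=> //; split=> // i x; have [] := du i x. Qed.

Lemma Ck_cst k (c : R) : Ck k (fun=> c).
Proof.
have H (c' : R) i x : is_derive x (delta_mx 0 i) ((fun=> c') : E -> R) 0.
  exact: (@is_derive_cst _ E R c').
have C (c' : R) : continuous ((fun=> c') : E -> R) by exact: cst_continuous.
elim: k c => [|k IH] c; first exact: (Ck0_intro (d := fun=> cst 0)).
exact: (Ck_intro (d := fun _ _ => 0)).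
Qed.

Lemma is_deriveDf (f g : E -> R) x w a b : is_derive x w f a -> is_derive x w g b ->
  is_derive x w (fun x => f x + g x) (a + b).
Proof. by move=> h1 h2; exact: (@is_deriveD _ _ _ f g). Qed.

Lemma is_deriveMf (f g : E -> R) x w a b : is_derive x w f a -> is_derive x w g b ->
  is_derive x w (fun x => f x * g x) (f x * b + a * g x).
Proof.
by move=> h1 h2; rewrite [a * _]mulrC; exact: (@is_deriveM _ _ f g).
Qed.

Lemma Ck_add k u v : Ck k u -> Ck k v -> Ck k (fun x => u x + v x).
Proof.
have C k' f g : Ck k' f -> Ck k' g -> continuous (fun x => f x + g x).
  by move=> hf hg x; apply: continuousD; [exact: (Ck_continuous hf)|exact: (Ck_continuous hg)].
have D k' f g : Ck k' f -> Ck k' g -> forall i x, is_derive x (delta_mx 0 i)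
    (fun x => f x + g x) (partial i f x + partial i g x).
  move=> hf hg i x; apply: is_deriveDf; apply: derivableP;
    [exact: (Ck_derivable hf)|exact: (Ck_derivable hg)].
elim: k u v => [|k IH] u v hu hv; first exact: (Ck0_intro (C _ _ _ hu hv) (D _ _ _ hu hv)).
apply: (Ck_intro (C _ _ _ hu hv) (D _ _ _ hu hv)) => i.
by apply: IH; [exact: hu.2|exact: hv.2].
Qed.

Lemma Ck_mul k u v : Ck k u -> Ck k v -> Ck k (fun x => u x * v x).
Proof.
have C k' f g : Ck k' f -> Ck k' g -> continuous (fun x => f x * g x).
  by move=> hf hg x; apply: continuousM; [exact: (Ck_continuous hf)|exact: (Ck_continuous hg)].
have D k' f g : Ck k' f -> Ck k' g -> forall i x, is_derive x (delta_mx 0 i)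
    (fun x => f x * g x) (f x * partial i g x + partial i f x * g x).
  move=> hf hg i x; apply: is_deriveMf; apply: derivableP;
    [exact: (Ck_derivable hf)|exact: (Ck_derivable hg)].
elim: k u v => [|k IH] u v hu hv; first exact: (Ck0_intro (C _ _ _ hu hv) (D _ _ _ hu hv)).
apply: (Ck_intro (C _ _ _ hu hv) (D _ _ _ hu hv)) => i.
by apply: Ck_add; apply: IH; [exact: Ck_S|exact: hv.2|exact: hu.2|exact: Ck_S].
Qed.

Lemma Ck_coord k (i : 'I_n) : Ck k (fun x => x 0 i).
Proof.
have D (j : 'I_n) x : is_derive x (delta_mx 0 j) (fun x : E => x 0 i) ((j == i)%:R).
  apply/is_derive_line.
  rewrite (_ : (fun h : R => _) = (fun h => h * (j == i)%:R + x 0 i)); last first.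
    by apply/funext => h; rewrite !mxE eqxx [j == i]eq_sym.
  have -> : (fun h : R => h * (j == i)%:R + x 0 i) = id * cst ((j == i)%:R) + cst (x 0 i) by [].
  by apply: is_derive_eq; rewrite /= /GRing.scale /= mulr0 add0r mulr1 addr0.
have C : continuous (fun x : E => x 0 i) by exact: coord_continuous.
case: k => [|k]; first exact: (Ck0_intro (d := fun j _ => (j == i)%:R)).
by apply: (Ck_intro (d := fun j _ => (j == i)%:R)) => // j; exact: Ck_cst.
Qed.

Lemma is_derive_aff c r u i x : derivable u (aff c r x) (delta_mx 0 i) ->
  is_derive x (delta_mx 0 i) (u \o aff c r) (r * partial i u (aff c r x)).
Proof.
move=> /derivableP /is_derive_line h; apply/is_derive_line; rewrite mulrC.
rewrite (_ : (fun h : R => _) = (fun h : R => u (h *: delta_mx 0 i + aff c r x)) \o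
    (fun h => h * r)); last first.
  by apply/funext => y /=; congr u; rewrite /aff scalerDr scalerA addrCA mulrC.
apply: is_derive1_comp; first by rewrite mul0r; exact: h.
have -> : (fun h : R => h * r) = id * cst r by [].
by apply: is_derive_eq; rewrite /= /GRing.scale /= mulr0 add0r mulr1.
Qed.

Lemma Ck_aff k c r u : Ck k u -> Ck k (u \o aff c r).
Proof.
have C k' f : Ck k' f -> continuous (f \o aff c r).
  move=> hf x; apply: continuous_comp; first exact: aff_continuous.
  exact: (Ck_continuous hf).
have D k' f : Ck k' f -> forall i x, is_derive x (delta_mx 0 i)
    (f \o aff c r) (r * partial i f (aff c r x)).
  by move=> hf i x; apply: is_derive_aff; exact: (Ck_derivable hf).
elim: k u => [|k IH] u hu; first exact: (Ck0_intro (C _ _ hu) (D _ _ hu)).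
apply: (Ck_intro (C _ _ hu) (D _ _ hu)) => i.
by apply: Ck_mul; [exact: Ck_cst|apply: (IH (partial i u)); exact: hu.2].
Qed.

Lemma partial_aff c r u i : smooth u ->
  partial i (u \o aff c r) = fun x => r * partial i u (aff c r x).
Proof.
move=> /smooth_is_derive h; apply: partialE => x; apply: is_derive_aff.
by have [] := h i (aff c r x).
Qed.

Lemma smooth_aff c r u : smooth u -> smooth (u \o aff c r).
Proof. by move=> /smoothP h; apply/smoothP => k; exact: Ck_aff. Qed.

Lemma smooth_cst (c : R) : smooth ((fun=> c) : E -> R).
Proof. by apply/smoothP => k; exact: Ck_cst. Qed.

Lemma smooth_coord (i : 'I_n) : smooth (fun x : E => x 0 i).
Proof. by apply/smoothP => k; exact: Ck_coord. Qed.

Lemma smoothD u v : smooth u -> smooth v -> smooth (fun x => u x + v x).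
Proof. by move=> /smoothP hu /smoothP hv; apply/smoothP => k; exact: Ck_add. Qed.

Lemma smoothM u v : smooth u -> smooth v -> smooth (fun x => u x * v x).
Proof. by move=> /smoothP hu /smoothP hv; apply/smoothP => k; exact: Ck_mul. Qed.

Lemma smoothZ (c : R) u : smooth u -> smooth (fun x => c * u x).
Proof. by apply: smoothM; exact: smooth_cst. Qed.

Lemma smoothB u v : smooth u -> smooth v -> smooth (fun x => u x - v x).
Proof.
move=> hu hv; rewrite (_ : (fun x => _) = (fun x => u x + -1 * v x)).
  exact: (smoothD hu (smoothZ (-1) hv)).
by apply/funext => x; rewrite mulN1r.
Qed.

Lemma smooth_sum (I : Type) (s : seq I) (F : I -> E -> R) :
  (forall i, smooth (F i)) -> smooth (fun x => \sum_(i <- s) F i x).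
Proof.
move=> hF; elim: s => [|i s IH].
  rewrite (_ : (fun x => _) = fun=> 0); first exact: smooth_cst.
  by apply/funext => x; rewrite big_nil.
rewrite (_ : (fun x => _) = fun x => F i x + \sum_(i <- s) F i x).
  exact: (smoothD (hF i) IH).
by apply/funext => x; rewrite big_cons.
Qed.

Lemma smooth_prod (I : Type) (s : seq I) (F : I -> E -> R) :
  (forall i, smooth (F i)) -> smooth (fun x => \prod_(i <- s) F i x).
Proof.
move=> hF; elim: s => [|i s IH].
  rewrite (_ : (fun x => _) = fun=> 1); first exact: smooth_cst.
  by apply/funext => x; rewrite big_nil.
rewrite (_ : (fun x => _) = fun x => F i x * \prod_(i <- s) F i x).
  exact: (smoothM (hF i) IH).
by apply/funext => x; rewrite big_cons.
Qed.

Lemma smooth_dot (b : E) : smooth (fun x => dot b x).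
Proof.
by apply: smooth_sum => i; apply: smoothM; [exact: smooth_cst|exact: smooth_coord].
Qed.

Lemma partialM u v i : smooth u -> smooth v ->
  partial i (fun x => u x * v x) = fun x => u x * partial i v x + partial i u x * v x.
Proof.
by move=> hu hv; apply: partialE => x; apply: is_deriveMf; exact: smooth_is_derive.
Qed.

Lemma partial_cst (c : R) i : partial i ((fun=> c) : E -> R) = fun=> 0.
Proof. by apply: partialE => x; exact: (@is_derive_cst _ E R c). Qed.

Lemma partial_affine a (b : E) i : partial i (fun x => a + dot b x) = fun=> b 0 i.
Proof.
apply: partialE => x; apply/is_derive_line.
rewrite (_ : (fun h : R => _) = (fun h => h * b 0 i + (a + dot b x))); last first.
  apply/funext => h; rewrite dotDr dotZr addrCA; congr (_ * _ + _).
  rewrite /dot (bigD1 i)//= big1 ?addr0; first by rewrite mxE !eqxx mulr1.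
  by move=> j ji; rewrite mxE (negbTE ji) andbF mulr0.
have -> : (fun h : R => h * b 0 i + (a + dot b x)) = id * cst (b 0 i) + cst (a + dot b x) by [].
by apply: is_derive_eq; rewrite /= /GRing.scale /= mulr0 add0r mulr1 addr0.
Qed.

Lemma smooth_affine a (b : E) : smooth (fun x => a + dot b x).
Proof. by apply: smoothD; [exact: smooth_cst|exact: smooth_dot]. Qed.

Lemma smooth_flat j u : smooth u -> smooth (fun x => flat j (u x)).
Proof.
move=> hu; have /smoothP Cu := hu; apply/smoothP => k.
have C m : continuous (fun x => flat m (u x)).
  move=> x; apply: (continuous_comp (g := flat m)); first exact: (smooth_continuous hu).
  exact: flat_continuous.
have D m i x : is_derive x (delta_mx 0 i) (fun x => flat m (u x))
    ((- m%:R * flat m.+1 (u x) + flat m.+2 (u x)) * partial i u x).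
  by apply: is_derive_chain; [exact: is_derive_flat|exact: smooth_is_derive].
elim: k j => [|k IH] j; first exact: (Ck0_intro (C j) (D j)).
apply: (Ck_intro (C j) (D j)) => i; apply: Ck_mul; last by have [_] := Cu k.+1; apply.
by apply: Ck_add => //; apply: Ck_mul => //; exact: Ck_cst.
Qed.

Lemma smooth_inv u : (forall x, u x != 0) -> smooth u -> smooth (fun x => (u x)^-1).
Proof.
move=> u0 hu; have /smoothP Cu := hu; apply/smoothP => k.
have C : continuous (fun x => (u x)^-1).
  by move=> x; apply: continuousV => //; exact: (smooth_continuous hu).
have D i x : is_derive x (delta_mx 0 i) (fun x => (u x)^-1)
    (-1 * ((u x)^-1 * (u x)^-1) * partial i u x).
  apply: (is_derive_chain (g := @GRing.inv R)); last exact: smooth_is_derive.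
  have := @is_deriveV R id (u x) 1 1 (u0 x) (is_derive_id _ _).
  by rewrite [_ *: _]mulr1 mulN1r expr2 invfM.
elim: k => [|k IH]; first exact: (Ck0_intro C D).
apply: (Ck_intro C D) => i; apply: Ck_mul; last by have [_] := Cu k.+1; apply.
by apply: Ck_mul; [exact: Ck_cst|exact: Ck_mul].
Qed.

End smooth_calculus.

(** * Test functions *)

Section test_functions.
Context (R : realType) (n : nat).
Local Notation E := 'rV[R]_n.
Implicit Types (u v phi : E -> R) (Om D : set E).

(** A quotient [N / (N + N')] of flat functions of the squared norm, where [N] vanishes
    outside the large ball and [N'] inside the small one, and never both. *)
Lemma smooth_cutoff (a b : R) : 0 <= a -> a < b -> exists chi : E -> R,
  [/\ smooth chi, forall x, 0 <= chi x <= 1, forall x, enorm x <= a -> chi x = 1 &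
      forall x, b <= enorm x -> chi x = 0].
Proof.
move=> a0 ab; have b0 : 0 <= b by apply: le_trans a0 (ltW ab).
pose N (x : E) := flat 0 (b ^+ 2 - dot x x).
pose D (x : E) := N x + flat 0 (dot x x - a ^+ 2).
have sq : smooth (fun x : E => dot x x).
  by apply: smooth_sum => i; apply: smoothM; exact: smooth_coord.
have sN : smooth N.
  exact: (smooth_flat 0 (smoothB (smooth_cst (b ^+ 2)) sq)).
have sD : smooth D.
  exact: (smoothD sN (smooth_flat 0 (smoothB sq (smooth_cst (a ^+ 2))))).
have ab2 : a ^+ 2 < b ^+ 2 by rewrite ltr_pXn2r ?nnegrE.
have N0 x : 0 <= N x by exact: flat_ge0.
have D0 x : 0 < D x.
  rewrite /D /N; have [h|h] := ltP (dot x x) (b ^+ 2).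
    by rewrite ltr_pwDl ?flat_ge0// flat_gt0// subr_gt0.
  by rewrite ltr_wpDl ?flat_ge0// flat_gt0// subr_gt0 (lt_le_trans ab2).
exists (fun x => N x * (D x)^-1); split.
- apply: (smoothM sN); apply: (smooth_inv _ sD) => x; by rewrite gt_eqF.
- move=> x; rewrite mulr_ge0 ?invr_ge0 ?(ltW (D0 x))//=.
  by rewrite ler_pdivrMr// mul1r lerDl flat_ge0.
- move=> x xa; rewrite /D [flat 0 (_ - a ^+ 2)]flat_le0 ?addr0.
    rewrite mulfV// gt_eqF//; have := D0 x.
    rewrite /D [flat 0 (_ - a ^+ 2)]flat_le0 ?addr0//.
    by rewrite subr_le0 -enorm_sqr ler_pXn2r ?nnegrE ?enorm_ge0.
  by rewrite subr_le0 -enorm_sqr ler_pXn2r ?nnegrE ?enorm_ge0.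
- move=> x xb; rewrite /N flat_le0 ?mul0r//.
  by rewrite subr_le0 -enorm_sqr ler_pXn2r ?nnegrE ?enorm_ge0.
Qed.

Lemma smooth_box_bump (a b : E) : exists w : E -> R,
  [/\ smooth w, forall x, 0 <= w x & forall x, box a b x <-> 0 < w x].
Proof.
exists (fun x => \prod_(i < n) (flat 0 (x 0 i - a 0 i) * flat 0 (b 0 i - x 0 i))); split.
- have F i : smooth (fun x : E => flat 0 (x 0 i - a 0 i)).
    exact: (smooth_flat 0 (smoothB (smooth_coord R i) (smooth_cst (a 0 i)))).
  have G i : smooth (fun x : E => flat 0 (b 0 i - x 0 i)).
    exact: (smooth_flat 0 (smoothB (smooth_cst (b 0 i)) (smooth_coord R i))).
  exact: (smooth_prod _ (fun i => smoothM (F i) (G i))).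
- by move=> x; apply: prodr_ge0 => i _; rewrite mulr_ge0// flat_ge0.
- move=> x; split.
    by move=> h; apply: prodr_gt0 => i _; have /andP[h1 h2] := h i;
      rewrite mulr_gt0// flat_gt0// subr_gt0.
  move=> h i; apply/negPn/negP; rewrite negb_and -!leNgt => hi.
  suff E0 : \prod_(i < n) (flat 0 (x 0 i - a 0 i) * flat 0 (b 0 i - x 0 i)) = 0.
    by rewrite E0 ltxx in h.
  rewrite (bigD1 i)//=; move: hi => /orP[hi|hi].
    by rewrite flat_le0 ?mul0r// subr_le0.
  by rewrite [X in _ * X * _]flat_le0 ?mulr0 ?mul0r// subr_le0.
Qed.

Lemma flat_approx (t : R) : (fun k : nat => flat 0 (k%:R * t)) @ \oo -->
  (if 0 < t then 1 else 0 : R).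
Proof.
case: ltP => [t0|t0].
  rewrite -cvg_shiftS.
  rewrite (_ : (fun k => _) = (fun k => expR (- (t^-1 * k.+1%:R^-1)))); last first.
    apply/funext => k; rewrite /flat mulr_gt0// expr0 invr1 mul1r invfM.
    by rewrite [t^-1 * _]mulrC.
  suff : expR (- (t^-1 * k.+1%:R^-1)) @[k --> \oo] --> expR (0 : R) by rewrite expR0.
  apply: (@continuous_cvg _ _ _ _ _ _ expR); first exact: continuous_expR.
  rewrite -oppr0; apply: cvgN; rewrite -(mulr0 t^-1); apply: cvgMr.
  exact: cvg_harmonic.
rewrite (_ : (fun k => _) = fun=> 0); first exact: cvg_cst.
by apply/funext => k; rewrite flat_le0// mulr_ge0_le0.
Qed.

Lemma test_functionI Om (K : set E) phi : smooth phi -> compact K -> K `<=` Om ->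
  (forall x, phi x != 0 -> K x) -> test_function Om phi.
Proof.
move=> sphi cK KOm phiK.
have clK : closure [set x | phi x != 0] `<=` K.
  have /closure_id -> : closed K by apply: compact_closed => //; exact: norm_hausdorff.
  exact: closure_subset.
split=> //; last exact: subset_trans KOm.
by apply: subclosed_compact cK clK; exact: closed_closure.
Qed.

Lemma test_functionW D Om phi : D `<=` Om -> test_function D phi -> test_function Om phi.
Proof. by move=> DOm [h1 h2 h3]; split=> //; exact: subset_trans DOm. Qed.

Lemma test_function_out Om phi x : test_function Om phi -> ~ Om x -> phi x = 0.
Proof.
move=> [_ _ h] Ox; apply/eqP; apply: contra_notT Ox => x0.
by apply: h; exact: subset_closure.
Qed.

Lemma test_functionM Om u phi : smooth u -> test_function Om phi ->
  test_function Om (fun x => u x * phi x).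
Proof.
move=> su [sphi cphi phiOm]; apply: (test_functionI _ cphi phiOm); first exact: smoothM.
move=> x; rewrite mulf_eq0 negb_or => /andP[_ h]; exact: subset_closure.
Qed.

Lemma partial_out (A : set E) phi i x : (forall y, A y -> phi y = 0) ->
  A° x -> partial i phi x = 0.
Proof.
move=> h Ax; rewrite /partial -(derive_cst (0 : R) x (delta_mx 0 i)).
apply: near_eq_derive; near=> y; rewrite h//; near: y; exact: Ax.
Unshelve. all: by end_near. Qed.

Lemma test_function_partial Om phi i : test_function Om phi -> test_function Om (partial i phi).
Proof.
move=> [sphi cphi phiOm]; apply: (test_functionI _ cphi phiOm); first exact: smooth_partial.
move=> x; apply: contra_neqP => xn.
apply: (@partial_out (~` [set x | phi x != 0])).
  by move=> y /negP; rewrite negbK => /eqP.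
by rewrite interiorC.
Qed.

Lemma compact_bounded_fun (K : set E) u : compact K -> continuous u ->
  exists M, 0 <= M /\ forall x, K x -> `|u x| <= M.
Proof.
move=> cK cu; have /compact_bounded[M [_ hM]] : compact (u @` K).
  by apply: continuous_compact => //; exact: continuous_subspaceT.
exists (`|M| + 1); split; first by rewrite addr_ge0.
move=> x Kx; apply: hM; last by exists x.
by rewrite (le_lt_trans (ler_norm _))// ltrDl.
Qed.

Lemma test_function_bounded Om phi : test_function Om phi ->
  exists M, 0 <= M /\ forall x, `|phi x| <= M.
Proof.
move=> [sphi cphi _].
have [M [M0 hM]] := compact_bounded_fun cphi (smooth_continuous sphi).
exists M; split=> // x; have [->|x0] := eqVneq (phi x) 0; first by rewrite normr0.
by apply: hM; exact: subset_closure.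
Qed.

Lemma test_function_support Om phi : test_function Om phi ->
  exists M, forall x, phi x != 0 -> forall i, `|x 0 i| < M.
Proof.
move=> [sphi /compact_bounded[M [_ hM]] _].
exists (`|M| + 2) => x x0 i; apply: le_lt_trans (coord_le_norm _ _) _.
apply: (@le_lt_trans _ _ (`|M| + 1)); last by rewrite ltrD2l ltr1n.
apply: hM; last exact: subset_closure.
by rewrite (le_lt_trans (ler_norm _))// ltrDl.
Qed.

Lemma test_function_aff Om phi c r : r != 0 -> test_function Om phi ->
  test_function (aff c r @^-1` Om) (phi \o aff c r).
Proof.
move=> r0 [sphi cphi phiOm].
pose K := aff (- (r^-1 *: c)) r^-1 @` closure [set x | phi x != 0].
apply: (@test_functionI _ K).
- exact: smooth_aff.
- by apply: continuous_compact => //; apply: continuous_subspaceT; exact: aff_continuous.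
- by move=> _ [x xK <-]; rewrite /= affKV//; exact: phiOm.
- move=> x /= hx; exists (aff c r x); last exact: affK.
  exact: subset_closure.
Qed.

End test_functions.

(** * Square integrable functions and changes of variables *)

Section real_integrals.
Context (R : realType) (n : nat).
Local Notation E := 'rV[R]_n.
Local Notation mu := (lebesgue_rV R n).
Implicit Types (u v w f : E -> R) (D A : set E).

Lemma integrableDR D f g : measurable D -> mu.-integrable D (EFin \o f) ->
  mu.-integrable D (EFin \o g) -> mu.-integrable D (EFin \o (fun x => f x + g x)).
Proof. by move=> mD hf hg; exact: (integrableD mD hf hg). Qed.

Lemma integrableZR D (k : R) f : measurable D -> mu.-integrable D (EFin \o f) ->
  mu.-integrable D (EFin \o (fun x => k * f x)).
Proof. by move=> mD hf; exact: (integrableZl mD k hf). Qed.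

Lemma integrableBR D f g : measurable D -> mu.-integrable D (EFin \o f) ->
  mu.-integrable D (EFin \o g) -> mu.-integrable D (EFin \o (fun x => f x - g x)).
Proof. by move=> mD hf hg; exact: (integrableB mD hf hg). Qed.

Lemma le_integrableR D f g : measurable D -> measurable_fun D f ->
  (forall x, D x -> `|f x| <= g x) -> mu.-integrable D (EFin \o g) ->
  mu.-integrable D (EFin \o f).
Proof.
move=> mD mf fg; apply: le_integrable => //; first exact/measurable_EFinP.
by move=> x Dx; rewrite /= lee_fin (le_trans (fg x Dx))// ler_norm.
Qed.

Lemma integrable_meas D f : mu.-integrable D (EFin \o f) -> measurable_fun D f.
Proof. by move=> /integrableP[/measurable_EFinP]. Qed.

Lemma ae_eq_Rint D f g : measurable D -> measurable_fun D f -> measurable_fun D g ->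
  {ae mu, forall x, D x -> f x = g x} ->
  \int[mu]_(x in D) f x = \int[mu]_(x in D) g x.
Proof.
move=> mD mf mg fg; congr fine; apply: ae_eq_integral => //;
  try exact/measurable_EFinP.
by apply: filterS fg => x h Dx; rewrite /= h.
Qed.

Lemma integral_ext D Om (h : E -> \bar R) : D `<=` Om ->
  (forall x, Om x -> ~ D x -> h x = 0%E) ->
  (\int[mu]_(x in Om) h x = \int[mu]_(x in D) h x)%E.
Proof.
move=> DO f0; rewrite integral_mkcond [RHS]integral_mkcond; apply: eq_integral => x _.
rewrite !patchE; case: ifPn => xO; case: ifPn => xD //.
  by rewrite f0//; [move: xO; rewrite inE|move=> hx; move/negP : xD; apply; rewrite inE].
by exfalso; move/negP : xO; apply; move: xD; rewrite !inE; exact: DO.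
Qed.

Lemma Rintegral_ext D Om f : D `<=` Om -> (forall x, Om x -> ~ D x -> f x = 0) ->
  \int[mu]_(x in Om) f x = \int[mu]_(x in D) f x.
Proof.
by move=> DO f0; congr fine; apply: integral_ext => // x Ox Dx; rewrite /= f0.
Qed.

Lemma integrable_cstR D (k : R) : measurable D -> (mu D < +oo)%E ->
  mu.-integrable D (EFin \o (fun=> k)).
Proof.
move=> mD Dfin; apply/integrableP; split; first exact: measurable_cst.
rewrite (eq_integral (cst `|k|%:E))//; rewrite integral_cst//.
by apply: lte_mul_pinfty => //; rewrite lee_fin.
Qed.

Lemma integral_lty_EFin D f : measurable D -> mu.-integrable D (EFin \o f) ->
  (\int[mu]_(x in D) (f x)%:E)%E = (\int[mu]_(x in D) f x)%:E.
Proof. by move=> mD hf; rewrite fineK// (integrable_fin_num mD hf). Qed.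

(** Both sides are zero when the integral is infinite. *)
Lemma L2normE D u : L2norm D u = Num.sqrt (\int[mu]_(x in D) u x ^+ 2).
Proof.
rewrite /L2norm Lnorm.unlock /Rintegral.
rewrite (_ : (\int[mu]_x _)%E = (\int[mu]_(x in D) (u x ^+ 2)%:E)%E); last first.
  rewrite [RHS]integral_mkcond; apply: eq_integral => x _ /=.
  rewrite powR_mulrn// real_normK ?num_real// !patchE.
  by case: ifP => //; rewrite expr0n.
have : (0 <= \int[mu]_(x in D) (u x ^+ 2)%:E)%E.
  by apply: integral_ge0 => x _; rewrite lee_fin sqr_ge0.
case: (\int[mu]_(x in D) _)%E => [r| |] r0 //.
  by rewrite poweR_EFin /= powR12_sqrt.
by rewrite poweRyr ?invr_eq0//= sqrtr0.
Qed.

Lemma L2norm_ge0 D u : 0 <= L2norm D u.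
Proof. by rewrite L2normE sqrtr_ge0. Qed.

Lemma L2norm_sqr D u : L2norm D u ^+ 2 = \int[mu]_(x in D) u x ^+ 2.
Proof. by rewrite L2normE sqr_sqrtr// Rintegral_ge0// => x _; exact: sqr_ge0. Qed.

Lemma L2P D u : measurable D ->
  L2 D u <-> measurable_fun D u /\ mu.-integrable D (EFin \o (fun x => u x ^+ 2)).
Proof.
move=> mD; rewrite /L2 Lnorm.unlock.
rewrite (_ : (\int[mu]_x _)%E = (\int[mu]_(x in D) (u x ^+ 2)%:E)%E); last first.
  rewrite [RHS]integral_mkcond; apply: eq_integral => x _ /=.
  rewrite powR_mulrn// real_normK ?num_real// !patchE.
  by case: ifP => //; rewrite expr0n.
split=> -[mu1 h]; split=> //.
  apply/integrableP; split.
    apply/measurable_EFinP. exact: measurable_funX.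
  under eq_integral do rewrite /= ger0_norm ?sqr_ge0//.
  move: h; have : (0 <= \int[mu]_(x in D) (u x ^+ 2)%:E)%E.
    by apply: integral_ge0 => x _; rewrite lee_fin sqr_ge0.
  case: (\int[mu]_(x in D) _)%E => [r| |] // r0; first by move=> _; exact: ltry.
  by rewrite poweRyr ?invr_eq0.
by rewrite integral_lty_EFin// poweR_EFin ltry.
Qed.

Lemma L2_meas D u : L2 D u -> measurable_fun D u.
Proof. by case. Qed.

Lemma L2_integrable D u : measurable D -> L2 D u ->
  mu.-integrable D (EFin \o (fun x => u x ^+ 2)).
Proof. by move=> mD /(L2P _ mD)[]. Qed.

Lemma L2M D u v : measurable D -> L2 D u -> L2 D v ->
  mu.-integrable D (EFin \o (fun x => u x * v x)).
Proof.
move=> mD /(L2P _ mD)[mu1 iu] /(L2P _ mD)[mv iv].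
apply: (@le_integrableR _ _ (fun x => u x ^+ 2 + v x ^+ 2)) => //.
- exact: measurable_funM.
- move=> x _; rewrite normrM -(real_normK (num_real (u x))) -(real_normK (num_real (v x))).
  by have := normr_ge0 (u x); have := normr_ge0 (v x); nra.
- exact: integrableDR.
Qed.

Lemma L2_comb D (a : R) u v : measurable D -> L2 D u -> L2 D v ->
  L2 D (fun x => a * u x + v x).
Proof.
move=> mD hu hv; apply/L2P => //; split.
  by apply: measurable_funD; [apply: measurable_funM => //; exact: L2_meas|exact: L2_meas].
rewrite (_ : (fun x => _) = (fun x => a ^+ 2 * u x ^+ 2 + (2 * a * (u x * v x) + v x ^+ 2))).
  apply: integrableDR => //; first by apply: integrableZR => //; exact: L2_integrable.
  apply: integrableDR => //; last exact: L2_integrable.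
  by apply: integrableZR => //; exact: L2M.
by apply/funext => x; ring.
Qed.

Lemma L2_cst0 D : measurable D -> L2 D (fun=> 0).
Proof.
move=> mD; apply/L2P => //; split=> //.
by rewrite (_ : _ \o _ = cst 0%E); [exact: integrable0|apply/funext => x /=; rewrite expr0n].
Qed.

Lemma L2Z D (a : R) u : measurable D -> L2 D u -> L2 D (fun x => a * u x).
Proof.
move=> mD hu; rewrite (_ : (fun x => _) = fun x => a * u x + 0).
  by apply: L2_comb => //; exact: L2_cst0.
by apply/funext => x; rewrite addr0.
Qed.

Lemma L2D D u v : measurable D -> L2 D u -> L2 D v -> L2 D (fun x => u x + v x).
Proof.
move=> mD hu hv; rewrite (_ : (fun x => _) = fun x => 1 * u x + v x); first exact: L2_comb.
by apply/funext => x; rewrite mul1r.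
Qed.

Lemma L2B D u v : measurable D -> L2 D u -> L2 D v -> L2 D (fun x => u x - v x).
Proof.
move=> mD hu hv; rewrite (_ : (fun x => _) = fun x => -1 * v x + u x); first exact: L2_comb.
by apply/funext => x; rewrite mulN1r addrC.
Qed.

Lemma L2_bound D (M : R) (b : E -> R) u : measurable D -> measurable_fun D b ->
  (forall x, D x -> `|b x| <= M) -> L2 D u -> L2 D (fun x => b x * u x).
Proof.
move=> mD mb bM hu; apply/L2P => //; split.
  by apply: measurable_funM => //; exact: L2_meas.
apply: (@le_integrableR _ _ (fun x => M ^+ 2 * u x ^+ 2)) => //.
- by apply: measurable_funX; apply: measurable_funM => //; exact: L2_meas.
- move=> x Dx; rewrite ger0_norm ?sqr_ge0// exprMn ler_wpM2r ?sqr_ge0//.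
  by rewrite -(real_normK (num_real (b x))) ler_pXn2r ?nnegrE// ?bM// (le_trans _ (bM x Dx)).
- by apply: integrableZR => //; exact: L2_integrable.
Qed.

Lemma L2W D A u : measurable D -> measurable A -> A `<=` D -> L2 D u -> L2 A u.
Proof.
move=> mD mA AD /(L2P _ mD)[mu1 iu]; apply/L2P => //; split.
  exact: measurable_funS mu1.
exact: integrableS iu.
Qed.

Lemma eq_L2 D u v : {in D, u =1 v} -> L2 D u -> L2 D v.
Proof.
move=> uv [mu1 h]; split; first exact: eq_measurable_fun mu1.
rewrite (_ : v \_ D = u \_ D)//; apply/funext => x; rewrite !patchE.
by case: ifPn => // xD; rewrite uv.
Qed.

Lemma eq_L2norm D u v : {in D, u =1 v} -> L2norm D u = L2norm D v.
Proof.
by move=> uv; rewrite !L2normE; congr Num.sqrt; apply: eq_Rintegral => x xD; rewrite uv.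
Qed.

Lemma ae_eq_L2norm D u v : measurable D -> measurable_fun D u -> measurable_fun D v ->
  {ae mu, forall x, D x -> u x = v x} -> L2norm D u = L2norm D v.
Proof.
move=> mD mu1 mv uv; rewrite !L2normE; congr Num.sqrt.
apply: ae_eq_Rint => //; try exact: measurable_funX.
by apply: filterS uv => x h Dx; rewrite h.
Qed.

Lemma le_L2norm_set D A u : measurable D -> measurable A -> A `<=` D -> L2 D u ->
  L2norm A u <= L2norm D u.
Proof.
move=> mD mA AD hu; rewrite !L2normE ler_sqrt ?Rintegral_ge0//; last by move=> *; exact: sqr_ge0.
have iu := L2_integrable mD hu; have iA := integrableS mD mA AD iu.
rewrite -lee_fin -!integral_lty_EFin//; apply: ge0_subset_integral => //.
  by have /integrableP[] := iu.
by move=> x _; rewrite lee_fin sqr_ge0.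
Qed.

Lemma le_L2norm D u v : measurable D -> L2 D u -> L2 D v ->
  (forall x, D x -> u x ^+ 2 <= v x ^+ 2) -> L2norm D u <= L2norm D v.
Proof.
move=> mD hu hv uv; rewrite !L2normE ler_sqrt ?Rintegral_ge0//; last by move=> *; exact: sqr_ge0.
by apply: le_Rintegral => //; exact: L2_integrable.
Qed.

Lemma L2normZ D (a : R) u : measurable D -> L2 D u ->
  L2norm D (fun x => a * u x) = `|a| * L2norm D u.
Proof.
move=> mD hu; rewrite !L2normE -sqrtr_sqr -sqrtrM ?sqr_ge0//; congr Num.sqrt.
under eq_Rintegral do rewrite exprMn.
by rewrite RintegralZl//; exact: L2_integrable.
Qed.

Lemma L2norm0 D : L2norm D (fun=> 0 : R) = 0.
Proof.
rewrite L2normE (_ : (fun x : E => _) = fun=> 0) ?expr0n//.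
by rewrite /Rintegral integral0 /= sqrtr0.
Qed.

Lemma L2normD_sqr D u v : measurable D -> L2 D u -> L2 D v ->
  L2norm D (fun x => u x + v x) ^+ 2 <= 2 * L2norm D u ^+ 2 + 2 * L2norm D v ^+ 2.
Proof.
move=> mD hu hv; have iu := L2_integrable mD hu; have iv := L2_integrable mD hv.
rewrite !L2norm_sqr -!RintegralZl// -RintegralD//; try exact: integrableZR.
apply: le_Rintegral => //.
- by apply: L2_integrable => //; exact: L2D.
- by apply: integrableDR => //; exact: integrableZR.
- by move=> x _; rewrite -subr_ge0 (_ : _ - _ = (u x - v x) ^+ 2) ?sqr_ge0//; ring.
Qed.

Lemma L2_cauchy_schwarz D u v : measurable D -> L2 D u -> L2 D v ->
  `|\int[mu]_(x in D) (u x * v x)| <= L2norm D u * L2norm D v.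
Proof.
move=> mD hu hv; have iu := L2_integrable mD hu; have iv := L2_integrable mD hv.
have iuv := L2M mD hu hv.
set C := \int[mu]_(x in D) _; pose A := L2norm D u; pose B := L2norm D v.
have A0 : 0 <= A := L2norm_ge0 _ _; have B0 : 0 <= B := L2norm_ge0 _ _.
have Q s t : 0 <= s ^+ 2 * A ^+ 2 - 2 * s * t * C + t ^+ 2 * B ^+ 2.
  rewrite /A /B /C !L2norm_sqr -!RintegralZl// -RintegralB//; try exact: integrableZR.
  rewrite -RintegralD//; try exact: integrableZR.
    apply: Rintegral_ge0 => x _; rewrite (_ : _ + _ = (s * u x - t * v x) ^+ 2) ?sqr_ge0//.
    by ring.
  by apply: integrableBR => //; exact: integrableZR.
rewrite -/A -/B -(ler_pXn2r (ltn0Sn 1)) ?nnegrE ?mulr_ge0// real_normK ?num_real//.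
have [A1|A1] := eqVneq A 0.
  have [->|C0] := eqVneq C 0; first by rewrite expr0n sqr_ge0.
  have := Q ((B ^+ 2 + 1) / (2 * C)) 1; rewrite A1.
  rewrite (_ : _ + _ = - 1); first by rewrite oppr_ge0 ler10.
  by field.
have := Q C (A ^+ 2).
rewrite (_ : _ + _ = A ^+ 2 * ((A * B) ^+ 2 - C ^+ 2)); last by ring.
by rewrite pmulr_rge0 ?subr_ge0// exprn_gt0// lt0r A1.
Qed.

Lemma aff_preimage_measurable c (r : R) A : measurable A -> measurable (aff c r @^-1` A).
Proof.
by move=> mA; rewrite -[X in measurable X]setTI; exact: measurable_aff.
Qed.

Lemma measurable_fun_aff c (r : R) d (T : measurableType d) A (f : E -> T) :
  measurable A -> measurable_fun A f -> measurable_fun (aff c r @^-1` A) (f \o aff c r).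
Proof.
move=> mA mf; apply: (measurable_comp mA) => //; first by move=> _ [x Ax <-].
by apply: measurable_funTS; exact: measurable_aff.
Qed.

Lemma ge0_integral_aff c (r : R) D (f : E -> \bar R) : 0 < r -> measurable D ->
  measurable_fun D f -> (forall x, D x -> (0 <= f x)%E) ->
  (\int[mu]_(x in D) f x = (r ^+ n)%:E * \int[mu]_(x in aff c r @^-1` D) f (aff c r x))%E.
Proof.
move=> r0 mD mf f0; have rn0 : 0 <= r ^+ n by rewrite exprn_ge0// ltW.
have ma := measurable_aff c r.
pose m1 : {measure set E -> \bar R} := pushforward mu (aff c r).
rewrite (eq_measure_integral (mscale (NngNum rn0) (m1 ma))); last first.
  by move=> A mA _; exact: measure_aff.
rewrite ge0_integral_mscale//; congr (_ * _)%E; rewrite /= ge0_integral_pushforward//.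
by move=> x; rewrite inE; exact: f0.
Qed.

Lemma integrable_aff c (r : R) D f : 0 < r -> measurable D ->
  mu.-integrable D (EFin \o f) ->
  mu.-integrable (aff c r @^-1` D) (EFin \o (f \o aff c r)).
Proof.
move=> r0 mD hf; have mf := integrable_meas hf.
apply/integrableP; split; first by apply/measurable_EFinP; exact: measurable_fun_aff.
have /integrableP[_] := hf.
rewrite (ge0_integral_aff c r0 mD)//=; last first.
  by do 2 apply: measurableT_comp => //.
have rn0 : 0 < r ^+ n by rewrite exprn_gt0.
have : (0 <= \int[mu]_(x in aff c r @^-1` D) `|(f (aff c r x))%:E|)%E by exact: integral_ge0.
case: (\int[mu]_(x in _) _)%E => [s| |] //= _; first by move=> _; exact: ltry.
by rewrite gt0_muley ?lte_fin.
Qed.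

Lemma Rintegral_aff c (r : R) D f : 0 < r -> measurable D ->
  mu.-integrable D (EFin \o f) ->
  \int[mu]_(x in D) f x = r ^+ n * \int[mu]_(x in aff c r @^-1` D) f (aff c r x).
Proof.
move=> r0 mD hf; have hfa := integrable_aff c r0 mD hf.
have mD' := @aff_preimage_measurable c r _ mD.
apply: EFin_inj; rewrite EFinM -!integral_lty_EFin//.
rewrite integralE [in RHS]integralE muleBr//; last first.
  apply: fin_num_adde_defl; rewrite fin_numN.
  exact: (integrable_fin_num mD' (integrable_funeneg mD' hfa)).
have /integrableP[mE _] := hf.
congr (_ - _)%E; rewrite (ge0_integral_aff c r0 mD)//;
  try by congr (_ * _)%E; apply: eq_integral => x _; rewrite !(funeposE, funenegE).
- exact: measurable_funepos.
- exact: measurable_funeneg.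
Qed.

Lemma ae_aff c (r : R) (P : E -> Prop) : 0 < r -> {ae mu, forall x, P x} ->
  {ae mu, forall x, P (aff c r x)}.
Proof.
move=> r0 [N [mN N0 hN]]; exists (aff c r @^-1` N); split.
- exact: aff_preimage_measurable.
- move: N0; rewrite (measure_aff c r0 mN) => /eqP; rewrite mule_eq0 => /orP[|/eqP//].
  by rewrite eqe gt_eqF// exprn_gt0.
- by move=> x /= hx; apply: hN.
Qed.

Lemma L2_aff c (r : R) D u : 0 < r -> measurable D -> L2 D u ->
  L2 (aff c r @^-1` D) (u \o aff c r).
Proof.
move=> r0 mD /(L2P _ mD)[mu1 h]; apply/L2P; first exact: aff_preimage_measurable.
split; first exact: measurable_fun_aff.
exact: (integrable_aff c r0 mD h).
Qed.

Lemma L2norm_aff c (r : R) D u : 0 < r -> measurable D -> L2 D u ->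
  L2norm D u = Num.sqrt (r ^+ n) * L2norm (aff c r @^-1` D) (u \o aff c r).
Proof.
move=> r0 mD hu; rewrite !L2normE -sqrtrM ?exprn_ge0 ?ltW//; congr Num.sqrt.
by rewrite (Rintegral_aff c r0 mD)//; exact: L2_integrable.
Qed.

Lemma L2_smooth_bounded D u : measurable D -> (mu D < +oo)%E -> measurable_fun D u ->
  (exists M, forall x, D x -> `|u x| <= M) -> L2 D u.
Proof.
move=> mD Dfin mu1 [M hM]; apply/L2P => //; split=> //.
apply: (@le_integrableR _ _ (fun=> M ^+ 2)) => //.
- exact: measurable_funX.
- move=> x Dx; rewrite normrX ler_pXn2r ?nnegrE// ?hM// (le_trans _ (hM x Dx))//.
- exact: integrable_cstR.
Qed.

End real_integrals.

(** * Integration by parts and the fundamental lemma *)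

Section by_parts.
Context (R : realType) (n : nat).
Local Notation E := 'rV[R]_n.
Local Notation mu := (lebesgue_rV R n).
Implicit Types (u v phi h : E -> R) (Om D A : set E).

Lemma measurable_smooth phi D : smooth phi -> measurable_fun D phi.
Proof.
move=> sphi; apply: measurable_funTS; apply: continuous_measurable_rV.
exact: smooth_continuous.
Qed.

Lemma Rdominated_convergence D (f_ : nat -> E -> R) (f g : E -> R) : measurable D ->
  (forall k, measurable_fun D (f_ k)) -> measurable_fun D f ->
  (forall x, D x -> f_ k x @[k --> \oo] --> f x) ->
  mu.-integrable D (EFin \o g) ->
  (forall k x, D x -> `|f_ k x| <= g x) ->
  \int[mu]_(x in D) f_ k x @[k --> \oo] --> \int[mu]_(x in D) f x.
Proof.
move=> mD mf_ mf ff gi fg.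
have [||||ifE _ h] := @dominated_convergence _ _ _ mu D mD (fun k => EFin \o f_ k)
    (EFin \o f) (EFin \o g) _ _ _ gi _.
- by move=> k; exact/measurable_EFinP.
- exact/measurable_EFinP.
- by apply/nearW => x Dx; apply: cvg_EFin; [exact: nearW|exact: ff].
- by apply/nearW => x k Dx; rewrite /= lee_fin fg.
rewrite /Rintegral; apply: fine_cvg; rewrite fineK//.
exact: integrable_fin_num.
Qed.

Lemma integrable_restrict_cst (M N : R) :
  mu.-integrable setT (EFin \o ((fun=> M) \_ (box (const_mx (- N)) (const_mx N)))).
Proof.
rewrite -restrict_EFin.
apply/(integrable_mkcond (EFin \o (fun=> M)) (measurable_box _ _)).
by apply: integrable_cstR; [exact: measurable_box|rewrite box_measure ltry].
Qed.

Lemma test_function_dominated Om phi : test_function Om phi -> exists M N : R,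
  forall x, `|phi x| <= ((fun=> M) \_ (box (const_mx (- N)) (const_mx N))) x.
Proof.
move=> tphi; have [M [M0 hM]] := test_function_bounded tphi.
have [N hN] := test_function_support tphi; exists M, N => x.
rewrite patchE; case: ifPn => [_|/negP xN]; first exact: hM.
have [->|x0] := eqVneq (phi x) 0; first by rewrite normr0.
by exfalso; apply: xN; rewrite inE => j; rewrite !mxE -ltr_norml; exact: hN.
Qed.

Lemma difference_quotient_le phi i (M : R) : test_function setT phi ->
  (forall x, `|partial i phi x| <= M) -> forall x (t : R), 0 < t ->
  `|phi (t *: delta_mx 0 i + x) - phi x| <= M * t.
Proof.
move=> [sphi _ _] hM x t t0.
pose G (s : R) := phi (s *: delta_mx 0 i + x).
have dG (s : R) : is_derive s 1 G (partial i phi (s *: delta_mx 0 i + x)).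
  apply/is_derive_line; have /is_derive_line := smooth_is_derive sphi i (s *: delta_mx 0 i + x).
  congr (is_derive _ _ _ _); apply/funext => y; rewrite /G; congr phi.
  by rewrite [y *: 1]mulr1 scalerDl addrA.
have [|s _] := @MVT_segment R G (fun s : R => partial i phi (s *: delta_mx 0 i + x)) 0 t (ltW t0).
  by apply: derivable_within_continuous => s _; have [] := dG s.
rewrite /G scale0r add0r subr0 => ->; rewrite normrM (gtr0_norm t0).
by rewrite ler_pM2r.
Qed.

(** By translation invariance the integral of a difference quotient vanishes;
    let the step tend to zero. *)
Lemma Rintegral_partial phi i : test_function setT phi ->
  \int[mu]_(x in setT) partial i phi x = 0.
Proof.
move=> tphi; have [sphi _ _] := tphi.
have tdphi := test_function_partial i tphi; have [sdphi _ _] := tdphi.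
have [M [M0 hM]] := test_function_bounded tdphi.
have [N hN] := test_function_support tphi.
have iphi : mu.-integrable setT (EFin \o phi).
  have [M' [N' hphi]] := test_function_dominated tphi.
  apply: (le_integrableR _ _ (fun x _ => hphi x)) => //; first exact: measurable_smooth.
  exact: integrable_restrict_cst.
pose s (k : nat) : R := k.+1%:R^-1.
have s0 k : 0 < s k by rewrite invr_gt0.
pose q k x := (s k)^-1 * (phi (s k *: delta_mx 0 i + x) - phi x).
have affE k x : s k *: delta_mx 0 i + x = aff (s k *: delta_mx 0 i) 1 x.
  by rewrite /aff scale1r.
have mphi k : measurable_fun setT (fun x => phi (s k *: delta_mx 0 i + x)).
  rewrite (_ : (fun x => _) = phi \o aff (s k *: delta_mx 0 i) 1).
    by apply: measurable_smooth; exact: smooth_aff.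
  by apply/funext => x /=; rewrite affE.
have ishift k : mu.-integrable setT (EFin \o (fun x => phi (s k *: delta_mx 0 i + x))).
  have := integrable_aff (s k *: delta_mx 0 i) ltr01 measurableT iphi.
  by rewrite preimage_setT; congr (_.-integrable _ _); apply/funext => x /=; rewrite affE.
have q0 k : \int[mu]_(x in setT) q k x = 0.
  rewrite /q RintegralZl//; last exact: integrableBR.
  rewrite RintegralB// [X in _ - X](Rintegral_aff (s k *: delta_mx 0 i) ltr01)//.
  rewrite expr1n mul1r preimage_setT.
  under [X in _ * (_ - X)]eq_Rintegral do rewrite -affE.
  by rewrite subrr mulr0.
have : \int[mu]_(x in setT) q k x @[k --> \oo] --> \int[mu]_(x in setT) partial i phi x.
  apply: (@Rdominated_convergence _ _ _
      ((fun=> M) \_ (box (const_mx (- (N + 1))) (const_mx (N + 1))))) => //.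
  - move=> k; apply: measurable_funM => //; apply: measurable_funB => //.
    exact: measurable_smooth.
  - exact: measurable_smooth.
  - move=> x _; have [h1 h2] := smooth_is_derive sphi i x.
    have {}h1 : (fun t : R => t^-1 *: ((phi \o shift x) (t *: delta_mx 0 i) - phi x)) @ 0^' -->
        partial i phi x by exact: h1.
    move/cvgr_dnbhsP : h1 => /(_ s); apply; split; first by move=> k; rewrite gt_eqF.
    exact: cvg_harmonic.
  - exact: integrable_restrict_cst.
  - move=> k x _; rewrite patchE /q; case: ifPn => [_|/negP xN].
      rewrite normrM normfV (gtr0_norm (s0 k)) ler_pdivrMl// mulrC.
      exact: (difference_quotient_le tphi hM).
    have [j hj] : exists j, N + 1 <= `|x 0 j|.
      apply: contra_notP xN => /forallNP xN; rewrite inE => j; rewrite !mxE -ltr_norml.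
      by rewrite ltNge; apply/negP; exact: xN.
    have -> : phi x = 0.
      apply/eqP; apply: contraTT hj => /hN /(_ j); rewrite -ltNge => h.
      by apply: lt_trans h _; rewrite ltrDl.
    have -> : phi (s k *: delta_mx 0 i + x) = 0.
      apply/eqP; apply: contraTT hj => /hN /(_ j); rewrite -ltNge => h.
      have -> : x 0 j = (s k *: delta_mx 0 i + x) 0 j - (s k *: delta_mx 0 i : E) 0 j.
        by rewrite [in RHS]mxE addrAC subrr add0r.
      apply: le_lt_trans (ler_normB _ _) _.
      apply: ltr_leD => //; rewrite !mxE normrM (gtr0_norm (s0 k)).
      have sk1 : s k <= 1 by rewrite /s invf_le1 ?ler1n.
      by case: (_ && _); rewrite ?normr1 ?mulr1// normr0 mulr0.
    by rewrite subrr mulr0 normr0.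
under eq_fun do rewrite q0.
by move=> h; apply/esym; apply: (cvg_unique _ (cvg_cst 0) h).
Qed.

Lemma int_test_part Om phi i : measurable Om -> test_function Om phi ->
  \int[mu]_(x in Om) partial i phi x = 0.
Proof.
move=> mOm tphi; rewrite -(Rintegral_partial i (test_functionW (@subsetT _ Om) tphi)).
symmetry; apply: Rintegral_ext => // x _.
exact: test_function_out (test_function_partial i tphi).
Qed.

Lemma test_function_L2 Om D phi : measurable D -> test_function Om phi -> L2 D phi.
Proof.
move=> mD tphi; have [sphi _ _] := tphi.
have [M [N hphi]] := test_function_dominated (test_functionM sphi tphi).
apply: (@L2W _ _ setT) => //; apply/L2P => //; split; first exact: measurable_smooth.
apply: (le_integrableR _ _ (fun x _ => hphi x)) => //; last exact: integrable_restrict_cst.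
by apply: measurable_funM; exact: measurable_smooth.
Qed.

Lemma compact_cbox (a b : E) : compact (cbox a b).
Proof.
have := @rV_compact R n (fun i => `[a 0 i, b 0 i]%classic)
  (fun i => @segment_compact R (a 0 i) (b 0 i)).
congr compact; apply/seteqP; split=> x h i; have := h i; rewrite /= in_itv//=.
Qed.

Lemma box_sub_cbox (a b : E) : box a b `<=` cbox a b.
Proof. by move=> x h i; have /andP[h1 h2] := h i; rewrite !ltW. Qed.

Section fundamental_lemma.
Variables (Om : set E) (h : E -> R).
Hypotheses (oOm : open Om) (h2 : L2 Om h).
Hypothesis h0 : forall phi, test_function Om phi -> \int[mu]_(x in Om) (h x * phi x) = 0.

Let mOm : measurable Om := open_measurable_rV oOm.

(* The indicator of a box is the limit of the test functions [flat 0 (k w)], where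
   [w] is a smooth function positive exactly on that box. *)
Let box_int a b : cbox a b `<=` Om -> \int[mu]_(x in box a b) h x = 0.
Proof.
move=> abOm; have [w [sw w0 hw]] := smooth_box_bump a b.
have mB := measurable_box a b.
pose f_ k x := h x * flat 0 (k%:R * w x).
have tf k : test_function Om (fun x => flat 0 (k%:R * w x)).
  apply: (@test_functionI _ _ _ (cbox a b)) => //.
  - exact: (smooth_flat 0 (smoothZ k%:R sw)).
  - exact: compact_cbox.
  move=> x hx; apply: box_sub_cbox; apply/hw; rewrite lt0r w0 andbT.
  by apply: contraNneq hx => ->; rewrite mulr0 flat_le0.
have i1 : L2 Om ((fun=> 1 : R) \_ (box a b)).
  apply: (@L2W _ _ setT) => //; apply/L2P => //; split.
    apply/(measurable_restrictT _ mB); exact: measurable_cst.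
  have : mu.-integrable (box a b) (EFin \o (fun=> 1 : R)).
    by apply: integrable_cstR => //; rewrite box_measure ltry.
  move=> /(integrable_mkcond _ mB); rewrite restrict_EFin; congr (_.-integrable _ _).
  by apply/funext => x /=; rewrite !patchE; case: ifP => _; rewrite ?expr1n ?expr0n.
have i1h := L2M mOm h2 i1.
have -> : \int[mu]_(x in box a b) h x = \int[mu]_(x in Om) (h x * ((fun=> 1 : R) \_ (box a b)) x).
  rewrite [RHS](Rintegral_ext (subset_trans (@box_sub_cbox a b) abOm)); last first.
    by move=> x _ xB; rewrite patchE memNset// mulr0.
  by apply: eq_Rintegral => x xB; rewrite patchE xB mulr1.
have : \int[mu]_(x in Om) f_ k x @[k --> \oo] -->
    \int[mu]_(x in Om) (h x * ((fun=> 1 : R) \_ (box a b)) x).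
  have mh := L2_meas h2.
  apply: (@Rdominated_convergence _ _ _
     (fun x => `|h x * ((fun=> 1 : R) \_ (box a b)) x|)) => //.
  - by move=> k; apply: measurable_funM => //; apply: measurable_smooth; have [] := tf k.
  - by apply: measurable_funM => //; exact: L2_meas i1.
  - move=> x _; apply: cvgMr; have := @flat_approx R (w x).
    rewrite patchE (_ : (x \in box a b) = (0 < w x))//.
    by apply/idP/idP; rewrite inE; move/hw.
  - exact: (integrable_norm i1h).
  - move=> k x _; rewrite /f_ !normrM ler_wpM2l// patchE.
    have [xB|xB] := ifPn.
      by rewrite normr1 ger0_norm ?flat0_le1// flat_ge0.
    have -> : w x = 0.
      apply/eqP; rewrite eq_le w0 andbT leNgt; apply: contra xB => /hw.
      by rewrite inE.
    by rewrite mulr0 flat_le0.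
rewrite (_ : (fun k => _) = fun=> 0); last by apply/funext => k; exact: h0 (tf k).
by move=> hc; apply/esym; apply: (cvg_unique _ (cvg_cst 0) hc).
Qed.

(* The boxes generate the sigma-algebra and are stable under intersection: by Dynkin's
   lemma, the integral of [h] vanishes on every measurable subset of the box. *)
Let box_ae a b : cbox a b `<=` Om -> {ae mu, forall x, box a b x -> h x = 0}.
Proof.
move=> abOm; have mB := measurable_box a b.
have BO : box a b `<=` Om by apply: subset_trans abOm; exact: box_sub_cbox.
have hi : mu.-integrable (box a b) (EFin \o h).
  have hB := L2W mOm mB BO h2.
  have oneB : L2 (box a b) (fun=> 1 : R).
    apply: L2_smooth_bounded => //; first by rewrite box_measure ltry.
    by exists 1 => x _; rewrite normr1.
  by have := L2M mB hB oneB; congr (_.-integrable _ _); apply/funext => x /=; rewrite mulr1.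
have sub A : measurable A -> mu.-integrable (box a b `&` A) (EFin \o h).
  by move=> mA; apply: integrableS hi => //; exact: measurableI.
have all0 A : measurable A -> (\int[mu]_(x in box a b `&` A) (h x)%:E = 0)%E.
  move=> mA; have : <<s @boxes R n >> A by rewrite -boxes_gen.
  move: A mA; suff H : forall A, <<s @boxes R n >> A ->
     (\int[mu]_(x in box a b `&` A) (h x)%:E = 0)%E by move=> A _; exact: H.
  apply: (@dynkin_induction _ E (@boxes R n)).
  - exact: boxes_gen.
  - exact: boxes_setI.
  - by rewrite setIT integral_lty_EFin// box_int.
  - move=> _ [[c d] _ <-] /=; rewrite integral_lty_EFin ?box_setI.
    + rewrite box_int// => x xcd; apply: abOm => i; have := xcd i.
      rewrite !mxE ge_max le_min => /andP[/andP[? ?] /andP[? ?]]; exact/andP.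
    + exact: measurable_box.
    + by rewrite -box_setI; apply: sub; exact: measurable_box.
  - move=> A mA A0.
    have : (\int[mu]_(x in (box a b `&` A) `|` (box a b `&` ~` A)) (h x)%:E = 0)%E.
      by rewrite -setIUr setUv setIT integral_lty_EFin// box_int.
    rewrite integral_setU; first by rewrite A0 add0e.
    + exact: measurableI.
    + by apply: measurableI => //; exact: measurableC.
    + by rewrite -setIUr setUv setIT; have /integrableP[] := hi.
    + by apply/disj_setPS => x [[_ Ax] [_ nAx]].
  - move=> F mF tF F0; rewrite setI_bigcupr integral_bigcup.
    + by rewrite eseries0// => k _ _; exact: F0.
    + exact: trivIset_setIl.
    + by move=> k; exact: measurableI.
    + by rewrite -setI_bigcupr; apply: sub; exact: bigcup_measurable.
have := @integral_ae_eq _ _ _ mu _ mB (cst 0%E) _ hi (measurable_cst _).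
move=> /(_ _)/wrap[|]; last by apply: filterS => x hx xB; have [] := hx xB.
by move=> A AB mA; rewrite integral0 -(all0 _ mA) setIidr.
Qed.

(** Countably many boxes whose closures lie in [Om] cover [Om]. *)
Lemma fundamental_lemma : {ae mu, forall x, Om x -> h x = 0}.
Proof.
have [p hp] := @box_basis R n.
have : forall k, {ae mu, forall x,
    cbox (p k).1 (p k).2 `<=` Om -> box (p k).1 (p k).2 x -> h x = 0}.
  move=> k; have [pO|pO] := pselect (cbox (p k).1 (p k).2 `<=` Om).
    by apply: filterS (box_ae pO) => x hx _.
  by apply/nearW => x.
move=> /ae_foralln; apply: filterS => x hx Ox.
by have [k [xk kO]] := hp _ _ oOm Ox; exact: (hx k kO xk).
Qed.

End fundamental_lemma.

End by_parts.

(** * Weak gradients *)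

Section weak_gradients.
Context (R : realType) (n : nat).
Local Notation E := 'rV[R]_n.
Local Notation mu := (lebesgue_rV R n).
Implicit Types (u v w phi psi zeta chi : E -> R) (F G : E -> E) (Om D A : set E).

Definition wgrad Om u F := L2vec Om F /\ is_weak_gradient Om u F.

Definition nabla u : E -> E := fun x => \row_i partial i u x.

(** The difference of two weak gradients is orthogonal to all test functions. *)
Lemma wgrad_unique Om u F G : open Om -> wgrad Om u F -> wgrad Om u G ->
  {ae mu, forall x, Om x -> F x = G x}.
Proof.
move=> oO [LF hF] [LG hG]; have mO := open_measurable_rV oO.
have : \forall x \ae mu, forall i : 'I_n, Om x -> F x 0 i - G x 0 i = 0.
  apply: filter_forall => i; apply: fundamental_lemma => //; first exact: L2B.
  move=> phi tphi; have Lphi := test_function_L2 mO tphi.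
  under eq_Rintegral do rewrite mulrBl.
  rewrite RintegralB//; try exact: L2M.
  apply/eqP; rewrite subr_eq0; apply/eqP/oppr_inj.
  by rewrite -hF// -hG.
apply: filterS => x h Ox; apply/rowP => i; apply/eqP; rewrite -subr_eq0.
by apply/eqP; exact: h.
Qed.

Lemma gradP Om u : W12 Om u -> wgrad Om u (grad Om u).
Proof. by move=> [_ [F hF]]; rewrite /grad; exact: (xgetPex _ (ex_intro _ F hF)). Qed.

Lemma W12I Om u F : L2 Om u -> wgrad Om u F -> W12 Om u.
Proof. by move=> hu hF; split=> //; exists F. Qed.

Lemma grad_ae Om u F : open Om -> W12 Om u -> wgrad Om u F ->
  {ae mu, forall x, Om x -> grad Om u x = F x}.
Proof. by move=> oO hu hF; exact: (wgrad_unique oO (gradP hu) hF). Qed.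

Lemma integrable_sumR (I : Type) (s : seq I) D (f : I -> E -> R) : measurable D ->
  (forall i, mu.-integrable D (EFin \o f i)) ->
  mu.-integrable D (EFin \o (fun x => \sum_(i <- s) f i x)).
Proof.
move=> mD hf; elim: s => [|i s IH].
  rewrite (_ : _ \o _ = cst 0%E); first exact: integrable0.
  by apply/funext => x /=; rewrite big_nil.
rewrite (_ : _ \o _ = EFin \o (fun x => f i x + \sum_(j <- s) f j x)).
  exact: (integrableDR mD (hf i) IH).
by apply/funext => x /=; rewrite big_cons.
Qed.

Lemma L2vec_enorm D F : measurable D -> L2vec D F -> L2 D (fun x => enorm (F x)).
Proof.
move=> mD hF; apply/L2P => //; split; last first.
  under eq_fun do rewrite enorm_sum.
  by apply: integrable_sumR => // i; exact: (L2_integrable mD (hF i)).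
rewrite (_ : (fun x => _) = (@powR R ^~ 2^-1) \o (fun x => \sum_(i < n) F x 0 i ^+ 2)).
  apply: measurableT_comp; first exact: measurable_powR.
  by apply: measurable_sum => i; apply: measurable_funX; exact: L2_meas (hF i).
apply/funext => x; rewrite /comp powR12_sqrt -?(enorm_sum (F x)) ?sqr_ge0//.
by rewrite sqrtr_sqr ger0_norm// enorm_ge0.
Qed.

Lemma integrable_dot D F G : measurable D -> L2vec D F -> L2vec D G ->
  mu.-integrable D (EFin \o (fun x => dot (F x) (G x))).
Proof. by move=> mD hF hG; apply: integrable_sumR => // i; exact: L2M. Qed.

Lemma L2vec_comb D (a : R) F G : measurable D -> L2vec D F -> L2vec D G ->
  L2vec D (fun x => a *: F x + G x).
Proof.
move=> mD hF hG i; rewrite (_ : (fun x => _) = fun x => a * F x 0 i + G x 0 i).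
  exact: L2_comb.
by apply/funext => x; rewrite !mxE.
Qed.

Lemma L2vecW D A F : measurable D -> measurable A -> A `<=` D -> L2vec D F -> L2vec A F.
Proof. by move=> mD mA AD hF i; apply: L2W (hF i). Qed.

Lemma gradnormE Om D u F : open Om -> measurable D -> D `<=` Om -> W12 Om u ->
  wgrad Om u F -> gradnorm Om D u = L2norm D (fun x => enorm (F x)).
Proof.
move=> oO mD DO hu hF; have mO := open_measurable_rV oO; rewrite /gradnorm.
have LD G : L2vec Om G -> measurable_fun D (fun x => enorm (G x)).
  by move=> hG; apply: L2_meas; apply: L2vec_enorm => //; exact: L2vecW hG.
apply: ae_eq_L2norm => //; [exact: LD (gradP hu).1|exact: LD hF.1|].
by apply: filterS (grad_ae oO hu hF) => x h Dx; rewrite h//; exact: DO.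
Qed.

Lemma gradnorm_ge0 Om D u : 0 <= gradnorm Om D u.
Proof. exact: L2norm_ge0. Qed.

Lemma grad_L2 Om D u : open Om -> measurable D -> D `<=` Om -> W12 Om u ->
  L2 D (fun x => enorm (grad Om u x)).
Proof.
move=> oO mD DO hu; apply: L2vec_enorm => //.
by apply: L2vecW (gradP hu).1 => //; exact: open_measurable_rV.
Qed.

Lemma wgrad_comb Om (a : R) u v F G : open Om -> L2 Om u -> L2 Om v ->
  wgrad Om u F -> wgrad Om v G ->
  wgrad Om (fun x => a * u x + v x) (fun x => a *: F x + G x).
Proof.
move=> oO hu hv [LF hF] [LG hG]; have mO := open_measurable_rV oO.
split; first exact: L2vec_comb.
move=> phi i tphi; have Lphi := test_function_L2 mO tphi.
have Ldphi := test_function_L2 mO (test_function_partial i tphi).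
under eq_Rintegral do rewrite mulrDl -mulrA.
have i1 := L2M mO hu Ldphi; have i2 := L2M mO hv Ldphi.
have i3 := L2M mO (LF i) Lphi; have i4 := L2M mO (LG i) Lphi.
rewrite RintegralD//; last exact: integrableZR.
rewrite RintegralZl// hF// hG//.
have -> : \int[mu]_(x in Om) ((a *: F x + G x) 0 i * phi x) =
    \int[mu]_(x in Om) (a * (F x 0 i * phi x) + G x 0 i * phi x).
  by apply: eq_Rintegral => x _; rewrite !mxE mulrDl mulrA.
by rewrite RintegralD ?RintegralZl//; [rewrite opprD mulrN|exact: integrableZR].
Qed.

Lemma W12_comb Om (a : R) u v : open Om -> W12 Om u -> W12 Om v ->
  W12 Om (fun x => a * u x + v x).
Proof.
move=> oO hu hv; have mO := open_measurable_rV oO.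
apply: (W12I (L2_comb a mO hu.1 hv.1)).
exact: (wgrad_comb a oO hu.1 hv.1 (gradP hu) (gradP hv)).
Qed.

Lemma eq_wgrad Om u v F : {in Om, u =1 v} -> wgrad Om u F -> wgrad Om v F.
Proof.
move=> uv [LF hF]; split=> // phi i tphi; rewrite -hF//.
by apply: eq_Rintegral => x xO; rewrite uv.
Qed.

Lemma wgradW D Om u F : open D -> open Om -> D `<=` Om -> wgrad Om u F -> wgrad D u F.
Proof.
move=> oD oO DO [LF hF]; have mD := open_measurable_rV oD.
split; first by apply: L2vecW LF => //; exact: open_measurable_rV.
move=> phi i tphi; have := hF phi i (test_functionW DO tphi).
have key f (psi : E -> R) : test_function D psi ->
    \int[mu]_(x in D) (f x * psi x) = \int[mu]_(x in Om) (f x * psi x).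
  move=> tpsi; symmetry; apply: Rintegral_ext => // x _ Dx.
  by rewrite (test_function_out tpsi)// mulr0.
by rewrite -!key//; exact: test_function_partial.
Qed.

Lemma W12W D Om u : open D -> open Om -> D `<=` Om -> W12 Om u -> W12 D u.
Proof.
move=> oD oO DO hu; have Lu : L2 D u.
  by apply: L2W hu.1 => //; exact: open_measurable_rV.
exact: (W12I Lu (wgradW oD oO DO (gradP hu))).
Qed.

(** Test functions supported in [D] suffice to determine the gradient on [D]. *)
Lemma grad_local D Om Om' u v : open D -> open Om -> open Om' -> D `<=` Om ->
  D `<=` Om' -> W12 Om u -> W12 Om' v -> {in D, u =1 v} ->
  {ae mu, forall x, D x -> grad Om u x = grad Om' v x}.
Proof.
move=> oD oO oO' DO DO' hu hv uv; apply: (wgrad_unique oD (u := u)).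
  exact: wgradW (gradP hu).
apply: (eq_wgrad (u := v)); first by move=> x xD; rewrite uv.
exact: wgradW (gradP hv).
Qed.

Lemma gradnorm_local D Om Om' u v : open D -> open Om -> open Om' -> D `<=` Om ->
  D `<=` Om' -> W12 Om u -> W12 Om' v -> {in D, u =1 v} ->
  gradnorm Om D u = gradnorm Om' D v.
Proof.
move=> oD oO oO' DO DO' hu hv uv; have mD := open_measurable_rV oD.
apply: ae_eq_L2norm => //; try by apply: L2_meas; exact: grad_L2.
by apply: filterS (grad_local oD oO oO' DO DO' hu hv uv) => x h Dx; rewrite h.
Qed.

Lemma wgrad_smooth Om zeta : open Om -> smooth zeta -> L2 Om zeta ->
  (forall i, L2 Om (partial i zeta)) -> wgrad Om zeta (nabla zeta).
Proof.
move=> oO sz Lz Ldz; have mO := open_measurable_rV oO.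
split; first by move=> i; apply: eq_L2 (Ldz i) => x _; rewrite mxE.
move=> phi i tphi; have [sphi _ _] := tphi; have Lphi := test_function_L2 mO tphi.
have Ldphi := test_function_L2 mO (test_function_partial i tphi).
have := int_test_part i mO (test_functionM sz tphi).
rewrite partialM// RintegralD//; try exact: L2M.
move/eqP; rewrite addr_eq0 => /eqP ->; congr (- _).
by apply: eq_Rintegral => x _; rewrite mxE.
Qed.

Lemma wgrad_test Om phi : open Om -> test_function Om phi -> wgrad Om phi (nabla phi).
Proof.
move=> oO tphi; have mO := open_measurable_rV oO; have [sphi _ _] := tphi.
apply: wgrad_smooth => //; first exact: test_function_L2 tphi.
by move=> i; exact: test_function_L2 (test_function_partial i tphi).
Qed.

Lemma W12_test Om phi : open Om -> test_function Om phi -> W12 Om phi.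
Proof.
move=> oO tphi; apply: (W12I _ (wgrad_test oO tphi)).
exact: (test_function_L2 (open_measurable_rV oO) tphi).
Qed.

Lemma bounded_cbox Om : bounded_set Om -> exists N, Om `<=` cbox (const_mx (- N)) (const_mx N).
Proof.
move=> [M [_ hM]]; exists (`|M| + 1) => x Ox i; rewrite !mxE -ler_norml.
apply: le_trans (coord_le_norm _ _) _; apply: hM => //.
by rewrite (le_lt_trans (ler_norm _))// ltrDl.
Qed.

Lemma bounded_lty Om : open Om -> bounded_set Om -> (mu Om < +oo)%E.
Proof.
move=> oO /bounded_cbox[N hN]; apply: (@measure_bounded _ _ _ (N + 1)).
  exact: open_measurable_rV.
move=> x /hN h i; have := h i; rewrite !mxE -ler_norml => h'.
by apply: le_lt_trans h' _; rewrite ltrDl.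
Qed.

Lemma L2_smooth Om zeta : open Om -> bounded_set Om -> smooth zeta -> L2 Om zeta.
Proof.
move=> oO bO sz; have [N hN] := bounded_cbox bO.
have cK := @compact_cbox R n (const_mx (- N)) (const_mx N).
have [M [_ hM]] := compact_bounded_fun cK (smooth_continuous sz).
apply: L2_smooth_bounded; first exact: open_measurable_rV.
- exact: bounded_lty.
- exact: measurable_smooth.
- by exists M => x Ox; apply: hM; exact: hN Ox.
Qed.

Lemma wgrad_smooth_bounded Om zeta : open Om -> bounded_set Om -> smooth zeta ->
  wgrad Om zeta (nabla zeta).
Proof.
move=> oO bO sz; apply: wgrad_smooth => //; first exact: L2_smooth.
by move=> i; apply: L2_smooth => //; exact: smooth_partial.
Qed.

Lemma W12_smooth Om zeta : open Om -> bounded_set Om -> smooth zeta -> W12 Om zeta.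
Proof.
move=> oO bO sz; apply: (W12I _ (wgrad_smooth_bounded oO bO sz)).
exact: L2_smooth.
Qed.

Lemma nabla_affine a (b : E) : nabla (fun x => a + dot b x) = fun=> b.
Proof. by apply/funext => x; apply/rowP => i; rewrite mxE partial_affine. Qed.

End weak_gradients.

(** * Extension by zero, cutoffs and dilations in Sobolev spaces *)

Section sobolev_operations.
Context (R : realType) (n : nat).
Local Notation E := 'rV[R]_n.
Local Notation mu := (lebesgue_rV R n).
Implicit Types (u v w phi psi zeta chi : E -> R) (F G : E -> E) (Om D A : set E).

Definition ext0 (V : nmodType) D (f : E -> V) : E -> V := fun x => if x \in D then f x else 0.

Lemma ext0_in (V : nmodType) D (f : E -> V) x : D x -> ext0 D f x = f x.
Proof. by move=> Dx; rewrite /ext0 mem_set. Qed.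

Lemma ext0_out (V : nmodType) D (f : E -> V) x : ~ D x -> ext0 D f x = 0.
Proof. by move=> Dx; rewrite /ext0 memNset. Qed.

Lemma L2_ext D Om f : measurable D -> measurable Om -> D `<=` Om ->
  (forall x, Om x -> ~ D x -> f x = 0) -> L2 D f -> L2 Om f.
Proof.
move=> mD mO DO f0 /(L2P _ mD)[mf hf]; apply: (@eq_L2 _ _ Om (f \_ D)).
  move=> x; rewrite inE => Ox; rewrite patchE; case: ifPn => // xD.
  by rewrite f0// => h; move/negP : xD; apply; rewrite inE.
apply: (@L2W _ _ setT) => //; apply/L2P => //; split; first exact/(measurable_restrictT _ mD).
move/(integrable_mkcond _ mD) : hf; rewrite restrict_EFin; congr (_.-integrable _ _).
by apply/funext => x /=; rewrite !patchE; case: ifP => _; rewrite ?expr0n.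
Qed.

Lemma L2norm_ext D Om f : D `<=` Om -> (forall x, Om x -> ~ D x -> f x = 0) ->
  L2norm Om f = L2norm D f.
Proof.
move=> DO f0; rewrite !L2normE; congr Num.sqrt; apply: Rintegral_ext => // x Ox Dx.
by rewrite f0// expr0n.
Qed.

Lemma W12norm_ge0 Om u : 0 <= W12norm Om u.
Proof. exact: sqrtr_ge0. Qed.

Lemma W12norm_sqr Om u : W12norm Om u ^+ 2 = L2norm Om u ^+ 2 + gradnorm Om Om u ^+ 2.
Proof. by rewrite sqr_sqrtr// addr_ge0// sqr_ge0. Qed.

Lemma W12norm_le_sum Om u : W12norm Om u <= L2norm Om u + gradnorm Om Om u.
Proof.
have := L2norm_ge0 Om u; have := gradnorm_ge0 Om Om u.
move=> g0 l0; rewrite -(ler_pXn2r (ltn0Sn 1)) ?nnegrE ?addr_ge0 ?W12norm_ge0// W12norm_sqr.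
by have := mulr_ge0 l0 g0; rewrite sqrrD; lra.
Qed.

Lemma L2norm_le_W12norm Om u : L2norm Om u <= W12norm Om u.
Proof.
rewrite -(ler_pXn2r (ltn0Sn 1)) ?nnegrE ?L2norm_ge0 ?W12norm_ge0// W12norm_sqr lerDl.
exact: sqr_ge0.
Qed.

Lemma gradnorm_le_W12norm Om u : gradnorm Om Om u <= W12norm Om u.
Proof.
rewrite -(ler_pXn2r (ltn0Sn 1)) ?nnegrE ?L2norm_ge0 ?W12norm_ge0// W12norm_sqr lerDr.
exact: sqr_ge0.
Qed.

(** A test function of [Om] times the cutoff is a test function of [D]; testing the weak
    gradient of [psi] with it and expanding the product gives the formula. *)
Lemma wgrad_cutoff D Om chi psi F : open D -> open Om -> D `<=` Om ->
  test_function D chi -> L2 D psi -> wgrad D psi F ->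
  wgrad Om (fun x => chi x * psi x)
    (ext0 D (fun x => chi x *: F x + psi x *: nabla chi x)).
Proof.
move=> oD oO DO tchi Lpsi [LF hF]; have [sc _ _] := tchi.
have mD := open_measurable_rV oD; have mO := open_measurable_rV oO.
have [M [M0 hM]] := test_function_bounded tchi.
split.
  move=> i; apply: (L2_ext mD mO DO); first by move=> x _ Dx; rewrite ext0_out// mxE.
  have [M' [_ hM']] := test_function_bounded (test_function_partial i tchi).
  apply: (@eq_L2 _ _ D (fun x => chi x * F x 0 i + partial i chi x * psi x)).
    by move=> x; rewrite inE => Dx; rewrite ext0_in// !mxE [psi x * _]mulrC.
  apply: L2D => //; apply: L2_bound => //.
  - exact: measurable_smooth.
  - by apply: measurable_smooth; exact: smooth_partial.
move=> phi i tphi; have [sphi _ _] := tphi.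
have t2 : test_function D (fun x => chi x * phi x).
  have -> : (fun x => chi x * phi x) = (fun x => phi x * chi x).
    by apply/funext => x; rewrite mulrC.
  exact: test_functionM.
have tdc := test_function_partial i tchi; have tdphi := test_function_partial i tphi.
have Lphi := test_function_L2 mD tphi; have Ldphi := test_function_L2 mD tdphi.
have t3 : test_function D (fun x => partial i chi x * phi x).
  have -> : (fun x => partial i chi x * phi x) = (fun x => phi x * partial i chi x).
    by apply/funext => x; rewrite mulrC.
  exact: test_functionM.
have := hF _ i t2; rewrite partialM// => h.
rewrite (Rintegral_ext DO); last first.
  by move=> x _ Dx; rewrite (test_function_out tchi)// !mul0r.
rewrite [in RHS](Rintegral_ext DO); last by move=> x _ Dx; rewrite ext0_out// mxE mul0r.
have i3 := L2M mD Lpsi (test_function_L2 mD t3).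
have i2 := L2M mD (LF i) (test_function_L2 mD t2).
have i4 : mu.-integrable D (EFin \o (fun x => psi x * (chi x * partial i phi x + partial i chi x * phi x))).
  by apply: L2M => //; have := test_function_L2 mD (test_function_partial i t2); rewrite partialM.
have -> : \int[mu]_(x in D) (chi x * psi x * partial i phi x) =
    \int[mu]_(x in D) (psi x * (chi x * partial i phi x + partial i chi x * phi x) -
                       psi x * (partial i chi x * phi x)).
  by apply: eq_Rintegral => x _; ring.
rewrite RintegralB// h -opprD -RintegralD//; congr (- _).
by apply: eq_Rintegral => x; rewrite inE => Dx; rewrite ext0_in// !mxE; ring.
Qed.

Lemma L2_cutoff D Om chi psi : open D -> open Om -> D `<=` Om ->
  test_function D chi -> L2 D psi -> L2 Om (fun x => chi x * psi x).
Proof.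
move=> oD oO DO tchi Lpsi; have [sc _ _] := tchi; have mD := open_measurable_rV oD.
apply: (L2_ext mD (open_measurable_rV oO) DO).
  by move=> x _ Dx; rewrite (test_function_out tchi)// mul0r.
have [M [_ hM]] := test_function_bounded tchi.
by apply: L2_bound => //; exact: measurable_smooth.
Qed.

Lemma W12_cutoff D Om chi psi : open D -> open Om -> D `<=` Om ->
  test_function D chi -> W12 D psi -> W12 Om (fun x => chi x * psi x).
Proof.
move=> oD oO DO tchi hpsi; apply: (W12I (L2_cutoff oD oO DO tchi hpsi.1)).
exact: (wgrad_cutoff oD oO DO tchi hpsi.1 (gradP hpsi)).
Qed.

Lemma W12norm_cutoff D Om chi : open D -> open Om -> D `<=` Om -> test_function D chi ->
  exists C, 0 <= C /\
    forall psi, W12 D psi -> W12norm Om (fun x => chi x * psi x) <= C * W12norm D psi.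
Proof.
move=> oD oO DO tchi; have [sc _ _] := tchi.
have mD := open_measurable_rV oD; have mO := open_measurable_rV oO.
have [M [M0 hM]] := test_function_bounded tchi.
have [M' hM'] : exists M', forall x, enorm (nabla chi x) <= M'.
  have /boolp.choice[m hm] (i : 'I_n) : exists m : R, forall x, `|partial i chi x| <= m.
    have [m [_ hm]] := test_function_bounded (test_function_partial i tchi).
    by exists m.
  exists (n%:R * \sum_i `|m i|) => x; apply: enorm_le => i; rewrite mxE.
  apply: le_trans (hm i x) _; apply: le_trans (ler_norm _) _.
  by rewrite (bigD1 i)//= lerDl sumr_ge0.
have M'0 : 0 <= M' by apply: le_trans (hM' 0); exact: enorm_ge0.
exists (3 * M + 2 * M'); split=> [|psi hpsi]; first by rewrite addr_ge0// mulr_ge0.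
have Lpsi := hpsi.1; have gpsi := gradP hpsi.
have gc := wgrad_cutoff oD oO DO tchi Lpsi gpsi.
have Lg := grad_L2 oD mD (@subset_refl _ _) hpsi.
have le1 : L2norm Om (fun x => chi x * psi x) <= M * L2norm D psi.
  rewrite (L2norm_ext DO); last by move=> x _ Dx; rewrite (test_function_out tchi)// mul0r.
  have <- : L2norm D (fun x => M * psi x) = M * L2norm D psi by rewrite L2normZ// ger0_norm.
  have Lc := L2_cutoff oD oD (@subset_refl _ D) tchi Lpsi.
  apply: le_L2norm => //; first exact: L2Z.
  move=> x _; rewrite !exprMn ler_wpM2r ?sqr_ge0// -[leLHS](real_normK (num_real _)).
  by rewrite ler_pXn2r ?nnegrE.
have le2 : gradnorm Om Om (fun x => chi x * psi x) <=
    2 * (M * gradnorm D D psi + M' * L2norm D psi).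
  rewrite (gradnormE oO mO _ (W12_cutoff oD oO DO tchi hpsi) gc)//.
  rewrite (L2norm_ext DO); last by move=> x _ Dx; rewrite ext0_out// enorm0.
  have LM : L2 D (fun x => M * enorm (grad D psi x)) by exact: L2Z.
  have LM' : L2 D (fun x => M' * `|psi x|).
    apply: L2Z => //; apply/L2P => //; split; first by apply: measurableT_comp => //; exact: L2_meas.
    by under eq_fun do rewrite real_normK ?num_real//; exact: L2_integrable.
  have E1 : L2norm D (fun x => M * enorm (grad D psi x)) = M * gradnorm D D psi.
    by rewrite L2normZ// ger0_norm.
  have E2 : L2norm D (fun x => M' * `|psi x|) = M' * L2norm D psi.
    rewrite -[in RHS](ger0_norm M'0) -L2normZ// !L2normE; congr Num.sqrt.
    by apply: eq_Rintegral => x _; rewrite !exprMn real_normK ?num_real.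
  rewrite -E1 -E2; set p := L2norm D (fun x => M * _); set q := L2norm D (fun x => M' * _).
  have pq : 0 <= p * q by rewrite mulr_ge0 ?L2norm_ge0.
  apply: (@le_trans _ _ (L2norm D (fun x => M * enorm (grad D psi x) + M' * `|psi x|))); last first.
    rewrite -(ler_pXn2r (ltn0Sn 1)) ?nnegrE ?mulr_ge0 ?addr_ge0 ?L2norm_ge0//.
    apply: le_trans (L2normD_sqr mD LM LM') _; rewrite -/p -/q [leRHS]exprMn (sqrrD p).
    have := sqr_ge0 p; have := sqr_ge0 q; lra.
  apply: le_L2norm => //.
  - apply: (@eq_L2 _ _ D (fun x => enorm (ext0 D (fun x => chi x *: grad D psi x + psi x *: nabla chi x) x))) => //.
    by apply: L2vec_enorm => //; apply: L2vecW gc.1.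
  - exact: L2D.
  - move=> x Dx; rewrite ext0_in// ler_pXn2r ?nnegrE ?addr_ge0 ?mulr_ge0 ?enorm_ge0//.
    apply: le_trans (enormD _ _) _; rewrite !enormZ lerD ?ler_wpM2r ?enorm_ge0//.
    by rewrite mulrC ler_wpM2r.
apply: le_trans (W12norm_le_sum _ _) _; apply: le_trans (lerD le1 le2) _.
have h1 := ler_wpM2l M0 (L2norm_le_W12norm D psi).
have h2 := ler_wpM2l M0 (gradnorm_le_W12norm D psi).
have h3 := ler_wpM2l M'0 (L2norm_le_W12norm D psi).
rewrite mulrDl; lra.
Qed.

End sobolev_operations.

Section sobolev_W120.
Context (R : realType) (n : nat).
Local Notation E := 'rV[R]_n.
Local Notation mu := (lebesgue_rV R n).
Implicit Types (u v w phi psi zeta chi : E -> R) (F G : E -> E) (Om D A : set E).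

Lemma wgradB Om u v F G : open Om -> L2 Om u -> L2 Om v ->
  wgrad Om u F -> wgrad Om v G ->
  wgrad Om (fun x => u x - v x) (fun x => F x - G x).
Proof.
move=> oO hu hv hF hG; have := wgrad_comb (-1) oO hv hu hG hF.
congr wgrad; apply/funext => x; first by rewrite mulN1r addrC.
by rewrite scaleN1r addrC.
Qed.

Lemma W12B Om u v : open Om -> W12 Om u -> W12 Om v -> W12 Om (fun x => u x - v x).
Proof.
move=> oO hu hv; have mO := open_measurable_rV oO.
apply: (W12I (L2B mO hu.1 hv.1)).
exact: (wgradB oO hu.1 hv.1 (gradP hu) (gradP hv)).
Qed.

Lemma W120_approx D phi (e : R) : open D -> W120 D phi -> 0 < e ->
  exists w, [/\ test_function D w, L2norm D (fun x => phi x - w x) <= e,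
    L2norm D (fun x => enorm (grad D phi x - nabla w x)) <= e &
    forall i, L2norm D (fun x => grad D phi x 0 i - partial i w x) <= e].
Proof.
move=> oD [hphi happ] e0; have mD := open_measurable_rV oD.
have [w [tw hw]] := happ e e0; exists w.
have hwW := W12_test oD tw.
have gd := wgradB oD hphi.1 hwW.1 (gradP hphi) (wgrad_test oD tw).
have hd := W12B oD hphi hwW.
have hg : L2norm D (fun x => enorm (grad D phi x - nabla w x)) <= e.
  rewrite -(gradnormE oD mD (@subset_refl _ D) hd gd).
  by apply: le_trans (ltW hw); exact: gradnorm_le_W12norm.
split=> //; first by apply: le_trans (ltW hw); exact: L2norm_le_W12norm.
move=> i; apply: le_trans hg; apply: le_L2norm => //.
- by apply: eq_L2 (gd.1 i) => x _; rewrite !mxE.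
- by apply: L2vec_enorm => //; exact: gd.1.
- move=> x _; rewrite -[leLHS](real_normK (num_real _)) ler_pXn2r ?nnegrE ?enorm_ge0//.
  by have := coord_le_enorm (grad D phi x - nabla w x) i; rewrite !mxE.
Qed.

(** If [phi] is a test function of [D] the support of [zeta] does not matter, and both
    sides are continuous in [phi] for the norm of [W12 D]. *)
Lemma W120_by_parts D phi zeta i : open D -> W120 D phi -> smooth zeta ->
  L2 D zeta -> L2 D (partial i zeta) ->
  \int[mu]_(x in D) (phi x * partial i zeta x) =
  - \int[mu]_(x in D) (grad D phi x 0 i * zeta x).
Proof.
move=> oD hphi sz Lz Ldz; have mD := open_measurable_rV oD; have Lphi := hphi.1.1.
have Lg := (gradP hphi.1).1.
have i1 := L2M mD Lphi Ldz; have i2 := L2M mD (Lg i) Lz.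
apply/eqP; rewrite -addr_eq0; apply/eqP.
set X := _ + _; pose K := L2norm D (partial i zeta) + L2norm D zeta + 1.
have K0 : 0 < K by rewrite ltr_wpDl// addr_ge0// L2norm_ge0.
suff H (e : R) : 0 < e -> `|X| <= e * K.
  apply/eqP; rewrite -normr_le0; apply/ler_addgt0Pl => e e0; rewrite addr0.
  by have := H (e / K) (divr_gt0 e0 K0); rewrite divfK// gt_eqF.
move=> e0; have [w [tw h1 _ /(_ i) h2]] := W120_approx oD hphi e0.
have [sw _ _] := tw; have Lw := test_function_L2 mD tw.
have Ldw := test_function_L2 mD (test_function_partial i tw).
have := int_test_part i mD (test_functionM sz tw).
rewrite partialM// RintegralD//; try exact: L2M.
move=> hw.
have E1 : \int[mu]_(x in D) ((phi x - w x) * partial i zeta x) =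
    \int[mu]_(x in D) (phi x * partial i zeta x) - \int[mu]_(x in D) (partial i zeta x * w x).
  rewrite -RintegralB//; last exact: L2M.
  by apply: eq_Rintegral => x _; ring.
have E2 : \int[mu]_(x in D) ((grad D phi x 0 i - partial i w x) * zeta x) =
    \int[mu]_(x in D) (grad D phi x 0 i * zeta x) - \int[mu]_(x in D) (zeta x * partial i w x).
  rewrite -RintegralB//; last exact: L2M.
  by apply: eq_Rintegral => x _; ring.
have gen (a b p q c d : R) : c = a - p -> d = b - q -> q + p = 0 -> a + b = c + d.
  by move=> -> -> h; rewrite addrACA -opprD [p + q]addrC h subr0.
have XE := gen _ _ _ _ _ _ E1 E2 hw.
rewrite /X XE.
apply: le_trans (ler_normD _ _) _.
apply: (@le_trans _ _ (e * L2norm D (partial i zeta) + e * L2norm D zeta)); last first.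
  by rewrite -mulrDr ler_wpM2l ?(ltW e0)// lerDl.
apply: lerD.
  apply: le_trans (L2_cauchy_schwarz mD (L2B mD Lphi Lw) Ldz) _.
  by rewrite ler_wpM2r ?L2norm_ge0.
apply: le_trans (L2_cauchy_schwarz mD (L2B mD (Lg i) Ldw) Lz) _.
by rewrite ler_wpM2r ?L2norm_ge0.
Qed.

(** A test function of [Om] is an admissible [zeta] in [W120_by_parts]. *)
Lemma wgrad_ext0 D Om phi : open D -> open Om -> D `<=` Om -> W120 D phi ->
  wgrad Om (ext0 D phi) (ext0 D (grad D phi)).
Proof.
move=> oD oO DO hphi; have mD := open_measurable_rV oD; have mO := open_measurable_rV oO.
split.
  move=> i; apply: (L2_ext mD mO DO); first by move=> x _ Dx; rewrite ext0_out// mxE.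
  by apply: eq_L2 ((gradP hphi.1).1 i) => x; rewrite inE => Dx; rewrite ext0_in.
move=> zeta i tz; have [sz _ _] := tz.
rewrite (Rintegral_ext DO); last by move=> x _ Dx; rewrite ext0_out// mul0r.
rewrite [in RHS](Rintegral_ext DO); last by move=> x _ Dx; rewrite ext0_out// mxE mul0r.
have := W120_by_parts (i := i) oD hphi sz (test_function_L2 mD tz)
   (test_function_L2 mD (test_function_partial i tz)).
have -> : \int[mu]_(x in D) (ext0 D phi x * partial i zeta x) =
    \int[mu]_(x in D) (phi x * partial i zeta x).
  by apply: eq_Rintegral => x; rewrite inE => Dx; rewrite ext0_in.
move=> ->; congr (- _).
by apply: eq_Rintegral => x; rewrite inE => Dx; rewrite ext0_in.
Qed.

Lemma W12_ext0 D Om phi : open D -> open Om -> D `<=` Om -> W120 D phi ->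
  W12 Om (ext0 D phi).
Proof.
move=> oD oO DO hphi; have mD := open_measurable_rV oD; have mO := open_measurable_rV oO.
apply: (W12I _ (wgrad_ext0 oD oO DO hphi)).
apply: (L2_ext mD mO DO); first by move=> x _ Dx; rewrite ext0_out.
by apply: eq_L2 hphi.1.1 => x; rewrite inE => Dx; rewrite ext0_in.
Qed.

Lemma W120_ext0 D Om phi : open D -> open Om -> D `<=` Om -> W120 D phi ->
  W120 Om (ext0 D phi).
Proof.
move=> oD oO DO hphi; have mD := open_measurable_rV oD; have mO := open_measurable_rV oO.
have hext := W12_ext0 oD oO DO hphi.
split=> // e e0; have [w [tw h1 h2 _]] := W120_approx oD hphi (divr_gt0 e0 (ltr0n R 2)).
have tw' := test_functionW DO tw; exists w; split=> //.
have hw := W12_test oO tw'.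
have gd := wgradB oO hext.1 hw.1 (wgrad_ext0 oD oO DO hphi) (wgrad_test oO tw').
have w0 x : ~ D x -> w x = 0 by move=> Dx; exact: test_function_out tw _.
have n1 : L2norm Om (fun x => ext0 D phi x - w x) <= e / 2.
  rewrite (L2norm_ext DO); last by move=> x _ Dx; rewrite ext0_out// w0// subr0.
  apply: le_trans h1; apply: eq_ler.
  by apply: eq_L2norm => x; rewrite inE => Dx; rewrite ext0_in.
have n2 : gradnorm Om Om (fun x => ext0 D phi x - w x) <= e / 2.
  rewrite (gradnormE oO mO _ (W12B oO hext hw) gd)// (L2norm_ext DO); last first.
    move=> x _ Dx; rewrite ext0_out// sub0r enormN (_ : nabla w x = 0) ?enorm0//.
    by apply/rowP => i; rewrite !mxE (test_function_out (test_function_partial i tw)).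
  apply: le_trans h2; apply: eq_ler.
  by apply: eq_L2norm => x; rewrite inE => Dx; rewrite ext0_in.
have e2 : 0 < e / 2 by rewrite divr_gt0.
rewrite -(ltr_pXn2r (ltn0Sn 1)) ?nnegrE ?W12norm_ge0 ?(ltW e0)// W12norm_sqr.
apply: (@le_lt_trans _ _ ((e / 2) ^+ 2 + (e / 2) ^+ 2)).
  by apply: lerD; rewrite ler_pXn2r ?nnegrE ?L2norm_ge0 ?gradnorm_ge0 ?(ltW e2).
have -> : e = e / 2 + e / 2 by rewrite -splitr.
by move: e2; move: (e / 2) => d d0; nra.
Qed.

Lemma gradnorm_ext0 D Om A phi : open D -> open Om -> D `<=` Om -> measurable A ->
  A `<=` D -> W120 D phi -> gradnorm Om A (ext0 D phi) = gradnorm D A phi.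
Proof.
move=> oD oO DO mA AD hphi.
rewrite (gradnormE oO mA (subset_trans AD DO) (W12_ext0 oD oO DO hphi) (wgrad_ext0 oD oO DO hphi)).
by apply: eq_L2norm => x; rewrite inE => /AD Dx; rewrite ext0_in.
Qed.

Lemma gradnorm_ext0T D Om phi : open D -> open Om -> D `<=` Om -> W120 D phi ->
  gradnorm Om Om (ext0 D phi) = gradnorm D D phi.
Proof.
move=> oD oO DO hphi; have mO := open_measurable_rV oO.
rewrite (gradnormE oO mO _ (W12_ext0 oD oO DO hphi) (wgrad_ext0 oD oO DO hphi))//.
rewrite (L2norm_ext DO); last by move=> x _ Dx; rewrite ext0_out// enorm0.
by apply: eq_L2norm => x; rewrite inE => Dx; rewrite ext0_in.
Qed.

Lemma esupp_ext0 D Om phi : D `<=` Om -> esupp Om (ext0 D phi) `<=` esupp D phi.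
Proof.
move=> DO x hx U oU Ux h; apply: (hx U oU Ux); apply: filterS h => y h [Oy Uy].
by have [Dy|Dy] := pselect (D y); [rewrite ext0_in// h|rewrite ext0_out].
Qed.

Lemma ext0_comb D (a : R) phi psi :
  ext0 D (fun x => a * phi x + psi x) = (fun x => a * ext0 D phi x + ext0 D psi x).
Proof.
by apply/funext => x; rewrite /ext0; case: ifP => // _; rewrite mulr0 addr0.
Qed.

Lemma open_aff (c : E) (r : R) Om : open Om -> open (aff c r @^-1` Om).
Proof. by move=> oO; apply: open_comp => // x _; exact: aff_continuous. Qed.

Lemma aff_preimageK (c : E) (r : R) Om : r != 0 ->
  aff (- (r^-1 *: c)) r^-1 @^-1` (aff c r @^-1` Om) = Om.
Proof. by move=> r0; apply/seteqP; split=> x /=; rewrite affKV. Qed.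

Lemma aff_compKV (T : Type) (c : E) (r : R) (f : E -> T) : r != 0 ->
  (f \o aff (- (r^-1 *: c)) r^-1) \o aff c r = f.
Proof. by move=> r0; apply/funext => x /=; rewrite affK. Qed.

Lemma wgrad_aff (c : E) (r : R) Om u F : 0 < r -> open Om -> L2 Om u -> wgrad Om u F ->
  wgrad (aff c r @^-1` Om) (u \o aff c r) (fun x => r *: F (aff c r x)).
Proof.
move=> r0 oO Lu [LF hF]; have mO := open_measurable_rV oO.
have r1 : r != 0 by rewrite gt_eqF.
have mO' := @aff_preimage_measurable R n c r _ mO.
split.
  move=> i; apply: (@eq_L2 _ _ _ (fun x => r * F (aff c r x) 0 i)); first by move=> x _; rewrite !mxE.
  by apply: L2Z => //; exact: (L2_aff c r0 mO (LF i)).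
move=> phi i tphi; have [sphi _ _] := tphi.
pose S := @aff R n (- (r^-1 *: c)) r^-1.
have tS : test_function Om (phi \o S).
  have rV : r^-1 != 0 by rewrite invr_eq0.
  by have := test_function_aff (- (r^-1 *: c)) rV tphi; rewrite aff_preimageK.
have := hF _ i tS; rewrite partial_aff// -/S => h.
have Ldphi : L2 Om (fun x => r^-1 * partial i phi (S x)).
  by have := test_function_L2 mO (test_function_partial i tS); rewrite partial_aff.
have Lphi := test_function_L2 mO tS.
rewrite (Rintegral_aff c r0 mO (L2M mO Lu Ldphi)) in h.
rewrite (Rintegral_aff c r0 mO (L2M mO (LF i) Lphi)) in h.
have iu : mu.-integrable (aff c r @^-1` Om) (EFin \o (fun x => u (aff c r x) * partial i phi x)).
  apply: L2M => //; first exact: (L2_aff c r0 mO Lu).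
  exact: test_function_L2 (test_function_partial i tphi).
have iF : mu.-integrable (aff c r @^-1` Om) (EFin \o (fun x => F (aff c r x) 0 i * phi x)).
  apply: L2M => //; first exact: (L2_aff c r0 mO (LF i)).
  exact: test_function_L2 tphi.
have e1 : \int[mu]_(x in aff c r @^-1` Om)
     (u (aff c r x) * (r^-1 * partial i phi (S (aff c r x)))) =
   r^-1 * \int[mu]_(x in aff c r @^-1` Om) (u (aff c r x) * partial i phi x).
  rewrite -[RHS](RintegralZl _ mO' iu); apply: eq_Rintegral => x _.
  by rewrite /S (affK _ r1) mulrCA.
have e2 : \int[mu]_(x in aff c r @^-1` Om) (F (aff c r x) 0 i * (phi \o S) (aff c r x)) =
   \int[mu]_(x in aff c r @^-1` Om) (F (aff c r x) 0 i * phi x).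
  by apply: eq_Rintegral => x _; rewrite /S /= (affK _ r1).
rewrite e1 e2 in h.
have -> : \int[mu]_(x in aff c r @^-1` Om) ((r *: F (aff c r x)) 0 i * phi x) =
    r * \int[mu]_(x in aff c r @^-1` Om) (F (aff c r x) 0 i * phi x).
  by rewrite -[RHS](RintegralZl _ mO' iF); apply: eq_Rintegral => x _; rewrite !mxE mulrA.
have rn : r ^+ n != 0 by rewrite expf_neq0.
move: h; rewrite -mulrN => /(mulfI rn) /(congr1 ( *%R r)).
by rewrite mulrA mulfV// mul1r mulrN.
Qed.

Lemma W12_aff (c : E) (r : R) Om u : 0 < r -> open Om -> W12 Om u ->
  W12 (aff c r @^-1` Om) (u \o aff c r).
Proof.
move=> r0 oO hu; apply: (W12I _ (wgrad_aff c r0 oO hu.1 (gradP hu))).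
exact: (L2_aff c r0 (open_measurable_rV oO) hu.1).
Qed.

Lemma grad_aff (c : E) (r : R) Om u : 0 < r -> open Om -> W12 Om u ->
  {ae mu, forall x, (aff c r @^-1` Om) x ->
    grad (aff c r @^-1` Om) (u \o aff c r) x = r *: grad Om u (aff c r x)}.
Proof.
move=> r0 oO hu; apply: grad_ae; [exact: open_aff|exact: W12_aff|].
exact: (wgrad_aff c r0 oO hu.1 (gradP hu)).
Qed.

Lemma gradnorm_aff (c : E) (r : R) Om A u : 0 < r -> open Om -> measurable A ->
  A `<=` Om -> W12 Om u ->
  gradnorm Om A u = Num.sqrt (r ^+ n) / r *
    gradnorm (aff c r @^-1` Om) (aff c r @^-1` A) (u \o aff c r).
Proof.
move=> r0 oO mA AO hu; have mA' := @aff_preimage_measurable R n c r _ mA.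
have AO' : aff c r @^-1` A `<=` aff c r @^-1` Om by move=> x; exact: AO.
have Lg := grad_L2 oO mA AO hu.
rewrite (gradnormE (open_aff oO) mA' AO' (W12_aff c r0 oO hu)
  (wgrad_aff c r0 oO hu.1 (gradP hu))).
rewrite /gradnorm (L2norm_aff c r0 mA Lg).
rewrite [in RHS](eq_L2norm (v := fun x => r * enorm (grad Om u (aff c r x)))); last first.
  by move=> x _; rewrite enormZ gtr0_norm.
rewrite L2normZ//; last exact: (L2_aff c r0 mA Lg).
by rewrite (gtr0_norm r0) mulrA divfK// gt_eqF.
Qed.

Lemma W120_aff (c : E) (r : R) Om phi : 0 < r -> open Om -> W120 Om phi ->
  W120 (aff c r @^-1` Om) (phi \o aff c r).
Proof.
move=> r0 oO [hphi happ]; have mO := open_measurable_rV oO.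
have r1 : r != 0 by rewrite gt_eqF.
split; first exact: W12_aff.
move=> e e0; pose s := Num.sqrt (r ^+ n).
have s0 : 0 < s by rewrite sqrtr_gt0 exprn_gt0.
pose K := (1 + r) / s; have K0 : 0 < K by rewrite divr_gt0// addr_gt0.
have [w [tw hw]] := happ (e / K) (divr_gt0 e0 K0).
exists (w \o aff c r); split; first exact: test_function_aff.
have hw' := W12_test oO tw; have hd := W12B oO hphi hw'.
rewrite ltr_pdivlMr// mulrC in hw; apply: le_lt_trans hw.
apply: le_trans (W12norm_le_sum _ _) _; rewrite /K mulrDl mul1r mulrDl; apply: lerD.
  rewrite mulrC ler_pdivlMr// mulrC -(L2norm_aff c r0 mO hd.1).
  exact: L2norm_le_W12norm.
have := gradnorm_aff c r0 oO mO (@subset_refl _ _) hd; rewrite -/s /comp => h.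
apply: (@le_trans _ _ (r / s * gradnorm Om Om (fun x => phi x - w x))).
  by rewrite h mulrA mulf_div [r * s]mulrC divff ?mul1r// mulf_neq0// gt_eqF.
by rewrite ler_wpM2l ?divr_ge0 ?(ltW r0) ?(ltW s0)//; exact: gradnorm_le_W12norm.
Qed.

Lemma esupp_aff (c : E) (r : R) Om phi : 0 < r ->
  esupp (aff c r @^-1` Om) (phi \o aff c r) `<=` aff c r @^-1` (esupp Om phi).
Proof.
move=> r0 x hx U oU Ux h; apply: (hx (aff c r @^-1` U) (open_aff oU) Ux).
by apply: filterS (ae_aff c r0 h) => y hy [Oy Uy]; exact: hy.
Qed.

Lemma closure_aff (c : E) (r : R) A : r != 0 ->
  aff c r @^-1` (closure A) `<=` closure (aff c r @^-1` A).
Proof.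
move=> r0 x hx B xB.
have hB : nbhs (aff c r x) (aff (- (r^-1 *: c)) r^-1 @^-1` B).
  by apply: aff_continuous; rewrite affK.
by have [y [Ay By]] := hx _ hB; exists (aff (- (r^-1 *: c)) r^-1 y); rewrite /= affKV.
Qed.

End sobolev_W120.

(** * One step of approximation on the unit ball *)

Section unit_step.
Context (R : realType) (n : nat).
Local Notation E := 'rV[R]_n.
Local Notation mu := (lebesgue_rV R n).
Local Notation B := (eball (0 : E)).
Implicit Types (u v w phi psi chi : E -> R) (f F G : E -> E) (Om D A : set E).

Lemma closure_eball c (r s : R) : r < s -> closure (eball c r) `<=` eball (c : E) s.
Proof.
move=> rs x hx; have sr : 0 < s - r by rewrite subr_gt0.
have [y [yc yx]] := hx _ (open_nbhs_nbhs (conj (@eball_open R n x (s - r)) (@eball_center R n x _ sr))).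
rewrite /eball /= in yc yx *; have := enormD (x - y) (y - c).
by rewrite addrA subrK [enorm (x - y)]enormB => h; lra.
Qed.

Lemma compact_closure_eball c (r : R) : compact (closure (eball (c : E) r)).
Proof.
have r1 : r < r + 1 by rewrite ltrDl.
have [M hM] := bounded_eball c (r + 1).
apply: (subclosed_compact _ (@compact_cbox R n (const_mx (- M)) (const_mx M))).
  exact: closed_closure.
by move=> x /(closure_eball r1)/hM h i; rewrite !mxE -ler_norml ltW.
Qed.

Lemma bounded_set_eball c (r : R) : bounded_set (eball (c : E) r).
Proof.
have [M [Mr hM]] := compact_bounded (@compact_closure_eball c r).
by exists M; split=> // t /hM h x /subset_closure; exact: h.
Qed.

Lemma integral_grad_sqr Om A u : open Om -> measurable A -> A `<=` Om -> W12 Om u ->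
  (\int[mu]_(x in A) (enorm (grad Om u x) ^+ 2)%:E)%E = (gradnorm Om A u ^+ 2)%:E.
Proof.
move=> oO mA AO hu; rewrite integral_lty_EFin//; first by rewrite -L2norm_sqr.
by apply: L2_integrable => //; exact: grad_L2.
Qed.

Lemma gradnorm_eq0 Om A u : open Om -> open A -> A `<=` Om -> W12 Om u ->
  (forall x, A x -> u x = 0) -> gradnorm Om A u = 0.
Proof.
move=> oO oA AO hu u0; have mA := open_measurable_rV oA.
have z0 : wgrad A (fun=> 0) (fun=> 0).
  split; first by move=> i; rewrite (_ : (fun x => _) = fun=> 0); [exact: L2_cst0|apply/funext => x; rewrite mxE].
  move=> phi i tphi; under eq_Rintegral do rewrite mul0r.
  by under [in RHS]eq_Rintegral do rewrite mxE mul0r; rewrite /Rintegral integral0 oppr0.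
have W0 : W12 A (fun=> 0 : R) by apply: (W12I _ z0); exact: L2_cst0.
rewrite (gradnorm_local oA oO oA AO (@subset_refl _ A) hu W0); last first.
  by move=> x; rewrite inE; exact: u0.
rewrite (gradnormE oA mA (@subset_refl _ A) W0 z0).
by under eq_L2norm do rewrite enorm0; exact: L2norm0.
Qed.

Lemma dot_grad_ext0 D Om G phi : open D -> open Om -> D `<=` Om -> L2vec Om G ->
  W120 D phi ->
  \int[mu]_(x in Om) dot (G x) (grad Om (ext0 D phi) x) =
  \int[mu]_(x in D) dot (G x) (grad D phi x).
Proof.
move=> oD oO DO LG hphi; have mO := open_measurable_rV oO.
have W := W12_ext0 oD oO DO hphi; have wg := wgrad_ext0 oD oO DO hphi.
rewrite (@ae_eq_Rint _ _ _ _ (fun x => dot (G x) (ext0 D (grad D phi) x)) mO).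
- rewrite (Rintegral_ext DO); last first.
    move=> x _ Dx; rewrite ext0_out//; rewrite /dot big1// => i _.
    by rewrite mxE mulr0.
  by apply: eq_Rintegral => x; rewrite inE => Dx; rewrite ext0_in.
- exact: integrable_meas (integrable_dot mO LG (gradP W).1).
- exact: integrable_meas (integrable_dot mO LG wg.1).
- by apply: filterS (grad_ae oO W wg) => x h Ox; rewrite h.
Qed.

Lemma W12dual_ext0 D Om (g : (E -> R) -> R) : open D -> open Om -> D `<=` Om ->
  W12dual Om g -> W12dual D (fun phi => g (ext0 D phi)).
Proof.
move=> oD oO DO [glin [C hC]]; split.
  by move=> a v w hv hw; rewrite ext0_comb glin//; exact: W120_ext0.
exists C => v hv; rewrite -(gradnorm_ext0T oD oO DO hv); apply: hC.
exact: W120_ext0.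
Qed.

Lemma W12dualB Om (g h : (E -> R) -> R) : W12dual Om g -> W12dual Om h ->
  W12dual Om (fun phi => g phi - h phi).
Proof.
move=> [gl [C hC]] [hl [C' hC']]; split.
  by move=> a v w hv hw; rewrite gl// hl//; ring.
exists (C + C') => v hv; apply: le_trans (ler_normB _ _) _.
by rewrite mulrDl lerD ?hC ?hC'.
Qed.

Lemma W12dualZ Om (a : R) (g : (E -> R) -> R) : W12dual Om g ->
  W12dual Om (fun phi => a * g phi).
Proof.
move=> [gl [C hC]]; split.
  by move=> b v w hv hw; rewrite gl//; ring.
by exists (`|a| * C) => v hv; rewrite normrM -mulrA ler_wpM2l ?hC.
Qed.

Lemma admissible_ext0 D Om (q : E -> R) : open D -> open Om -> D `<=` Om ->
  admissible Om q -> admissible D q.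
Proof.
move=> oD oO DO [iq q0 [C hC]]; split.
- by apply: integrableS iq => //; exact: open_measurable_rV.
- by move=> x /DO; exact: q0.
exists C => phi hphi; have := hC _ (W120_ext0 oD oO DO hphi).
rewrite gradnorm_ext0T//; congr (_ <= _)%E; rewrite (integral_ext DO).
  by apply: eq_integral => x; rewrite inE => Dx; rewrite ext0_in.
by move=> x _ Dx; rewrite ext0_out// expr0n mul0r.
Qed.

Lemma L12norm_ge0 Om c (r s : R) u : r < s -> 0 <= L12norm Om c r s u.
Proof.
move=> rs; rewrite addr_ge0 ?gradnorm_ge0// divr_ge0 ?L2norm_ge0//.
by rewrite subr_ge0 ltW.
Qed.

(** A problem on [Om] containing the unit ball is turned into a problem on the unit
    ball by letting the operator act on [chi psi], with [chi] a cutoff equal to one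
    on the ball of radius 3/4. The remainder [V ((1 - chi) w)] vanishes on functions
    supported in the balls of radius at most 1/2, and is put in the source. Shrinking
    the radius [theta] to 3/4 costs a factor two in [L12norm]. *)
Lemma unit_step (C0 lam delta0 : R) Om (V : (E -> R) -> (E -> R) -> R) f
    (g : (E -> R) -> R) w :
  @approximation_constants R n C0 lam delta0 -> open Om -> B 1 `<=` Om ->
  W12multiplier Om V -> L2vec Om f -> admissible Om (fun x => enorm (f x) ^+ 2) ->
  W12dual Om g -> weak_solution Om V f g w ->
  average (B 1) (fun x => w x ^+ 2) <= 1 ->
  (forall (rho : R) psi phi, 0 < rho -> rho <= 1 / 2 -> W12 Om psi -> W120 Om phi ->
     esupp Om phi `<=` closure (B rho) ->
     [/\ forall s : R, rho < s -> s <= 2 * rho ->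
           `|V psi phi| <= delta0 / 2 * L12norm Om 0 rho s psi * gradnorm Om (B rho) phi,
         `|g phi| <= delta0 * gradnorm Om (B rho) phi &
         (\int[mu]_(x in B rho) (enorm (f x) ^+ 2 * phi x ^+ 2)%:E
          <= (delta0 ^+ 2 * gradnorm Om (B rho) phi ^+ 2)%:E)%E]) ->
  exists (a : R) (b : E),
    Num.sqrt (average (B lam) (fun x => `|w x - (a + dot b x)| ^+ 2)) <= lam / 2 /\
    `|a| + enorm b <= C0.
Proof.
move=> [_ _ d0 happrox] oO BO hV Lf hf hg hw wavg small.
have oB := @eball_open R n 0 1; have mB := @measurable_eball R n 0 1.
have [chi [schi chi01 chi1 chi0]] := @smooth_cutoff R n (3 / 4) (7 / 8)
  ltac:(lra) ltac:(lra).
have tchi : test_function (B 1) chi.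
  apply: (@test_functionI _ _ _ (closure (B (7 / 8)))) => //.
  - exact: compact_closure_eball.
  - by apply: closure_eball; lra.
  - move=> x; apply: contraPP => /= hx; apply/negP; rewrite negbK; apply/eqP/chi0.
    rewrite leNgt; apply/negP => h; apply: hx; apply: subset_closure.
    by rewrite /eball /= subr0.
have [hw1 hweq] := hw.
have [Vdual Vlin [CV hCV]] := hV.
pose w2 x := w x - chi x * w x.
have hwB := W12W oB oO BO hw1.
have hcw := W12_cutoff oB oO BO tchi hwB.
have hw2 : W12 Om w2 := W12B oO hw1 hcw.
apply: (happrox (fun psi phi => V (fun x => chi x * psi x) (ext0 (B 1) phi)) f
  (fun phi => g (ext0 (B 1) phi) - V w2 (ext0 (B 1) phi)) w) => //.
- split.
  + move=> psi hpsi; apply: (W12dual_ext0 oB oO BO); apply: Vdual.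
    exact: (W12_cutoff oB oO BO tchi hpsi).
  + move=> a psi psi' phi hpsi hpsi' hphi.
    rewrite -Vlin; [|exact: (W12_cutoff oB oO BO tchi hpsi)|
      exact: (W12_cutoff oB oO BO tchi hpsi')|exact: (W120_ext0 oB oO BO hphi)].
    by congr V; apply/funext => x; ring.
  + have [C [_ hC]] := W12norm_cutoff oB oO BO tchi.
    exists (`|CV| * C) => psi phi hpsi hphi.
    have h := hCV _ _ (W12_cutoff oB oO BO tchi hpsi) (W120_ext0 oB oO BO hphi).
    rewrite (gradnorm_ext0T oB oO BO hphi) in h; apply: le_trans h _.
    rewrite ler_wpM2r ?gradnorm_ge0//.
    apply: (@le_trans _ _ (`|CV| * W12norm Om (fun x => chi x * psi x))).
      by rewrite ler_wpM2r ?W12norm_ge0// ler_norm.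
    by rewrite -mulrA ler_wpM2l// hC.
- by apply: L2vecW Lf => //; exact: open_measurable_rV.
- exact: (admissible_ext0 oB oO BO hf).
- exact: (W12dualB (W12dual_ext0 oB oO BO hg) (W12dual_ext0 oB oO BO (Vdual _ hw2))).
- split=> // phi hphi; have := hweq _ (W120_ext0 oB oO BO hphi).
  rewrite (dot_grad_ext0 oB oO BO Lf hphi) (dot_grad_ext0 oB oO BO (gradP hw1).1 hphi).
  have -> : \int[mu]_(x in B 1) dot (grad (B 1) w x) (grad (B 1) phi x) =
      \int[mu]_(x in B 1) dot (grad Om w x) (grad (B 1) phi x).
    have gphi := (gradP hphi.1).1.
    have Lgw : L2vec (B 1) (grad Om w).
      by apply: L2vecW (gradP hw1).1 => //; exact: open_measurable_rV.
    apply: ae_eq_Rint => //.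
    + exact: integrable_meas (integrable_dot mB (gradP hwB).1 gphi).
    + exact: integrable_meas (integrable_dot mB Lgw gphi).
    + have := grad_local oB oB oO (@subset_refl _ _) BO hwB hw1 (fun x _ => erefl (w x)).
      by apply: filterS => x h Bx; rewrite h.
  have -> : V w (ext0 (B 1) phi) =
      V (fun x => chi x * w x) (ext0 (B 1) phi) + V w2 (ext0 (B 1) phi).
    rewrite -[V (fun x => chi x * w x) _]mul1r -Vlin//; last exact: (W120_ext0 oB oO BO hphi).
    by congr V; apply/funext => x; rewrite /w2; ring.
  by move=> h; apply/eqP; rewrite -subr_eq0; move/eqP: h; rewrite -subr_eq0 => /eqP <-;
    apply/eqP; ring.
move=> rho psi phi rho0 rho1 hpsi hphi hsupp.
have hphi' := W120_ext0 oB oO BO hphi.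
have hsupp' : esupp Om (ext0 (B 1) phi) `<=` closure (B rho).
  by apply: subset_trans hsupp; exact: esupp_ext0.
have Brho : B rho `<=` B 1 by apply: le_eball; lra.
have gext : gradnorm Om (B rho) (ext0 (B 1) phi) = gradnorm (B 1) (B rho) phi.
  by apply: gradnorm_ext0 => //; exact: measurable_eball.
have g0 := gradnorm_ge0 (B 1) (B rho) phi.
split.
- move=> theta rt t2.
  have hc := W12_cutoff oB oO BO tchi hpsi.
  have [hVs _ _] := small _ _ _ rho0 rho1 hc hphi' hsupp'.
  pose s := Num.min theta (3 / 4).
  have rs : rho < s by rewrite lt_min rt /=; lra.
  have s2 : s <= 2 * rho by apply: le_trans t2; rewrite ge_min lexx.
  have sth : s <= theta by rewrite ge_min lexx.
  have s34 : s <= 3 / 4 by rewrite ge_min lexx orbT.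
  have half : theta - rho <= 2 * (s - rho).
    by rewrite /s; case: (leP theta (3 / 4)) => h; lra.
  have t1 : theta <= 1 by lra.
  have oBs := @eball_open R n 0 s; have mBs := @measurable_eball R n 0 s.
  have mBt := @measurable_eball R n 0 theta.
  have Bst : B s `<=` B theta by exact: le_eball.
  have Bt1 : B theta `<=` B 1 by exact: le_eball.
  have Bs1 := subset_trans Bst Bt1.
  have eqs : {in B s, (fun x => chi x * psi x) =1 psi}.
    move=> x; rewrite inE /eball /= subr0 => h; rewrite chi1 ?mul1r//.
    by apply: le_trans s34; exact: ltW.
  apply: le_trans (hVs _ rs s2) _; rewrite gext ler_wpM2r//.
  rewrite -mulrA ler_wpM2l ?(ltW d0)// ler_pdivrMl// /L12norm.
  rewrite (gradnorm_local oBs oO oB (subset_trans Bs1 BO) Bs1 hc hpsi eqs) (eq_L2norm eqs).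
  rewrite mulrDr lerD//.
    apply: (@le_trans _ _ (L2norm (B theta) psi / (s - rho))).
      rewrite ler_wpM2r ?invr_ge0 ?subr_ge0 ?(ltW rs)//; apply: le_L2norm_set => //.
      by apply: L2W hpsi.1.
    rewrite mulrCA ler_wpM2l ?L2norm_ge0//.
    have sr : 0 < s - rho by rewrite subr_gt0.
    have tr : 0 < theta - rho by rewrite subr_gt0.
    by rewrite -ler_pdivrMl// -[leLHS]invfM lef_pV2 ?posrE ?mulr_gt0.
  apply: (@le_trans _ _ (gradnorm (B 1) (B theta) psi)).
    by apply: le_L2norm_set => //; exact: grad_L2.
  by rewrite ler_peMl ?gradnorm_ge0// ler1n.
- have [_ hgs _] := small _ _ _ rho0 rho1 hw2 hphi' hsupp'.
  have [hVs _ _] := small _ _ _ rho0 rho1 hw2 hphi' hsupp'.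
  suff -> : V w2 (ext0 (B 1) phi) = 0 by rewrite subr0 -gext.
  pose s := Num.min (2 * rho) (3 / 4).
  have rs : rho < s by rewrite lt_min; apply/andP; split; lra.
  have s2 : s <= 2 * rho by rewrite ge_min lexx.
  have s34 : s <= 3 / 4 by rewrite ge_min lexx orbT.
  have Bs1 : B s `<=` B 1 by apply: le_eball; lra.
  have z x : B s x -> w2 x = 0.
    rewrite /eball /= subr0 => h; rewrite /w2 chi1 ?mul1r ?subrr//.
    by apply: le_trans s34; exact: ltW.
  have := hVs s rs s2; rewrite /L12norm gradnorm_eq0//; last 2 first.
  + exact: eball_open.
  + exact: subset_trans BO.
  rewrite (@eq_L2norm _ _ _ _ (fun=> 0)); last by move=> x; rewrite inE => /z.
  by rewrite L2norm0 mul0r addr0 mulr0 mul0r normr_le0 => /eqP.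
- have [_ _] := small _ _ _ rho0 rho1 hw2 hphi' hsupp'.
  rewrite gext integral_grad_sqr//; [|exact: measurable_eball|exact: hphi.1].
  rewrite EFinM; congr (_ <= _)%E; apply: eq_integral => x; rewrite inE => /Brho Bx.
  by rewrite ext0_in.
Qed.

End unit_step.

(** * One step of approximation at an arbitrary scale *)

Section scaled_step.
Context (R : realType) (n : nat).
Local Notation E := 'rV[R]_n.
Local Notation mu := (lebesgue_rV R n).
Local Notation B := (eball (0 : E)).
Implicit Types (u v w phi psi : E -> R) (f F G : E -> E) (Om D A : set E).

(** The affine function with value [a] at [x0] and gradient [b / r]. *)
Definition lin (x0 : E) (r a : R) (b : E) (x : E) : R := a + dot b (r^-1 *: (x - x0)).

Lemma lin_aff x0 (r a : R) b : r != 0 ->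
  lin x0 r a b \o aff x0 r = fun y => a + dot b y.
Proof.
move=> r0; apply/funext => y; rewrite /lin /aff /= addrAC subrr add0r scalerA mulVf//.
by rewrite scale1r.
Qed.

Lemma lin_affV x0 (r a : R) b :
  lin x0 r a b = (fun y => a + dot b y) \o aff (- (r^-1 *: x0)) r^-1.
Proof.
by apply/funext => y; rewrite /lin /aff /= scalerDr scalerN [X in dot b X]addrC.
Qed.

Lemma smooth_lin x0 (r a : R) b : smooth (lin x0 r a b).
Proof. by rewrite lin_affV; apply: smooth_aff; exact: smooth_affine. Qed.

Lemma linD x0 (r a a' N : R) b b' x :
  lin x0 r (a + N * a') (b + N *: b') x = lin x0 r a b x + N * lin x0 r a' b' x.
Proof. by rewrite /lin dotDl dotZl; ring. Qed.

Lemma lin_rescale x0 (r lam a : R) b : lam != 0 ->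
  lin x0 (r * lam) a (lam *: b) = lin x0 r a b.
Proof.
move=> l0; apply/funext => x; rewrite /lin dotZl !dotZr invfM; congr (_ + _).
by rewrite mulrA [lam * _]mulrCA mulfV// mulr1.
Qed.

Lemma powR_vol_eball (t : R) : (0 < n)%N -> 0 < t ->
  vol (B t) `^ ((n%:R + 2) / (2 * n%:R)) =
  t * Num.sqrt (t ^+ n) * vol (B 1) `^ ((n%:R + 2) / (2 * n%:R)).
Proof.
move=> n0 t0; have nR : n%:R != 0 :> R by rewrite pnatr_eq0 -lt0n.
rewrite vol_eball// powRM ?exprn_ge0 ?(ltW t0)//; last by rewrite ltW// vol_eball_gt0.
congr (_ * _); rewrite -powR_mulrn ?(ltW t0)// -powRrM.
have -> : n%:R * ((n%:R + 2) / (2 * n%:R)) = 1 + n%:R * 2^-1 :> R.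
  by field.
rewrite powRD; last by rewrite gt_eqF// implybT.
rewrite powRr1 ?(ltW t0)// powRrM powR12_sqrt ?powR_ge0//.
Qed.

Lemma sqrt_expn_le (t : R) : (2 <= n)%N -> 0 < t -> t <= 1 -> Num.sqrt (t ^+ n) <= t.
Proof.
move=> n2 t0 t1; rewrite -[leRHS]ger0_norm ?(ltW t0)// -sqrtr_sqr ler_sqrt ?sqr_ge0//.
by rewrite ler_wiXn2l// ltW.
Qed.

(** [V] is only known to preserve combinations of the form [a u + w]. *)
Lemma operator_scale Om (V : (E -> R) -> (E -> R) -> R) (k : R) u v phi :
  open Om -> W12multiplier Om V -> W12 Om u -> W12 Om v -> W120 Om phi ->
  V (fun x => k * (u x - v x)) phi = k * (V u phi - V v phi).
Proof.
move=> oO [_ Vlin _] hu hv hphi; have hd := W12B oO hu hv.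
have -> : (fun x => k * (u x - v x)) = (fun x => (k - 1) * (u x - v x) + (u x - v x)).
  by apply/funext => x; ring.
rewrite Vlin//.
have -> : V (fun x => u x - v x) phi = V u phi - V v phi; last by ring.
have -> : (fun x => u x - v x) = (fun x => -1 * v x + u x) by apply/funext => x; ring.
by rewrite Vlin//; ring.
Qed.

Section dilation.
Variables (x0 : E) (r : R).
Hypothesis r0 : 0 < r.
Let T := aff x0 r.
Let S := @aff R n (- (r^-1 *: x0)) r^-1.
Let c := Num.sqrt (r ^+ n).

Let rn0 : r != 0. Proof. by rewrite gt_eqF. Qed.
Let rV0 : 0 < r^-1. Proof. by rewrite invr_gt0. Qed.

Lemma W12_unscale Om psi : open Om -> W12 (T @^-1` Om) psi -> W12 Om (psi \o S).
Proof.
move=> oO h; have := W12_aff (- (r^-1 *: x0)) rV0 (open_aff oO) h.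
by rewrite aff_preimageK.
Qed.

Lemma W120_unscale Om phi : open Om -> W120 (T @^-1` Om) phi -> W120 Om (phi \o S).
Proof.
move=> oO h; have := W120_aff (- (r^-1 *: x0)) rV0 (open_aff oO) h.
by rewrite aff_preimageK.
Qed.

Lemma L2norm_unscale A psi : measurable A -> L2 A (psi \o S) ->
  L2norm A (psi \o S) = c * L2norm (T @^-1` A) psi.
Proof. by move=> mA h; rewrite (L2norm_aff x0 r0 mA h) aff_compKV. Qed.

Lemma gradnorm_unscale Om A psi : open Om -> measurable A -> A `<=` Om ->
  W12 (T @^-1` Om) psi ->
  gradnorm Om A (psi \o S) = c / r * gradnorm (T @^-1` Om) (T @^-1` A) psi.
Proof.
move=> oO mA AO h; rewrite (gradnorm_aff x0 r0 oO mA AO (W12_unscale oO h)).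
by rewrite aff_compKV.
Qed.

Lemma aff_eball0 (s : R) : T @^-1` (eball x0 (r * s)) = B s.
Proof. by rewrite -(@aff_eball R n x0 0 r s r0) /aff scaler0 addr0. Qed.

Lemma esupp_unscale Om phi (rho : R) : esupp (T @^-1` Om) phi `<=` closure (B rho) ->
  esupp Om (phi \o S) `<=` closure (eball x0 (r * rho)).
Proof.
move=> h; have := @esupp_aff R n (- (r^-1 *: x0)) r^-1 (T @^-1` Om) phi rV0.
rewrite aff_preimageK// => h1 x /h1 /h hx.
have := @closure_aff R n (- (r^-1 *: x0)) r^-1 (B rho) (lt0r_neq0 rV0) x hx.
by rewrite -aff_eball0 aff_preimageK.
Qed.

Lemma W12norm_unscale Om : open Om -> exists C, 0 <= C /\
  forall psi, W12 (T @^-1` Om) psi -> W12norm Om (psi \o S) <= C * W12norm (T @^-1` Om) psi.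
Proof.
move=> oO; have mO := open_measurable_rV oO.
have c0 : 0 <= c by exact: sqrtr_ge0.
have C0 : 0 <= c + c / r by rewrite addr_ge0// divr_ge0// ltW.
exists (c + c / r); split=> // psi h; have h' := W12_unscale oO h.
apply: le_trans (W12norm_le_sum _ _) _.
rewrite (L2norm_unscale mO h'.1) (gradnorm_unscale oO mO (@subset_refl _ _) h) mulrDl lerD//.
  by rewrite ler_wpM2l// L2norm_le_W12norm.
by rewrite ler_wpM2l ?divr_ge0 ?(ltW r0)// gradnorm_le_W12norm.
Qed.

Lemma W12dual_unscale Om (g : (E -> R) -> R) : open Om -> W12dual Om g ->
  W12dual (T @^-1` Om) (fun phi => g (phi \o S)).
Proof.
move=> oO [gl [C hC]]; have mO := open_measurable_rV oO; split.
  by move=> a v w hv hw; rewrite -gl//; exact: W120_unscale.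
exists (C * (c / r)) => v hv; have hv' := W120_unscale oO hv.
by rewrite -mulrA -(gradnorm_unscale oO mO (@subset_refl _ _) hv.1); exact: hC.
Qed.

Lemma multiplier_unscale Om (V : (E -> R) -> (E -> R) -> R) (k : R) :
  open Om -> W12multiplier Om V ->
  W12multiplier (T @^-1` Om) (fun psi phi => k * V (psi \o S) (phi \o S)).
Proof.
move=> oO [Vd Vl [C hC]]; have mO := open_measurable_rV oO; split.
- by move=> psi hpsi; exact: (W12dualZ k (W12dual_unscale oO (Vd _ (W12_unscale oO hpsi)))).
- move=> a u w v hu hw hv.
  have -> : (fun x => a * u x + w x) \o S = (fun x => a * (u \o S) x + (w \o S) x) by [].
  rewrite Vl; [ring|exact: W12_unscale|exact: W12_unscale|exact: W120_unscale].
- have [C' [C'0 hC']] := W12norm_unscale oO.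
  exists (`|k| * (`|C| * C' * (c / r))) => u v hu hv.
  rewrite normrM -!mulrA ler_wpM2l//.
  apply: le_trans (hC _ _ (W12_unscale oO hu) (W120_unscale oO hv)) _.
  rewrite (gradnorm_unscale oO mO (@subset_refl _ _) hv.1).
  rewrite [leRHS](_ : _ = `|C| * (C' * W12norm (T @^-1` Om) u) *
    (c / r * gradnorm (T @^-1` Om) (T @^-1` Om) v)); last by ring.
  apply: ler_wpM2r.
    by rewrite mulr_ge0 ?gradnorm_ge0 ?divr_ge0 ?sqrtr_ge0 ?(ltW r0).
  apply: (@le_trans _ _ (`|C| * W12norm Om (u \o S))).
    by rewrite ler_wpM2r ?W12norm_ge0// ler_norm.
  by rewrite ler_wpM2l// hC'.
Qed.

Lemma dot_grad_scale Om G phi : open Om -> L2vec Om G -> W12 Om phi ->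
  \int[mu]_(y in T @^-1` Om) dot (G (T y)) (grad (T @^-1` Om) (phi \o T) y) =
  r / r ^+ n * \int[mu]_(x in Om) dot (G x) (grad Om phi x).
Proof.
move=> oO LG hphi; have mO := open_measurable_rV oO.
have mO' := @aff_preimage_measurable R n x0 r _ mO.
have id := integrable_dot mO LG (gradP hphi).1.
have id' := integrable_aff x0 r0 mO id.
rewrite [in RHS](Rintegral_aff x0 r0 mO id).
rewrite mulrA divfK ?expf_neq0// -(RintegralZl _ mO' id').
have LG' : L2vec (T @^-1` Om) (fun y => G (T y)).
  by move=> i; exact: (L2_aff x0 r0 mO (LG i)).
have hT := W12_aff x0 r0 oO hphi.
apply: ae_eq_Rint => //.
- exact: integrable_meas (integrable_dot mO' LG' (gradP hT).1).
- exact: integrable_meas (integrableZR r mO' id').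
- by apply: filterS (grad_aff x0 r0 oO hphi) => y h Oy; rewrite h// dotZr.
Qed.

Lemma integral_ge0_scale Om (h : E -> R) : measurable Om -> measurable_fun Om h ->
  (forall x, Om x -> 0 <= h x) ->
  (\int[mu]_(y in T @^-1` Om) (h (T y))%:E =
   ((r ^+ n)^-1)%:E * \int[mu]_(x in Om) (h x)%:E)%E.
Proof.
move=> mO mh h0; rewrite [in RHS](ge0_integral_aff x0 r0 mO)//; last exact/measurable_EFinP.
by rewrite muleA -EFinM mulVf ?mul1e// expf_neq0.
Qed.

End dilation.

End scaled_step.

Section scaled_step_main.
Context (R : realType) (n : nat).
Local Notation E := 'rV[R]_n.
Local Notation mu := (lebesgue_rV R n).
Local Notation B := (eball (0 : E)).
Local Notation v1 := (vol (B 1)).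
Local Notation pn := ((n%:R + 2) / (2 * n%:R)).
Implicit Types (u v w phi psi : E -> R) (f F G : E -> E) (Om D A : set E).

(** The local smallness hypotheses at the centre [x0] and radii at most [r / 2], with
    constant bounds [m1] and [m2] in place of the moduli. *)
Definition local_bounds Om (V : (E -> R) -> (E -> R) -> R) f (g : (E -> R) -> R)
    (x0 : E) (r m1 m2 : R) :=
  forall (rho : R) psi phi, 0 < rho -> rho <= r / 2 -> W12 Om psi -> W120 Om phi ->
    esupp Om phi `<=` closure (eball x0 rho) ->
    [/\ forall s : R, rho < s -> s <= 2 * rho ->
          `|V psi phi| <= m1 * L12norm Om x0 rho s psi * gradnorm Om (eball x0 rho) phi,
        (\int[mu]_(x in eball x0 rho) (enorm (f x) ^+ 2 * phi x ^+ 2)%:E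
         <= (m2 ^+ 2 * gradnorm Om (eball x0 rho) phi ^+ 2)%:E)%E &
        `|g phi| <= m2 / rho ^+ 2 * vol (B rho) `^ pn * gradnorm Om (eball x0 rho) phi].

(** Since [2 <= n], the L2 norm of a bounded function on a ball of radius [2 rho] is of
    order [rho], which compensates the weight [1 / rho]. *)
Lemma L12norm_affine_le (rho a : R) (b : E) Om : (2 <= n)%N -> 0 < rho -> rho <= 1 / 2 ->
  open Om -> B 1 `<=` Om -> W12 Om (fun y => a + dot b y) ->
  L12norm Om 0 rho (2 * rho) (fun y => a + dot b y) <=
  3 * Num.sqrt v1 * (`|a| + enorm b).
Proof.
move=> n2 rho0 rho1 oO BO hW; have t0 : 0 < 2 * rho by rewrite mulr_gt0.
have t1 : 2 * rho <= 1 by lra.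
have mB := @measurable_eball R n 0 (2 * rho); have oB := @eball_open R n 0 (2 * rho).
have oB1 := @eball_open R n 0 1.
have B2 : B (2 * rho) `<=` B 1 by exact: le_eball.
have bB := @bounded_set_eball R n 0 (2 * rho).
have sl := smooth_affine a b.
have ab0 : 0 <= `|a| + enorm b by rewrite addr_ge0// enorm_ge0.
have sv : 0 <= Num.sqrt v1 by exact: sqrtr_ge0.
have nB : Num.sqrt (vol (B (2 * rho))) <= 2 * rho * Num.sqrt v1.
  rewrite vol_eball// sqrtrM ?exprn_ge0 ?(ltW t0)// ler_wpM2r//.
  exact: sqrt_expn_le.
have csts (k : R) : 0 <= k -> L2norm (B (2 * rho)) (fun=> k) <= 2 * rho * Num.sqrt v1 * k.
  move=> k0; rewrite L2normE Rintegral_cst// sqrtrM ?sqr_ge0// sqrtr_sqr ger0_norm// mulrC.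
  by rewrite ler_wpM2r.
have cL2 (k : R) : L2 (B (2 * rho)) (fun=> k).
  by apply: L2_smooth => //; exact: smooth_cst.
have h1 : L2norm (B (2 * rho)) (fun y => a + dot b y) <= 2 * rho * Num.sqrt v1 * (`|a| + enorm b).
  apply: le_trans (csts _ ab0); apply: le_L2norm => //; first exact: L2_smooth.
  move=> y; rewrite /eball /= subr0 => hy.
  rewrite -[leLHS](real_normK (num_real _)) ler_pXn2r ?nnegrE//.
  apply: le_trans (ler_normD _ _) _; rewrite lerD2l.
  apply: le_trans (normr_dot_le _ _) _; rewrite ler_piMr ?enorm_ge0//.
  by rewrite (le_trans (ltW hy)).
have h2 : gradnorm Om (B (2 * rho)) (fun y => a + dot b y) <= 2 * rho * Num.sqrt v1 * enorm b.
  have wB := W12_smooth oB bB sl.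
  have wg := wgrad_smooth_bounded oB bB sl; rewrite nabla_affine in wg.
  rewrite (gradnorm_local oB oO oB (subset_trans B2 BO) (@subset_refl _ _) hW wB (fun _ _ => erefl)).
  rewrite (gradnormE oB mB (@subset_refl _ _) wB wg); apply: csts; exact: enorm_ge0.
rewrite /L12norm (_ : 2 * rho - rho = rho); last by ring.
apply: (@le_trans _ _ (2 * Num.sqrt v1 * (`|a| + enorm b) + Num.sqrt v1 * (`|a| + enorm b))).
  apply: lerD.
    rewrite ler_pdivrMr//; apply: le_trans h1 _.
    by apply: eq_ler; ring.
  apply: le_trans h2 _; apply: ler_pM; rewrite ?mulr_ge0 ?enorm_ge0 ?(ltW t0) ?(ltW rho0)//.
    by rewrite ler_piMl.
  by rewrite lerDr.
by apply: eq_ler; ring.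
Qed.

(** The rescaled error [(u - l) (x0 + r y) / N] solves a problem of the same form on the
    rescaled domain, in which the source contains [- V l / N]. The approximation on
    the unit ball then improves the affine function [l] on [eball x0 (r * lam)]. *)
Lemma scaled_step (C0 lam delta0 : R) Om (V : (E -> R) -> (E -> R) -> R) f
    (g : (E -> R) -> R) u (x0 : E) (r m1 m2 a N : R) (b : E) :
  (2 <= n)%N ->
  @approximation_constants R n C0 lam delta0 -> open Om -> bounded_set Om ->
  eball x0 r `<=` Om -> 0 < r ->
  W12multiplier Om V -> L2vec Om f -> admissible Om (fun x => enorm (f x) ^+ 2) ->
  W12dual Om g -> weak_solution Om V f g u ->
  0 <= m1 -> 0 <= m2 -> 0 < N ->
  local_bounds Om V f g x0 r m1 m2 ->
  2 * m1 <= delta0 -> m2 <= delta0 * N ->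
  m2 * v1 `^ pn + m1 * (3 * Num.sqrt v1 * (`|a| + enorm b)) <= delta0 * N ->
  L2norm (eball x0 r) (fun x => u x - lin x0 r a b x) <= N * Num.sqrt (vol (eball x0 r)) ->
  exists (a' : R) (b' : E), `|a'| + enorm b' <= C0 /\
    L2norm (eball x0 (r * lam))
      (fun x => u x - lin x0 r (a + N * a') (b + N *: b') x) <=
    N * (lam / 2) * Num.sqrt (vol (eball x0 (r * lam))).
Proof.
move=> n2 hC oO bO BO r0 hV Lf hf hg hw m10 m20 N0 small hm1 hm2 hm12 happ.
have [C00 /andP[lam0 lam1] d0 _] := hC.
have n0 : (0 < n)%N by apply: leq_trans n2.
have rn0 : r != 0 by rewrite gt_eqF.
have rnn : 0 < r ^+ n by rewrite exprn_gt0.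
have mO := open_measurable_rV oO.
pose T := aff x0 r; pose S := @aff R n (- (r^-1 *: x0)) r^-1.
pose c := Num.sqrt (r ^+ n); have c0 : 0 < c by rewrite sqrtr_gt0.
have c2 : c ^+ 2 = r ^+ n by rewrite sqr_sqrtr// ltW.
pose k := r ^+ 2 / r ^+ n; have k0 : 0 < k by rewrite divr_gt0// exprn_gt0.
have kc : k * (c / r) * (c / r) = 1.
  rewrite /k -c2; field; rewrite rn0; by rewrite gt_eqF.
pose l := lin x0 r a b.
have lE : l = (fun y => a + dot b y) \o S by exact: lin_affV.
have Wl : W12 Om l by apply: W12_smooth => //; exact: smooth_lin.
have [hu hueq] := hw.
have hd := W12B oO hu Wl.
pose Om1 := T @^-1` Om.
have oO1 : open Om1 by exact: open_aff.
have mO1 := open_measurable_rV oO1.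
have BT (s : R) : T @^-1` (eball x0 (r * s)) = B s by exact: aff_eball0.
have BO1 : B 1 `<=` Om1.
  by move=> y; rewrite -BT mulr1 => /BO.
pose w y := N^-1 * (u (T y) - l (T y)).
have wS : w \o S = (fun x => N^-1 * (u x - l x)).
  by apply/funext => x; rewrite /w /T /S /= affKV.
have wT : w = (fun x => N^-1 * (u x - l x)) \o T by [].
have hNd : W12 Om (fun x => N^-1 * (u x - l x)).
  have := W12_comb (N^-1 - 1) oO hd hd; congr (W12 _ _).
  by apply/funext => x; ring.
have hw1 : W12 Om1 w by rewrite wT; exact: W12_aff.
pose V1 psi phi := k * V (psi \o S) (phi \o S).
pose f1 y := (r / N) *: f (T y).
pose g1 phi := k / N * (g (phi \o S) - V l (phi \o S)).
have Lf1 : L2vec Om1 f1.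
  move=> i; apply: (@eq_L2 _ _ _ (fun y => (r / N) * f (T y) 0 i)).
    by move=> y _; rewrite mxE.
  by apply: L2Z => //; exact: (L2_aff x0 r0 mO (Lf i)).
have f1sq y : enorm (f1 y) ^+ 2 = (r / N) ^+ 2 * enorm (f (T y)) ^+ 2.
  by rewrite enormZ exprMn real_normK ?num_real.
have Lef := L2vec_enorm mO Lf.
have [Vd _ _] := hV.
have TK (psi : E -> R) : (psi \o S) \o T = psi by exact: aff_compKV.
(* the square integral of [f1] against [phi] is, up to a factor, that of [f] *)
have fscale A phi : measurable A -> A `<=` Om -> W120 Om1 phi ->
    (\int[mu]_(y in T @^-1` A) (enorm (f1 y) ^+ 2 * phi y ^+ 2)%:E =
     ((r / N) ^+ 2 / r ^+ n)%:E *
     \int[mu]_(x in A) (enorm (f x) ^+ 2 * (phi \o S) x ^+ 2)%:E)%E.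
  move=> mA AO hphi; have hphi' := W120_unscale r0 oO hphi.
  have mh : measurable_fun A (fun x => enorm (f x) ^+ 2 * (phi \o S) x ^+ 2).
    apply: measurable_funM; apply: measurable_funX; apply: (measurable_funS mO AO).
      exact: L2_meas Lef.
    exact: L2_meas hphi'.1.1.
  have h0 x : A x -> 0 <= enorm (f x) ^+ 2 * (phi \o S) x ^+ 2 by rewrite mulr_ge0 ?sqr_ge0.
  rewrite EFinM -muleA -(@integral_ge0_scale R n x0 r r0 A _ mA mh h0).
  rewrite -ge0_integralZl.
  - apply: eq_integral => y _; rewrite -EFinM f1sq -mulrA; congr ((_ * (_ * _ ^+ 2))%:E).
    by rewrite -[in LHS](TK phi).
  - exact: aff_preimage_measurable.
  - by apply/measurable_EFinP; exact: (@measurable_fun_aff R n x0 r _ _ A _ mA mh).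
  - by move=> y Ay; rewrite lee_fin; exact: h0.
  - by rewrite lee_fin sqr_ge0.
have adm1 : admissible Om1 (fun y => enorm (f1 y) ^+ 2).
  have [iq q0 [C hCf]] := hf; split.
  - under eq_fun do rewrite f1sq; apply: integrableZR => //.
    exact: (integrable_aff x0 r0 mO iq).
  - by move=> y _; exact: sqr_ge0.
  exists ((r / N) ^+ 2 / r ^+ n * C * (c / r) ^+ 2) => phi hphi.
  have hphi' := W120_unscale r0 oO hphi.
  under eq_integral do rewrite mulrC.
  rewrite (fscale Om phi mO (@subset_refl _ _) hphi).
  have := hCf _ hphi'; rewrite (gradnorm_unscale r0 oO mO (@subset_refl _ _) hphi.1) => h.
  under eq_integral do rewrite mulrC.
  have kk : (0 <= ((r / N) ^+ 2 / r ^+ n)%:E)%E by rewrite lee_fin divr_ge0 ?sqr_ge0 ?(ltW rnn).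
  apply: le_trans (lee_wpmul2l kk h) _; rewrite -EFinM lee_fin exprMn.
  by apply: eq_ler; rewrite -/c -/T -/Om1; ring.
have sol1 : weak_solution Om1 V1 f1 g1 w.
  split=> // phi hphi; have hphi' := W120_unscale r0 oO hphi.
  have Lgu := (gradP hu).1.
  have Lcb : L2vec Om (fun=> b) by move=> i; apply: L2_smooth => //; exact: smooth_cst.
  (* affine functions are harmonic: they only enter the equation through [V] *)
  have zero : \int[mu]_(x in Om) dot b (grad Om (phi \o S) x) = 0.
    have Lgp := (gradP hphi'.1).1.
    have by0 i : \int[mu]_(x in Om) (grad Om (phi \o S) x 0 i) = 0.
      have s1 := @smooth_cst R n 1.
      have d1 : partial i ((fun=> 1) : E -> R) = fun=> 0 by exact: partial_cst.
      have L0 : L2 Om (partial i ((fun=> 1) : E -> R)) by rewrite d1; exact: L2_cst0.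
      have := W120_by_parts oO hphi' s1 (L2_smooth oO bO s1) L0; rewrite d1.
      under eq_Rintegral do rewrite mulr0.
      rewrite {1}/Rintegral integral0 /= => /esym/eqP; rewrite oppr_eq0 => /eqP h.
      by rewrite -[RHS]h; apply: eq_Rintegral => x _; rewrite mulr1.
    have ig i : mu.-integrable Om (EFin \o (fun x => grad Om (phi \o S) x 0 i)).
      have := L2M mO (Lgp i) (L2_smooth oO bO (@smooth_cst R n 1)).
      by congr (_.-integrable _ _); apply/funext => x /=; rewrite mulr1.
    have sumI (s : seq 'I_n) :
        \int[mu]_(x in Om) (\sum_(i <- s) b 0 i * grad Om (phi \o S) x 0 i) = 0.
      elim: s => [|i s IH].
        by under eq_Rintegral do rewrite big_nil; rewrite /Rintegral integral0.
      under eq_Rintegral do rewrite big_cons.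
      rewrite RintegralD//.
      - by rewrite IH (RintegralZl _ mO (ig i)) by0 mulr0 addr0.
      - exact: (integrableZR _ mO (ig i)).
      - by apply: integrable_sumR => // j; exact: (integrableZR _ mO (ig j)).
    exact: sumI.
  have Lf' := dot_grad_scale x0 r0 oO Lf hphi'.1.
  have Lu' := dot_grad_scale x0 r0 oO Lgu hphi'.1.
  have Lb' := dot_grad_scale x0 r0 oO Lcb hphi'.1.
  rewrite zero mulr0 in Lb'; rewrite -/T -/Om1 TK in Lf' Lu' Lb'.
  have gphi := (gradP hphi.1).1.
  have LuT : L2vec Om1 (fun y => grad Om u (T y)) by move=> i; exact: (L2_aff x0 r0 mO (Lgu i)).
  have LfT : L2vec Om1 (fun y => f (T y)) by move=> i; exact: (L2_aff x0 r0 mO (Lf i)).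
  have LbT : L2vec Om1 (fun=> b) by move=> i; exact: (L2_aff x0 r0 mO (Lcb i)).
  have iu := integrable_dot mO1 LuT gphi.
  have ib := integrable_dot mO1 LbT gphi.
  have if' := integrable_dot mO1 LfT gphi.
  have e1 : \int[mu]_(y in Om1) dot (grad Om1 w y) (grad Om1 phi y) =
      N^-1 * (r * (r / r ^+ n * \int[mu]_(x in Om) dot (grad Om u x) (grad Om (phi \o S) x))).
    rewrite -Lu'.
    transitivity (\int[mu]_(y in Om1) (N^-1 * (r * dot (grad Om u (T y)) (grad Om1 phi y) -
       dot b (grad Om1 phi y)))).
      have wgd := wgradB oO hu.1 Wl.1 (gradP hu) (wgrad_smooth_bounded oO bO (smooth_lin x0 r a b)).
      have wgN := wgrad_comb (N^-1 - 1) oO hd.1 hd.1 wgd wgd.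
      have wgN' : wgrad Om (fun x => N^-1 * (u x - l x))
         (fun x => N^-1 *: (grad Om u x - nabla l x)).
        move: wgN; congr wgrad; apply/funext => x; first by rewrite /l; ring.
        by rewrite scalerBl scale1r subrK.
      have wgT := wgrad_aff x0 r0 oO hNd.1 wgN'.
      have gT := grad_ae oO1 hw1 wgT.
      have nl y : r *: nabla l (T y) = b.
        apply/rowP => i; rewrite !mxE.
        have := partial_affine a b i; rewrite -(lin_aff x0 a b rn0) -/l.
        rewrite partial_aff; last exact: smooth_lin.
        by move=> /(congr1 (fun h => h y)).
      apply: ae_eq_Rint => //.
      - exact: integrable_meas (integrable_dot mO1 (gradP hw1).1 gphi).
      - apply: measurable_funM => //; apply: measurable_funB.
          by apply: measurable_funM => //; exact: integrable_meas iu.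
        exact: integrable_meas ib.
      - apply: filterS gT => y h Oy; rewrite h// scalerA mulrC -scalerA scalerBr nl.
        by rewrite dotZl -scaleN1r dotDl !dotZl mulN1r.
    have izu := integrableZR r mO1 iu.
    rewrite (RintegralZl _ mO1 (integrableBR mO1 izu ib)) (RintegralB mO1 izu ib).
    by rewrite Lb' subr0 (RintegralZl _ mO1 iu).
  have e2 : \int[mu]_(y in Om1) dot (f1 y) (grad Om1 phi y) =
      r / N * (r / r ^+ n * \int[mu]_(x in Om) dot (f x) (grad Om (phi \o S) x)).
    rewrite -Lf' -(RintegralZl _ mO1 if').
    by apply: eq_Rintegral => y _; rewrite dotZl.
  have e3 : V1 w phi = k * (N^-1 * (V u (phi \o S) - V l (phi \o S))).
    by rewrite /V1 wS (operator_scale _ oO hV hu Wl hphi').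
  rewrite e1 e2 e3 /g1; have := hueq _ hphi'.
  move: (\int[mu]_(x in Om) dot _ _) (\int[mu]_(x in Om) dot (f _) _) (V u _) (V l _) (g _).
  move=> I1 I2 p q s h; have -> : p = I2 + s - I1 by rewrite -h; ring.
  rewrite /k; field; by rewrite gt_eqF// gt_eqF.
have avg1 : average (B 1) (fun y => w y ^+ 2) <= 1.
  rewrite /average -L2norm_sqr ler_pdivrMl ?vol_eball_gt0// mulr1.
  have v1p : 0 < v1 by exact: vol_eball_gt0.
  have hB1 : L2 (eball x0 r) (fun x => u x - l x).
    by apply: L2W hd.1 => //; exact: measurable_eball.
  move: happ; rewrite (L2norm_aff x0 r0 (@measurable_eball R n x0 r) hB1).
  have := BT 1; rewrite mulr1 => ->.
  rewrite vol_eball// sqrtrM ?(ltW rnn)// -/c mulrCA ler_pM2l// => h.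
  rewrite -[leRHS](sqr_sqrtr (ltW v1p)) ler_pXn2r ?nnegrE ?L2norm_ge0 ?sqrtr_ge0//.
  rewrite /w L2normZ; first by rewrite gtr0_norm ?invr_gt0// ler_pdivrMl.
    exact: measurable_eball.
  by have := L2_aff x0 r0 (@measurable_eball R n x0 r) hB1; have := BT 1; rewrite mulr1 => ->.
have small1 (rho : R) psi phi : 0 < rho -> rho <= 1 / 2 -> W12 Om1 psi -> W120 Om1 phi ->
     esupp Om1 phi `<=` closure (B rho) ->
     [/\ forall s : R, rho < s -> s <= 2 * rho ->
           `|V1 psi phi| <= delta0 / 2 * L12norm Om1 0 rho s psi * gradnorm Om1 (B rho) phi,
         `|g1 phi| <= delta0 * gradnorm Om1 (B rho) phi &
         (\int[mu]_(x in B rho) (enorm (f1 x) ^+ 2 * phi x ^+ 2)%:E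
          <= (delta0 ^+ 2 * gradnorm Om1 (B rho) phi ^+ 2)%:E)%E].
  move=> rho0 rho1 hpsi hphi hsupp.
  have hphi' := W120_unscale r0 oO hphi.
  have hsupp' := @esupp_unscale R n x0 r r0 Om phi rho hsupp.
  have rr0 : 0 < r * rho by rewrite mulr_gt0.
  have rr1 : r * rho <= r / 2 by rewrite ler_pM2l//; lra.
  have mBr := @measurable_eball R n x0 (r * rho).
  have subr (s : R) : s <= 1 -> eball x0 (r * s) `<=` Om.
    by move=> s1; apply: subset_trans BO; apply: le_eball; rewrite ler_piMr ?(ltW r0).
  have rhole1 : rho <= 1 by lra.
  have gS : gradnorm Om (eball x0 (r * rho)) (phi \o S) = c / r * gradnorm Om1 (B rho) phi.
    by rewrite (gradnorm_unscale r0 oO mBr (subr _ rhole1) hphi.1) BT.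
  have G0 := gradnorm_ge0 Om1 (B rho) phi.
  (* the estimate of [V] is invariant under dilations *)
  have Vest eta (s : R) : W12 Om1 eta -> rho < s -> s <= 2 * rho ->
      `|k * V (eta \o S) (phi \o S)| <= m1 * L12norm Om1 0 rho s eta * gradnorm Om1 (B rho) phi.
    move=> heta rs s2; have heta' := W12_unscale r0 oO heta.
    have [hVs _ _] := small _ _ _ rr0 rr1 heta' hphi' hsupp'.
    have rs' : r * rho < r * s by rewrite ltr_pM2l.
    have s2' : r * s <= 2 * (r * rho) by rewrite mulrCA ler_pM2l.
    have s1 : s <= 1 by lra.
    have mBs := @measurable_eball R n x0 (r * s).
    have := hVs _ rs' s2'; rewrite gS => h.
    rewrite normrM (gtr0_norm k0); apply: le_trans (ler_wpM2l (ltW k0) h) _.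
    have -> : L12norm Om x0 (r * rho) (r * s) (eta \o S) = c / r * L12norm Om1 0 rho s eta.
      rewrite /L12norm (gradnorm_unscale r0 oO mBs (subr _ s1) heta) BT.
      rewrite (L2norm_unscale r0 mBs); last by apply: L2W heta'.1 => //; exact: subr.
      rewrite BT -/c -mulrBr invfM; ring.
    apply: eq_ler.
    rewrite -[RHS]mul1r -kc; ring.
  split.
  - move=> s rs s2; apply: le_trans (Vest _ _ hpsi rs s2) _.
    rewrite ler_wpM2r// ler_wpM2r ?L12norm_ge0//; lra.
  - have hl1 : W12 Om1 (fun y => a + dot b y).
      by rewrite -(lin_aff x0 a b rn0); exact: W12_aff.
    have rho2 : rho < 2 * rho by lra.
    have := Vest _ _ hl1 rho2 (lexx _); rewrite -lE.
    have aff1 := L12norm_affine_le n2 rho0 rho1 oO1 BO1 hl1.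
    have [_ _] := small _ _ _ rr0 rr1 Wl hphi' hsupp'; rewrite gS => hgs hVl.
    rewrite /g1 normrM (gtr0_norm (divr_gt0 k0 N0)).
    apply: (@le_trans _ _ (k / N * (`|g (phi \o S)| + `|V l (phi \o S)|))).
      by rewrite ler_wpM2l ?(ltW (divr_gt0 k0 N0))// ler_normB.
    rewrite mulrAC ler_pdivrMr// mulrDr -[X in _ + X * _](gtr0_norm k0) -normrM.
    apply: (@le_trans _ _ ((m2 * v1 `^ pn + m1 * (3 * Num.sqrt v1 * (`|a| + enorm b))) *
        gradnorm Om1 (B rho) phi)); last by rewrite [leRHS]mulrAC ler_wpM2r.
    rewrite mulrDl lerD//; last first.
      by apply: le_trans hVl _; rewrite ler_wpM2r// ler_wpM2l.
    apply: le_trans (ler_wpM2l (ltW k0) hgs) _.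
    rewrite (powR_vol_eball n0 rr0) [leLHS](_ : _ =
      (m2 * v1 `^ pn * gradnorm Om1 (B rho) phi) * (Num.sqrt (rho ^+ n) / rho)).
      rewrite ler_piMr ?mulr_ge0 ?powR_ge0// ler_pdivrMr// mul1r.
      by apply: sqrt_expn_le => //; lra.
    rewrite [(r * rho) ^+ n]exprMn sqrtrM ?(ltW rnn)// -/c /k -c2; field.
    by rewrite rn0 !gt_eqF.
  - have := fscale (eball x0 (r * rho)) phi mBr (subr _ rhole1) hphi; rewrite BT => ->.
    have [_ hfs _] := small _ _ _ rr0 rr1 Wl hphi' hsupp'; rewrite gS in hfs.
    have kk : (0 <= ((r / N) ^+ 2 / r ^+ n)%:E)%E by rewrite lee_fin divr_ge0 ?sqr_ge0 ?(ltW rnn).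
    apply: le_trans (lee_wpmul2l kk hfs) _; rewrite -EFinM lee_fin -c2.
    have -> : (r / N) ^+ 2 / c ^+ 2 * (m2 ^+ 2 * (c / r * gradnorm Om1 (B rho) phi) ^+ 2) =
        (m2 / N) ^+ 2 * gradnorm Om1 (B rho) phi ^+ 2.
      by field; rewrite rn0 !gt_eqF.
    rewrite ler_wpM2r ?sqr_ge0// ler_pXn2r ?nnegrE ?(ltW d0) ?divr_ge0 ?(ltW N0)//.
    by rewrite ler_pdivrMr.
have [a' [b' [happ' hab]]] := unit_step hC oO1 BO1 (multiplier_unscale x0 r0 k oO hV) Lf1 adm1
  (W12dualZ (k / N) (W12dualB (W12dual_unscale x0 r0 oO hg) (W12dual_unscale x0 r0 oO (Vd _ Wl))))
  sol1 avg1 small1.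
exists a', b'; split=> //.
have rl0 : 0 < r * lam by rewrite mulr_gt0.
have mBl := @measurable_eball R n x0 (r * lam).
have BlO : eball x0 (r * lam) `<=` Om.
  by apply: subset_trans BO; apply: le_eball; rewrite ler_piMr ?(ltW r0)// ltW.
have Wl2 : W12 Om (lin x0 r (a + N * a') (b + N *: b')).
  by apply: W12_smooth => //; exact: smooth_lin.
have L2l : L2 (eball x0 (r * lam)) (fun x => u x - lin x0 r (a + N * a') (b + N *: b') x).
  by apply: L2W (W12B oO hu Wl2).1.
rewrite (L2norm_aff x0 r0 mBl L2l) BT -/c.
have vl0 : 0 < vol (B lam) by exact: vol_eball_gt0.
have -> : vol (eball x0 (r * lam)) = r ^+ n * vol (B lam).
  by rewrite (@vol_eball R n x0 _ rl0) (@vol_eball R n 0 _ lam0) exprMn mulrA.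
rewrite sqrtrM ?(ltW rnn)// -/c mulrCA ler_pM2l//.
have Lwl : L2 (B lam) (fun y => w y - (a' + dot b' y)).
  apply: L2B; first exact: measurable_eball.
    apply: L2W hw1.1 => //; first exact: measurable_eball.
    by apply: subset_trans BO1; apply: le_eball; exact: ltW.
  apply: L2_smooth; [exact: eball_open|exact: bounded_set_eball|exact: smooth_affine].
rewrite (@eq_L2norm _ _ _ _ (fun y => N * (w y - (a' + dot b' y)))); last first.
  move=> y _; rewrite /= linD -[lin x0 r a' b' _]/((lin x0 r a' b' \o T) y) lin_aff//.
  rewrite /w -/T -/l; field; by rewrite gt_eqF.
rewrite L2normZ//; last exact: measurable_eball.
rewrite (gtr0_norm N0) -mulrA ler_pM2l//.
move: happ'; rewrite /average.
have -> : \int[mu]_(x in B lam) `|w x - (a' + dot b' x)| ^+ 2 =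
    L2norm (B lam) (fun y => w y - (a' + dot b' y)) ^+ 2.
  by rewrite L2norm_sqr; apply: eq_Rintegral => y _; rewrite real_normK ?num_real.
rewrite sqrtrM ?invr_ge0 ?(ltW vl0)// sqrtr_sqr (ger0_norm (L2norm_ge0 _ _)).
by rewrite sqrtrV ?(ltW vl0)// ler_pdivrMl ?sqrtr_gt0// mulrC.
Qed.

End scaled_step_main.

(** * Iteration over the scales *)

Section recursion.
Context (R : realType).

Lemma bounded_series_cvg0 (s : nat -> R) (M : R) : (forall k, 0 <= s k) ->
  (forall m, \sum_(k < m) s k <= M) -> s k @[k --> \oo] --> 0.
Proof.
move=> s0 sM; apply: cvg_series_cvg_0; apply: nondecreasing_is_cvgn.
  by apply/nondecreasing_seqP => m; rewrite /series /= big_nat_recr//= lerDl.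
by exists M => _ [m _ <-]; rewrite /series /= big_mkord.
Qed.

Variables (C0 lam X : R) (al be : nat -> R).

(** [N] bounds the normalized errors, [L] the sizes of the affine functions and [D]
    their rescaled slopes; all three are independent of the centre. *)
Fixpoint NL (k : nat) : R * R :=
  if k is j.+1 then
    let L' := (NL j).2 + C0 * (NL j).1 in ((NL j).1 / 2 + al k + be k * L', L')
  else (X + al 0%N, 0).

Definition Nseq k := (NL k).1.
Definition Lseq k := (NL k).2.

Fixpoint Dseq k : R := if k is j.+1 then lam * (Dseq j + C0 * Nseq j) else 0.

Lemma NseqS k : Nseq k.+1 = Nseq k / 2 + al k.+1 + be k.+1 * Lseq k.+1.
Proof. by []. Qed.

Lemma LseqS k : Lseq k.+1 = Lseq k + C0 * Nseq k.
Proof. by []. Qed.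

Hypotheses (C00 : 0 < C0) (lam0 : 0 < lam) (lam1 : lam < 1) (X0 : 0 < X).
Hypotheses (al0 : forall k, 0 <= al k) (be0 : forall k, 0 <= be k).

Lemma Nseq_Lseq k : 0 < Nseq k /\ 0 <= Lseq k.
Proof.
elim: k => [|k [N0 L0]]; first by split=> //; rewrite ltr_wpDr.
have L1 : 0 <= Lseq k.+1 by rewrite LseqS addr_ge0// mulr_ge0 ?ltW.
by split=> //; rewrite NseqS -addrA ltr_wpDr ?divr_gt0// addr_ge0// mulr_ge0.
Qed.

Lemma Nseq_gt0 k : 0 < Nseq k. Proof. by have [] := Nseq_Lseq k. Qed.

Lemma Lseq_ge0 k : 0 <= Lseq k. Proof. by have [] := Nseq_Lseq k. Qed.

Lemma Nseq_ge k : al k + be k * Lseq k <= Nseq k.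
Proof.
case: k => [|k]; first by rewrite mulr0 addr0 lerDr ltW.
by rewrite NseqS -addrA lerDr divr_ge0// ltW// Nseq_gt0.
Qed.

Lemma Lseq_sum m : Lseq m = C0 * \sum_(k < m) Nseq k.
Proof.
elim: m => [|m IH]; first by rewrite big_ord0 mulr0.
by rewrite LseqS IH big_ord_recr/= mulrDr.
Qed.

Lemma Dseq_ge0 k : 0 <= Dseq k.
Proof.
elim: k => [//|k IH] /=; rewrite mulr_ge0 ?addr_ge0 ?mulr_ge0 ?(ltW C00) ?(ltW lam0)//.
by rewrite ltW// Nseq_gt0.
Qed.

Hypothesis be_small : forall m, C0 * \sum_(k < m) be k <= 1 / 4.

(** Summing the recursion, half of the sum of the [Nseq] is absorbed by the factor
    1/2 and a quarter by the smallness of the sum of the [be]. *)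
Lemma Nseq_sum m : \sum_(k < m) Nseq k <= 4 * (X + \sum_(k < m) al k).
Proof.
case: m => [|m]; first by rewrite !big_ord0 mulr_ge0// addr0 ltW.
set S := \sum_(k < m.+1) Nseq k.
have S0 : 0 <= S by apply: sumr_ge0 => i _; rewrite ltW// Nseq_gt0.
have LS (k : nat) : (k <= m)%N -> Lseq k <= C0 * S.
  move=> km; rewrite Lseq_sum ler_wpM2l ?(ltW C00)// /S -!(big_mkord predT Nseq).
  rewrite [leRHS](big_cat_nat (n := k))//=; last exact: leq_trans km _.
  by rewrite lerDl sumr_ge0// => i _; rewrite ltW// Nseq_gt0.
have : S <= X + S / 2 + \sum_(k < m.+1) al k + C0 * S * \sum_(k < m.+1) be k.
  rewrite {1}/S big_ord_recl /=.
  have h1 : \sum_(i < m) Nseq (bump 0 i) <=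
      S / 2 + \sum_(i < m) al i.+1 + C0 * S * \sum_(i < m) be i.+1.
    apply: (@le_trans _ _ (\sum_(i < m) (Nseq i / 2 + al i.+1 + be i.+1 * (C0 * S)))).
      apply: ler_sum => i _; rewrite /bump leq0n add1n NseqS lerD2l ler_wpM2l//.
      exact: LS.
    rewrite !big_split /= -!mulr_suml [X in _ + _ + X]mulrC lerD2r lerD2r.
    by rewrite ler_wpM2r ?invr_ge0// /S big_ord_recr /= lerDl ltW// Nseq_gt0.
  have h2 : \sum_(k < m.+1) al k = al 0%N + \sum_(i < m) al i.+1.
    by rewrite big_ord_recl.
  have h3 : C0 * S * \sum_(i < m) be i.+1 <= C0 * S * \sum_(k < m.+1) be k.
    by rewrite ler_wpM2l ?mulr_ge0 ?(ltW C00)// big_ord_recl /= lerDr.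
  rewrite h2; have E0 : Nseq 0%N = X + al 0%N by [].
  by rewrite E0; lra.
have := ler_wpM2r S0 (be_small m.+1).
rewrite mulrAC; lra.
Qed.

Lemma Dseq_sum m : (1 - lam) * \sum_(k < m) Dseq k <= C0 * \sum_(k < m) Nseq k.
Proof.
have key p : \sum_(k < p.+1) Dseq k <= lam * (\sum_(k < p) Dseq k + C0 * \sum_(k < p) Nseq k).
  rewrite big_ord_recl add0r mulr_sumr -big_split/= mulr_sumr.
  by apply: ler_sum => i _.
case: m => [|m]; first by rewrite !big_ord0 !mulr0.
have h := key m; have D0 : 0 <= \sum_(k < m) Dseq k by apply: sumr_ge0 => i _; exact: Dseq_ge0.
have D1 := Dseq_ge0 m; have N1 := Nseq_gt0 m.
have N0 : 0 <= \sum_(k < m) Nseq k by apply: sumr_ge0 => i _; rewrite ltW// Nseq_gt0.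
rewrite big_ord_recr /= in h *; rewrite [X in _ <= C0 * X]big_ord_recr /=.
have CN0 : 0 <= C0 * \sum_(k < m) Nseq k by rewrite mulr_ge0// ltW.
have CN1 : 0 <= C0 * Nseq m by rewrite mulr_ge0// ltW.
rewrite [leRHS]mulrDr; move: (C0 * Nseq m) (C0 * \sum_(k < m) Nseq k) (\sum_(k < m) Dseq k) (Dseq m)
   h D0 D1 CN0 CN1 => p q s t h s0 t0 q0 p0.
have h1 := mulr_ge0 (ltW lam0) t0.
have h2 : 0 <= (1 - lam) * q by rewrite mulr_ge0// subr_ge0 ltW.
lra.
Qed.

End recursion.

Section iteration.
Context (R : realType) (n : nat).
Local Notation E := 'rV[R]_n.
Local Notation mu := (lebesgue_rV R n).
Local Notation v1 := (vol (eball (0 : E) 1)).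
Local Notation pn := ((n%:R + 2) / (2 * n%:R)).

(** The normalization constants of [scaled_step]: the errors must dominate
    [cst2 * omega2] and [cst1 * omega1] times the size of the affine function. *)
Definition cst2 (delta0 : R) : R := (1 + v1 `^ pn) / delta0.
Definition cst1 (delta0 : R) : R := 3 * Num.sqrt v1 / delta0.

Variables (C0 lam delta0 : R).
Hypothesis hC : @approximation_constants R n C0 lam delta0.
Hypothesis n2 : (2 <= n)%N.

Lemma cst2_gt0 : 0 < cst2 delta0.
Proof. by have [_ _ d0 _] := hC; rewrite divr_gt0// ltr_wpDr ?powR_ge0. Qed.

Lemma cst1_gt0 : 0 < cst1 delta0.
Proof.
have [_ _ d0 _] := hC; rewrite divr_gt0// mulr_gt0// sqrtr_gt0.
exact: vol_eball_gt0.
Qed.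

Variables (Om : set E) (V : (E -> R) -> (E -> R) -> R) (f : E -> E)
  (g : (E -> R) -> R) (u : E -> R) (x0 : E) (r X : R) (m1 m2 : nat -> R).
Hypotheses (oO : open Om) (bO : bounded_set Om) (r0 : 0 < r) (BO : eball x0 r `<=` Om).
Hypotheses (hV : W12multiplier Om V) (Lf : L2vec Om f)
  (hf : admissible Om (fun x => enorm (f x) ^+ 2)) (hg : W12dual Om g)
  (hw : weak_solution Om V f g u).
Hypotheses (m10 : forall k, 0 <= m1 k) (m20 : forall k, 0 <= m2 k) (X0 : 0 < X).
Hypothesis small : forall k, local_bounds Om V f g x0 (r * lam ^+ k) (m1 k) (m2 k).
Hypothesis m1_small : forall k, 2 * m1 k <= delta0.
Hypothesis hX : L2norm Om u <= X * Num.sqrt (vol (eball x0 r)).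

Let al k := cst2 delta0 * m2 k.
Let be k := cst1 delta0 * m1 k.
Let N := Nseq C0 X al be.
Let L := Lseq C0 X al be.
Let D := Dseq C0 lam X al be.

Let C00 : 0 < C0. Proof. by have [] := hC. Qed.
Let lam0 : 0 < lam. Proof. by have [_ /andP[]] := hC. Qed.
Let lam1 : lam < 1. Proof. by have [_ /andP[]] := hC. Qed.
Let d0 : 0 < delta0. Proof. by have [] := hC. Qed.
Let al0 k : 0 <= al k. Proof. by rewrite mulr_ge0// ltW// cst2_gt0. Qed.
Let be0 k : 0 <= be k. Proof. by rewrite mulr_ge0// ltW// cst1_gt0. Qed.

Let good k (p : R * E) :=
  [/\ `|p.1| + enorm p.2 <= L k, enorm p.2 <= D k &
   L2norm (eball x0 (r * lam ^+ k)) (fun x => u x - lin x0 (r * lam ^+ k) p.1 p.2 x) <=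
   N k * Num.sqrt (vol (eball x0 (r * lam ^+ k)))].

Let good_step k p : good k p -> exists q, good k.+1 q /\ `|q.1 - p.1| <= C0 * N k.
Proof.
case: p => a b [/= hL hD happ].
have rk0 : 0 < r * lam ^+ k by rewrite mulr_gt0// exprn_gt0.
have rk1 : r * lam ^+ k <= r by rewrite ler_piMr ?(ltW r0)// exprn_ile1// ltW.
have N0 : 0 < N k by exact: Nseq_gt0.
have L0 : 0 <= L k by exact: Lseq_ge0.
have Nge : al k + be k * L k <= N k by exact: Nseq_ge.
have alE : delta0 * al k = m2 k + m2 k * v1 `^ pn.
  by rewrite /al /cst2; field; rewrite gt_eqF.
have beE : delta0 * (be k * L k) = m1 k * (3 * Num.sqrt v1 * L k).
  by rewrite /be /cst1; field; rewrite gt_eqF.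
have dN := ler_wpM2l (ltW d0) Nge; rewrite mulrDr alE beE in dN.
have p1 : 0 <= m2 k * v1 `^ pn by rewrite mulr_ge0 ?powR_ge0.
have p2 : 0 <= m1 k * (3 * Num.sqrt v1 * L k).
  by rewrite mulr_ge0// mulr_ge0// mulr_ge0 ?sqrtr_ge0.
have p3 : m1 k * (3 * Num.sqrt v1 * (`|a| + enorm b)) <= m1 k * (3 * Num.sqrt v1 * L k).
  by rewrite ler_wpM2l// ler_wpM2l// mulr_ge0 ?sqrtr_ge0.
have m2k := m20 k.
have c1 : m2 k <= delta0 * N k by lra.
have c2 : m2 k * v1 `^ pn + m1 k * (3 * Num.sqrt v1 * (`|a| + enorm b)) <= delta0 * N k by lra.
have [a' [b' [hab happ']]] := scaled_step n2 hC oO bO (subset_trans (le_eball rk1) BO) rk0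
  hV Lf hf hg hw (m10 k) (m20 k) N0 (@small k) (m1_small k) c1 c2 happ.
exists (a + N k * a', lam *: (b + N k *: b')).
have e1 : `|N k * a'| + enorm (N k *: b') <= C0 * N k.
  by rewrite normrM enormZ (gtr0_norm N0) -mulrDr mulrC ler_wpM2r// ltW.
have bb := enormD b (N k *: b').
have eb0 := enorm_ge0 (b + N k *: b').
have ea := ler_normD a (N k * a').
have na0 := normr_ge0 (N k * a').
have nb0 := enorm_ge0 (N k *: b').
split; last by rewrite /= addrAC subrr add0r; lra.
split.
- rewrite /= enormZ (gtr0_norm lam0) /L LseqS -/L -/N.
  have : lam * enorm (b + N k *: b') <= enorm (b + N k *: b') by rewrite ler_piMl// ltW.
  lra.
- rewrite /= enormZ (gtr0_norm lam0) /D /= -/D -/N ler_wpM2l ?(ltW lam0)//.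
  lra.
- rewrite /= exprSr mulrA lin_rescale ?gt_eqF//; apply: le_trans happ' _.
  rewrite ler_wpM2r ?sqrtr_ge0// /N NseqS -/N -addrA.
  have h1 : N k * (lam / 2) <= N k / 2.
    by rewrite ler_wpM2l ?(ltW N0)// ler_piMl ?invr_ge0// ltW.
  have h2 : 0 <= be k.+1 * Lseq C0 X al be k.+1 by rewrite mulr_ge0//; exact: Lseq_ge0.
  have := al0 k.+1; lra.
Qed.

Let good0 : good 0 (0, 0).
Proof.
split; rewrite /= ?normr0 ?enorm0 ?addr0//.
rewrite expr0 mulr1.
rewrite (@eq_L2norm _ _ _ _ u); last first.
  move=> x _; rewrite /lin add0r /dot big1 ?subr0// => i _.
  by rewrite mxE mul0r.
apply: le_trans (le_L2norm_set (open_measurable_rV oO) (measurable_eball _ _) BO hw.1.1) _.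
apply: le_trans hX _; rewrite ler_wpM2r ?sqrtr_ge0//.
by rewrite /N /Nseq /= lerDl.
Qed.

(** The affine part of the k-th approximation is at most [D k] on the k-th ball, so the
    value at the centre alone approximates [u] up to [N k + D k]. *)
Lemma approximating_constants : exists a : nat -> R,
  [/\ a 0%N = 0, forall k, `|a k.+1 - a k| <= C0 * N k &
   forall k, L2norm (eball x0 (r * lam ^+ k)) (fun x => u x - a k) ^+ 2 <=
     2 * (N k ^+ 2 + D k ^+ 2) * vol (eball x0 (r * lam ^+ k))].
Proof.
have [F hF] : exists F : nat -> R * E, F 0%N = (0, 0) /\
    forall k, good k (F k) /\ `|(F k.+1).1 - (F k).1| <= C0 * N k.
  have st k (s : {p | good k p}) : {q : {p | good k.+1 p} | `|(sval q).1 - (sval s).1| <= C0 * N k}.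
    have [q [hq1 hq2]] := cid (good_step (svalP s)).
    by exists (exist _ q hq1).
  pose Fs := fix Fs k : {p | good k p} :=
    if k is j.+1 then sval (st j (Fs j)) else exist _ (0, 0) good0.
  exists (fun k => sval (Fs k)); split=> // k; split; first exact: svalP.
  exact: (svalP (st k (Fs k))).
exists (fun k => (F k).1); split; first by rewrite hF.1.
  by move=> k; have [] := hF.2 k.
move=> k; have [[hL hD happ] _] := hF.2 k.
move: (F k) hL hD happ => [a b] /= hL hD happ.
pose rk := r * lam ^+ k.
have rk0 : 0 < rk by rewrite mulr_gt0// exprn_gt0.
have rk1 : rk <= r by rewrite ler_piMr ?(ltW r0)// exprn_ile1// ltW.
have mB := @measurable_eball R n x0 rk.
have oB := @eball_open R n x0 rk.
have BkO := subset_trans (le_eball rk1) BO.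
have vk0 : 0 < vol (eball x0 rk) by exact: vol_eball_gt0.
have N0 : 0 < N k by exact: Nseq_gt0.
have D0 : 0 <= D k by exact: Dseq_ge0.
have Lu : L2 (eball x0 rk) u.
  by apply: L2W hw.1.1 => //; exact: open_measurable_rV.
have Ll c : L2 (eball x0 rk) (lin x0 rk c b).
  by apply: L2_smooth => //; [exact: bounded_set_eball|exact: smooth_lin].
have Lcst c : L2 (eball x0 rk) (fun=> c).
  by apply: L2_smooth => //; [exact: bounded_set_eball|exact: smooth_cst].
have h1 := L2normD_sqr mB (L2B mB Lu (Ll a)) (Ll 0).
rewrite (@eq_L2norm _ _ _ _ (fun x => u x - a)) in h1; last first.
  by move=> x _; rewrite /lin; ring.
apply: le_trans h1 _.
have v2 : Num.sqrt (vol (eball x0 rk)) ^+ 2 = vol (eball x0 rk) by rewrite sqr_sqrtr// ltW.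
have h2 : L2norm (eball x0 rk) (fun x => u x - lin x0 rk a b x) ^+ 2 <=
    N k ^+ 2 * vol (eball x0 rk).
  by rewrite -v2 -exprMn ler_pXn2r ?nnegrE ?L2norm_ge0 ?mulr_ge0 ?sqrtr_ge0 ?(ltW N0).
have h3 : L2norm (eball x0 rk) (lin x0 rk 0 b) ^+ 2 <= D k ^+ 2 * vol (eball x0 rk).
  apply: (@le_trans _ _ (L2norm (eball x0 rk) (fun=> D k) ^+ 2)).
    rewrite ler_pXn2r ?nnegrE ?L2norm_ge0//; apply: le_L2norm => //.
    move=> x hx; rewrite /lin add0r -[leLHS](real_normK (num_real _)) ler_pXn2r ?nnegrE//.
    apply: le_trans hD; apply: le_trans (normr_dot_le _ _) _.
    rewrite ler_piMr ?enorm_ge0//.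
    by rewrite enormZ gtr0_norm ?invr_gt0// ler_pdivrMl// mulr1 ltW.
  by rewrite L2norm_sqr Rintegral_cst.
rewrite -/rk [leRHS](_ : _ = 2 * (N k ^+ 2 * vol (eball x0 rk)) +
  2 * (D k ^+ 2 * vol (eball x0 rk))); last by ring.
by apply: lerD; apply: ler_wpM2l.
Qed.

End iteration.

(** * From approximation by constants to continuity *)

Section campanato.
Context (R : realType) (n : nat).
Local Notation E := 'rV[R]_n.
Local Notation mu := (lebesgue_rV R n).

(* Grid cubes of side [h], indexed by natural numbers through the coding of
   integer vectors. *)
Section grid.
Variable h : R.
Hypothesis h0 : 0 < h.

Definition cell_vec (x : E) : 'rV[int]_n := \row_i Num.floor (x 0 i / h).
Definition cell (x : E) : nat := pickle (cell_vec x).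

Lemma cell_close x y : cell x = cell y -> enorm (x - y) <= n%:R * h.
Proof.
move=> /(pcan_inj pickleK)/rowP xy; apply: enorm_le => i; have := xy i; rewrite !mxE => xyi.
have /andP[h1 h2] := floor_itv (x 0 i / h).
have /andP[h3 h4] := floor_itv (y 0 i / h).
rewrite xyi in h1 h2; rewrite intrD in h2 h4.
have -> : x 0 i - y 0 i = (x 0 i / h - y 0 i / h) * h by rewrite mulrBl !divfK ?gt_eqF.
rewrite normrM (gtr0_norm h0) ler_piMl ?(ltW h0)// ler_norml; apply/andP; split; lra.
Qed.

Lemma cellE (j : nat) : exists A : set E, [/\ measurable A,
  (forall x, cell x = j <-> A x) &
  (exists x, cell x = j) -> ((h ^+ n)%:E <= mu A)%E].
Proof.
have [|nex] := pselect (exists x, cell x = j); last first.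
  by exists set0; split=> // x; split=> // hx; exfalso; apply: nex; exists x.
move=> [x <-]; pose z := cell_vec x.
pose A := [set y : E | forall i, (z 0 i)%:~R * h <= y 0 i < (z 0 i + 1)%:~R * h].
have mA : measurable A.
  rewrite (_ : A = \big[setI/setT]_(i < n)
      ((fun y : E => y 0 i) @^-1` `[(z 0 i)%:~R * h, (z 0 i + 1)%:~R * h[)).
    apply: bigsetI_measurable => i _; rewrite -[X in measurable X]setTI.
    by apply: measurable_coord => //; exact: measurable_itv.
  apply/seteqP; split=> y; rewrite -bigcap_seq /=.
    by move=> yA i _ /=; rewrite in_itv/= yA.
  by move=> + i => /(_ i); rewrite /= in_itv/=; apply; rewrite mem_index_enum.
exists A; split=> //.
- move=> y; split.
    move=> /(pcan_inj pickleK)/rowP yx i; have := yx i; rewrite !mxE => <-.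
    have /andP[h1 h2] := floor_itv (y 0 i / h).
    by rewrite -ler_pdivlMr// h1 -ltr_pdivrMr.
  move=> yA; congr pickle; apply/rowP => i; rewrite [LHS]mxE.
  apply/eqP; rewrite floor_eq; have /andP[h1 h2] := yA i.
  by rewrite ler_pdivlMr// h1 ltr_pdivrMr.
- move=> _; apply: (@le_trans _ _ (mu (box (\row_i ((z 0 i)%:~R * h)) (\row_i ((z 0 i + 1)%:~R * h))))).
    rewrite box_measure lee_fin -[n in h ^+ n]card_ord -prodr_const.
    apply: ler_prod => i _; rewrite (ltW h0)/= !mxE intrD mulrDl mul1r addrAC subrr add0r.
    by rewrite le_max lexx orbT.
  apply: le_measure; rewrite ?inE//; first exact: measurable_box.
  by move=> y yB i; have := yB i; rewrite !mxE => /andP[h1 ->]; rewrite ltW.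
Qed.

End grid.

Variables (Om Om' : set E) (u ut : E -> R) (rad e t : nat -> R) (a : nat -> E -> R).
Hypotheses (oO : open Om) (bO : bounded_set Om) (Lu : L2 Om u).
Hypotheses (rad0 : forall k, 0 < rad k) (e0 : forall k, 0 <= e k).
Hypotheses (e_cvg : e k @[k --> \oo] --> 0) (t_cvg : t k @[k --> \oo] --> 0).
Hypothesis ball_sub : forall x k, Om' x -> eball x (rad k) `<=` Om.
Hypothesis approx : forall x k, Om' x ->
  L2norm (eball x (rad k)) (fun y => u y - a k x) ^+ 2 <=
  e k ^+ 2 * vol (eball x (rad k)).
Hypothesis a_ut : forall x k, Om' x -> `|a k x - ut x| <= t k.

(* [2 ^+ n] is the ratio of the volumes of the balls of radii [rad k] and [rad k / 2] *)
Let Kc : R := 2 * Num.sqrt (2 ^+ n).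

Let Lcst (x : E) (r c : R) : L2 (eball x r) (fun=> c).
Proof.
by apply: L2_smooth; [exact: eball_open|exact: bounded_set_eball|exact: smooth_cst].
Qed.

(** Two nearby centres: both constants approximate [u] on a common ball. *)
Lemma constants_close k x y : Om' x -> Om' y -> enorm (x - y) <= rad k / 2 ->
  `|a k x - a k y| <= Kc * e k.
Proof.
move=> Ox Oy xy; have r0 := rad0 k; have r20 : 0 < rad k / 2 by rewrite divr_gt0.
have mQ := @measurable_eball R n x (rad k / 2).
have Qx : eball x (rad k / 2) `<=` eball x (rad k).
  by apply: le_eball; rewrite ler_pdivrMr// ler_peMr ?(ltW r0)// ler1n.
have Qy : eball x (rad k / 2) `<=` eball y (rad k).
  by apply: eball_sub; rewrite {2}(splitr (rad k)) lerD2r.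
have LuB z c : Om' z -> L2 (eball z (rad k)) (fun w => u w - c).
  move=> Oz; apply: L2B => //; first exact: measurable_eball.
  by apply: L2W Lu; [exact: open_measurable_rV|exact: measurable_eball|exact: ball_sub].
have LQ z c : eball x (rad k / 2) `<=` eball z (rad k) -> Om' z ->
    L2 (eball x (rad k / 2)) (fun w => u w - c).
  by move=> Qz Oz; apply: L2W (LuB z c Oz) => //; exact: measurable_eball.
have h1 := L2normD_sqr mQ (LQ _ (a k y) Qx Ox) (L2Z (-1) mQ (LQ _ (a k x) Qx Ox)).
rewrite L2normZ // in h1; last exact: LQ Qx Ox.
rewrite (@eq_L2norm _ _ _ _ (fun=> a k x - a k y)) in h1; last by move=> w _; ring.
rewrite normrN1 mul1r in h1.
have est z : Om' z -> eball x (rad k / 2) `<=` eball z (rad k) ->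
    L2norm (eball x (rad k / 2)) (fun w => u w - a k z) ^+ 2 <= e k ^+ 2 * vol (eball x (rad k)).
  move=> Oz Qz; have -> : vol (eball x (rad k)) = vol (eball z (rad k)).
    by rewrite (@vol_eball R n x)// (@vol_eball R n z).
  apply: le_trans (approx k Oz); rewrite ler_pXn2r ?nnegrE ?L2norm_ge0//.
  by apply: le_L2norm_set => //; [exact: measurable_eball|exact: LuB].
have h2 := est y Oy Qy; have h3 := est x Ox Qx.
rewrite L2norm_sqr Rintegral_cst// -/(vol _) in h1.
have vQ : vol (eball x (rad k)) = 2 ^+ n * vol (eball x (rad k / 2)).
  rewrite (@vol_eball R n x _ r0) (@vol_eball R n x _ r20) mulrA -exprMn.
  by rewrite mulrCA mulfV ?mulr1.
have vp : 0 < vol (eball x (rad k / 2)) by exact: vol_eball_gt0.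
have h4 : (a k x - a k y) ^+ 2 <= 4 * 2 ^+ n * e k ^+ 2.
  rewrite -(ler_pM2r vp); apply: le_trans h1 _; rewrite vQ in h2 h3.
  have -> : 4 * 2 ^+ n * e k ^+ 2 * vol (eball x (rad k / 2)) =
    2 * (e k ^+ 2 * (2 ^+ n * vol (eball x (rad k / 2)))) +
    2 * (e k ^+ 2 * (2 ^+ n * vol (eball x (rad k / 2)))) by ring.
  by apply: lerD; rewrite ler_wpM2l.
have K0 : 0 <= Kc by rewrite mulr_ge0// sqrtr_ge0.
rewrite -(ler_pXn2r (ltn0Sn 1)) ?nnegrE ?mulr_ge0//.
rewrite real_normK ?num_real//; apply: le_trans h4 _.
rewrite !exprMn sqr_sqrtr ?exprn_ge0//.
by apply: eq_ler; ring.
Qed.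

Let te_cvg : 2 * t k + Kc * e k @[k --> \oo] --> 0.
Proof.
have h1 : 2 * t k @[k --> \oo] --> (2 * 0 : R) by apply: cvgMl_tmp.
have h2 : Kc * e k @[k --> \oo] --> (Kc * 0 : R) by apply: cvgMl_tmp.
have := cvgD h1 h2; rewrite !mulr0 addr0; exact.
Qed.

Let small_scale (d : R) : 0 < d -> exists k, 2 * t k + Kc * e k < d.
Proof.
move=> d0.
have [k _ hk] : \forall k \near \oo, 2 * t k + Kc * e k < d by exact: (cvgr_lt 0).
by exists k; apply: hk => /=.
Qed.

(** The values [a k] at nearby points are close, and [ut] is their uniform limit. *)
Lemma limit_continuous : {within Om', continuous ut}.
Proof.
apply/subspace_continuousP => x Ox; apply/cvgrPdist_lt => d d0.
have [k hk] := small_scale d0; rewrite near_withinE.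
have r20 : 0 < rad k / 2 by rewrite divr_gt0.
have : nbhs x (eball x (rad k / 2)).
  by apply: open_nbhs_nbhs; split; [exact: eball_open|exact: eball_center].
apply: filterS => y xy Oy; rewrite /eball /= enormB in xy.
have h1 := constants_close Ox Oy (ltW xy).
have h2 := a_ut k Ox; have h3 := a_ut k Oy.
have -> : ut x - ut y = - (a k x - ut x) + (a k x - a k y) + (a k y - ut y) by ring.
apply: le_lt_trans (ler_normD _ _) _.
have := ler_normD (- (a k x - ut x)) (a k x - a k y); rewrite normrN => h4.
lra.
Qed.

(* side of the grid cubes: cubes have diameter at most [rad k / 2] *)
Let h k : R := rad k / (2 * n.+1%:R).
Let h_gt0 k : 0 < h k. Proof. by rewrite divr_gt0// mulr_gt0. Qed.

Let nh k : n%:R * h k < rad k / 2.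
Proof.
have n1 : 0 < n.+1%:R :> R by [].
have hE : h k = rad k / 2 / n.+1%:R by rewrite /h invfM mulrA.
by rewrite hE mulrA ltr_pdivrMr// mulrC ltr_pM2l ?divr_gt0// ltr_nat.
Qed.

(** On each cube of the grid that meets [Om'], replace [a k] by its value at one point
    of [Om']: this gives a measurable function approximating [u] in [L2]. *)
Let step_function k : exists (G : set E) (S : E -> R),
  [/\ measurable G, Om' `<=` G, G `<=` Om, measurable_fun setT S &
    (forall x, Om' x -> `|S x - a k x| <= Kc * e k) /\
    (\int[mu]_(x in G) ((u x - S x) ^+ 2)%:E <=
      (e k ^+ 2 * (vol (eball (0 : E) 1) * (2 * n.+1%:R) ^+ n))%:E * mu Om)%E].
Proof.
have /boolp.choice[F hF] := cellE (h_gt0 k).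
have mF j : measurable (F j) by have [] := hF j.
have FP j x : cell (h k) x = j <-> F j x by have [_ h1 _] := hF j.
pose good j := exists x, Om' x /\ F j x.
have /boolp.choice[p hp] (j : nat) : exists x, good j -> Om' x /\ F j x.
  by have [[x hx]|ng] := pselect (good j); [exists x|exists 0].
pose F' j := if pselect (good j) then F j else set0.
have mF' j : measurable (F' j) by rewrite /F'; case: pselect => gj; [exact: mF|exact: measurable0].
have F'P j x : F' j x <-> good j /\ F j x.
  by rewrite /F'; case: pselect => gj; split=> // -[].
have tF' : trivIset setT F'.
  apply/trivIsetP => i j _ _ /eqP ij; apply/seteqP; split=> // x [/F'P[_ /FP xi] /F'P[_ /FP xj]].
  by apply: ij; rewrite -xi xj.
pose S x := a k (p (cell (h k) x)).
have mS : measurable_fun setT S.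
  move=> _ Y mY; rewrite setTI.
  pose F2 j := if a k (p j) \in Y then F j else set0.
  rewrite (_ : S @^-1` Y = \bigcup_j F2 j).
    by apply: bigcup_measurable => j _; rewrite /F2; case: ifP.
  apply/seteqP; split=> x.
    move=> SY; exists (cell (h k) x) => //; rewrite /F2 mem_set//; exact/FP.
  move=> [j _]; rewrite /F2; case: ifPn => // + /FP xj.
  by rewrite inE -xj.
have close j x : good j -> F j x -> enorm (x - p j) <= rad k / 2.
  move=> gj /FP xj; have [_ /FP pj] := hp j gj.
  apply: le_trans (cell_close (h_gt0 k) _) (ltW (nh k)).
  by rewrite xj.
have F'O j x : F' j x -> eball (p j) (rad k) x.
  move=> /F'P[gj Fx]; apply: le_lt_trans (close j x gj Fx) _.
  by rewrite ltr_pdivrMr// ltr_pMr// ltr1n.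
exists (\bigcup_j F' j), S; split=> //.
- by apply: bigcup_measurable => j _.
- move=> x Ox; exists (cell (h k) x) => //; apply/F'P; split; last exact/FP.
  by exists x; split=> //; exact/FP.
- move=> x [j _ hx]; have [gj _] := (F'P j x).1 hx; have [Op _] := hp j gj.
  exact: (ball_sub Op (F'O j x hx)).
split.
  move=> x Ox; have gx : good (cell (h k) x) by exists x; split=> //; exact/FP.
  have [Op Fp] := hp _ gx; rewrite /S; apply: constants_close => //.
  by rewrite enormB; apply: close => //; exact/FP.
have GO : \bigcup_j F' j `<=` Om.
  move=> x [j _ hx]; have [gj _] := (F'P j x).1 hx; have [Op _] := hp j gj.
  exact: (ball_sub Op (F'O j x hx)).
have mO := open_measurable_rV oO.
have mG : measurable (\bigcup_j F' j) by apply: bigcup_measurable => j _.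
have mu1 : measurable_fun (\bigcup_j F' j) (fun x => ((u x - S x) ^+ 2)%:E).
  apply/measurable_EFinP; apply: measurable_funX; apply: measurable_funB.
    by apply: measurable_funS (L2_meas Lu).
  exact: measurable_funTS.
rewrite ge0_integral_bigcup//; last by move=> x _; rewrite lee_fin sqr_ge0.
set c := e k ^+ 2 * _.
have c0 : 0 <= c.
  by rewrite mulr_ge0 ?sqr_ge0// mulr_ge0 ?exprn_ge0// ltW// vol_eball_gt0.
apply: (@le_trans _ _ (\sum_(0 <= j <oo) (c%:E * mu (F' j)))%E); last first.
  rewrite nneseriesZl//; apply: lee_wpmul2l; first by rewrite lee_fin.
  rewrite -measure_semi_bigcup//; apply: le_measure; rewrite ?inE//.
apply: lee_nneseries => [j _ _|j _].
  by apply: integral_ge0 => x _; rewrite lee_fin sqr_ge0.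
have [gj|ngj] := pselect (good j); last first.
  have -> : F' j = set0 by rewrite /F'; case: pselect.
  by rewrite integral_set0 measure0 mule0.
have -> : F' j = F j by rewrite /F'; case: pselect.
have [Op Fp] := hp j gj.
have FB : F j `<=` eball (p j) (rad k) by move=> x Fx; apply: F'O; apply/F'P.
have LB : L2 (eball (p j) (rad k)) (fun y => u y - a k (p j)).
  apply: L2B => //; first exact: measurable_eball.
  by apply: L2W Lu => //; [exact: measurable_eball|exact: ball_sub].
apply: (@le_trans _ _ (\int[mu]_(x in eball (p j) (rad k)) ((u x - a k (p j)) ^+ 2)%:E)%E).
  rewrite (eq_integral (fun x => ((u x - a k (p j)) ^+ 2)%:E)); last first.
    by move=> x; rewrite inE => /FP xj; rewrite /S xj.
  apply: ge0_subset_integral => //; first exact: measurable_eball.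
    by apply/measurable_EFinP; apply: measurable_funX; exact: L2_meas LB.
  by move=> x _; rewrite lee_fin sqr_ge0.
rewrite integral_lty_EFin; [|exact: measurable_eball|exact: (L2_integrable (measurable_eball _ _) LB)].
rewrite -L2norm_sqr; apply: (@le_trans _ _ (e k ^+ 2 * vol (eball (p j) (rad k)))%:E).
  by rewrite lee_fin; exact: approx.
have [_ _ /(_ (ex_intro _ (p j) ((FP j (p j)).2 Fp))) hj] := hF j.
apply: (@le_trans _ _ (c%:E * (h k ^+ n)%:E)%E); last by apply: lee_wpmul2l; rewrite ?lee_fin.
rewrite -EFinM lee_fin /c (@vol_eball R n _ _ (rad0 k)) /h expr_div_n.
by apply: eq_ler; field; rewrite -?exprMn expf_neq0.
Qed.

(** The step functions [S k] converge to [u] in L2 and to [ut] at each point of [Om'].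
    By Fatou's lemma the lower limit of [(u - S k) ^+ 2] vanishes almost everywhere on
    the intersection of the [G k], a measurable set containing [Om']. *)
Lemma limit_ae : {ae mu, forall x, Om' x -> u x = ut x}.
Proof.
have mO := open_measurable_rV oO.
have [G hG] := boolp.choice step_function; have [S hS] := boolp.choice hG.
pose A := \bigcap_k G k.
have mA : measurable A by apply: bigcap_measurable => [|k _]; [exists 0%N|have [] := hS k].
have AG k : A `<=` G k by move=> x; apply.
have OA : Om' `<=` A by move=> x Ox k _; have [_ h1 _ _ _] := hS k; exact: h1.
have AO : A `<=` Om by move=> x /(_ 0%N I); have [_ _ h1 _ _] := hS 0%N; exact: h1.
pose q k x : \bar R := ((u x - S k x) ^+ 2)%:E.
have mq k : measurable_fun A (q k).
  apply/measurable_EFinP; apply: measurable_funX; apply: measurable_funB.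
    exact: measurable_funS (L2_meas Lu).
  by apply: measurable_funTS; have [] := hS k.
have q0 k x : (0 <= q k x)%E by rewrite lee_fin sqr_ge0.
have muO : mu Om \is a fin_num by rewrite ge0_fin_numE// bounded_lty.
pose W := vol (eball (0 : E) 1) * (2 * n.+1%:R) ^+ n * fine (mu Om).
have intq : (\int[mu]_(x in A) q k x)%E @[k --> \oo] --> 0%E.
  apply: (@squeeze_cvge _ _ _ _ (fun=> 0%E) _ (fun k => (e k ^+ 2 * W)%:E)).
  - apply: nearW => k; apply/andP; split; first by apply: integral_ge0 => x _; exact: q0.
    have [mG _ GO mSk [_ hk]] := hS k.
    apply: (@le_trans _ _ (\int[mu]_(x in G k) q k x)%E).
      apply: (ge0_subset_integral mu mA mG _ _ (@AG k)) => //.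
      apply/measurable_EFinP; apply: measurable_funX; apply: measurable_funB.
        exact: measurable_funS (L2_meas Lu).
      exact: measurable_funTS.
    apply: le_trans hk _; rewrite -(fineK muO) -EFinM lee_fin /W.
    by apply: eq_ler; ring.
  - exact: cvg_cst.
  - apply: cvg_EFin; first exact: nearW.
    rewrite -(mul0r W); apply: cvgMl; rewrite -(mulr0 (0 : R)).
    by under eq_fun do rewrite /= expr2; apply: cvgM.
have liminf0 : (\int[mu]_(x in A) limn_einf (q^~ x) = 0)%E.
  apply/eqP; rewrite eq_le; apply/andP; split.
    apply: le_trans (fatou _ mA mq (fun k x _ => q0 k x)) _.
    by rewrite (cvg_limn_einf_sup intq).1.
  apply: integral_ge0 => x _; rewrite limn_einf_lim; apply: lime_ge.
    by apply: is_cvg_einfs.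
  by apply: nearW => k; apply: le_ereal_inf_tmp => _ [j /= _ <-]; exact: q0.
have liminf_ge0 x : (0 <= limn_einf (q^~ x))%E.
  rewrite limn_einf_lim; apply: lime_ge; first exact: is_cvg_einfs.
  by apply: nearW => k; apply: le_ereal_inf_tmp => _ [j /= _ <-]; exact: q0.
have mlim : measurable_fun A (fun x => limn_einf (q^~ x)).
  rewrite (_ : (fun x => _) = (fun x => - limn_esup (fun k => - q k x))%E).
    apply: measurableT_comp => //; apply: measurable_fun_limn_esup => k.
    exact: measurableT_comp.
  by apply/funext => x; rewrite -limn_einfN; congr limn_einf; apply/funext => k; rewrite /comp oppeK.
have /(ae_eq_integral_abs mu mA mlim) : (\int[mu]_(x in A) `|limn_einf (q^~ x)| = 0)%E.
  by rewrite -[RHS]liminf0; apply: eq_integral => x _; rewrite gee0_abs.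
apply: filterS => x hx Ox; have {}hx := hx (OA _ Ox).
have Sut : S k x @[k --> \oo] --> ut x.
  apply/cvgrPdist_le => d d0.
  have : \forall k \near \oo, 2 * t k + Kc * e k < d by exact: (cvgr_lt 0).
  apply: filterS => k hk; have [_ _ _ _ [h1 _]] := hS k.
  have h2 := a_ut k Ox; have h3 := h1 x Ox; have h4 := normr_ge0 (a k x - ut x).
  have -> : ut x - S k x = - (a k x - ut x) - (S k x - a k x) by ring.
  by apply: le_trans (ler_normB _ _) _; rewrite normrN; lra.
have qcv : q k x @[k --> \oo] --> ((u x - ut x) ^+ 2)%:E.
  apply: cvg_EFin; first exact: nearW.
  have h1 : u x - S k x @[k --> \oo] --> u x - ut x.
    by apply: cvgB => //; exact: cvg_cst.
  exact: (cvgM h1 h1).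
move: hx; rewrite (cvg_limn_einf_sup qcv).1 /= => -[] /eqP.
by rewrite sqrf_eq0 subr_eq0 => /eqP.
Qed.

End campanato.

(** * Dini moduli along geometric sequences *)

Section dini_sums.
Context (R : realType).
Local Notation lmu := (@lebesgue_measure R).
Variables (omega : R -> R) (R0 lam : R).
Hypotheses (mo : modulus omega) (di : dini omega R0).
Hypotheses (R00 : 0 < R0) (lam01 : 0 < lam < 1).

Lemma modulus_ge0 (r : R) : 0 <= r -> 0 <= omega r.
Proof. by have [w0 w1 _ _] := mo; move=> r0; rewrite -w0 w1. Qed.

Let q (r : R) : \bar R := (omega r / r)%:E.

Let q_ge0 (a b r : R) : 0 <= a -> `]a, b]%classic r -> (0 <= q r)%E.
Proof.
move=> a0; rewrite /= in_itv/= => /andP[ar _]; have r0 := le_lt_trans a0 ar.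
by rewrite lee_fin mulr_ge0 ?invr_ge0 ?modulus_ge0// ltW.
Qed.

Let mq (a b : R) : 0 <= a -> measurable_fun `]a, b]%classic q.
Proof.
move=> a0; apply/measurable_EFinP.
apply: (eq_measurable_fun (fun r => omega r * r `^ (-1))).
  move=> r; rewrite inE/= in_itv/= => /andP[ar _].
  by rewrite powR_inv1// ltW// (le_lt_trans a0).
apply: measurable_funM; last by apply: measurable_funTS; exact: measurable_powR.
have m0 : measurable_fun (`[0, +oo[%classic : set R) omega.
  by apply: subspace_continuous_measurable_fun => //; have [_ _ _] := mo.
apply: measurable_funS m0 => //.
move=> r; rewrite /= !in_itv/= andbT => /andP[ar _].
by rewrite ltW// (le_lt_trans a0).
Qed.

(** On [(lam x, x]] the integrand is at least [omega (lam x) / x], and the interval has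
    length [(1 - lam) x]. *)
Let one_scale (x : R) : 0 < x ->
  (((1 - lam) * omega (lam * x))%:E <= \int[lmu]_(r in `](lam * x)%R, x]) q r)%E.
Proof.
move=> x0; have /andP[l0 l1] := lam01.
have lx0 : 0 <= lam * x by rewrite mulr_ge0 ?ltW.
have lamx : lam * x < x by rewrite gtr_pMl.
apply: (@le_trans _ _ (\int[lmu]_(r in `](lam * x)%R, x]) (cst (omega (lam * x) / x)%:E) r)%E).
  have len : lmu `](lam * x)%R, x] = (x - lam * x)%:E.
    by rewrite lebesgue_measure_itv/= lte_fin lamx.
  have -> := @integral_cst _ _ _ lmu _ (measurable_itv `](lam * x)%R, x]) (omega (lam * x) / x)%:E.
  rewrite [X in (_ <= _ * X)%E]len.
  rewrite -EFinM lee_fin.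
  by apply: eq_ler; field; rewrite gt_eqF.
apply: ge0_le_integral => //.
- by move=> r _; rewrite lee_fin mulr_ge0 ?invr_ge0 ?modulus_ge0// ltW.
- exact: mq.
move=> r; rewrite /= in_itv/= => /andP[ar rb]; have r0 := le_lt_trans lx0 ar.
have [_ w1 _ _] := mo.
rewrite lee_fin ler_pM ?invr_ge0 ?modulus_ge0 ?(ltW x0)//; first by rewrite w1// ltW.
by rewrite lef_pV2 ?posrE.
Qed.

Lemma dini_integral_ge0 : 0 <= dini_integral omega R0.
Proof. by apply: fine_ge0; apply: integral_ge0 => r hr; exact: (q_ge0 (lexx 0) hr). Qed.

Lemma dini_sum m :
  \sum_(k < m) omega (R0 * lam ^+ k) <= omega R0 + (1 - lam)^-1 * dini_integral omega R0.
Proof.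
have /andP[l0 l1] := lam01; have l10 : 0 < 1 - lam by rewrite subr_gt0.
have x0 k : 0 < R0 * lam ^+ k by rewrite mulr_gt0// exprn_gt0.
have tail k : ((\sum_(i < k) (1 - lam) * omega (R0 * lam ^+ i.+1))%:E +
    \int[lmu]_(r in `]0%R, (R0 * lam ^+ k)%R]) q r <= \int[lmu]_(r in `]0%R, R0]) q r)%E.
  elim: k => [|k IHk]; first by rewrite big_ord0 add0e expr0 mulr1.
  apply: le_trans IHk; rewrite big_ord_recr/= EFinD -addeA leeD2l//.
  have xk : lam * (R0 * lam ^+ k) = R0 * lam ^+ k.+1 by rewrite exprS mulrCA.
  have le_x : R0 * lam ^+ k.+1 <= R0 * lam ^+ k.
    by rewrite -xk ler_piMl// ltW.
  set b := R0 * lam ^+ k.+1 in xk le_x *; set c := R0 * lam ^+ k in xk le_x *.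
  have b0 : 0 < b by exact: x0.
  have IU : (`]0, c]%classic : set R) = `]0, b]%classic `|` `]b, c]%classic.
    by apply: itv_bndbnd_setU; rewrite bnd_simp// ltW.
  rewrite IU ge0_integral_setU//=.
  - by rewrite addeC leeD2l//; have := one_scale (x0 k); rewrite xk.
  - by have := @mq 0 c (lexx 0); rewrite IU.
  - by move=> r hr; apply: (@q_ge0 0 c) => //; rewrite IU.
  - apply/disj_setPS => r [] /=; rewrite !in_itv/= => /andP[_ h1] /andP[h2 _].
    by have := le_lt_trans h1 h2; rewrite ltxx.
have I0 : (0 <= \int[lmu]_(r in `]0%R, R0]) q r)%E.
  by apply: integral_ge0 => r hr; exact: (q_ge0 (lexx 0) hr).
have Ifin : (\int[lmu]_(r in `]0%R, R0]) q r)%E \is a fin_num by rewrite ge0_fin_numE.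
have D0 := dini_integral_ge0.
case: m => [|m].
  by rewrite big_ord0 addr_ge0 ?modulus_ge0 ?mulr_ge0 ?invr_ge0 ?(ltW R00) ?(ltW l10).
rewrite big_ord_recl expr0 mulr1 lerD2l mulrC ler_pdivlMr// mulrC mulr_sumr.
rewrite -lee_fin (_ : (dini_integral omega R0)%:E = \int[lmu]_(r in `]0%R, R0]) q r)%E.
  apply: le_trans (tail m); apply: leeDl; apply: integral_ge0 => r hr; exact: (q_ge0 (lexx 0) hr).
by rewrite /dini_integral /Rintegral fineK.
Qed.

End dini_sums.

(** * Interior continuity and supremum bounds *)

Section bounded_series.
Context (R : realType).

Lemma bounded_series_tails (s : nat -> R) (M : R) : (forall k, 0 <= s k) ->
  (forall m, \sum_(k < m) s k <= M) ->
  exists T : nat -> R, T k @[k --> \oo] --> (0 : R) /\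
    forall j m, \sum_(k < m) s (j + k)%N <= T j.
Proof.
move=> s0 sM.
have nd : nondecreasing_seq (series s).
  by apply/nondecreasing_seqP => m; rewrite /series /= big_nat_recr//= lerDl.
have cv : cvgn (series s).
  apply: nondecreasing_is_cvgn => //.
  by exists M => _ [m _ <-]; rewrite /series /= big_mkord.
exists (fun k => limn (series s) - series s k); split.
  have h1 : limn (series s) - series s k @[k --> \oo] --> limn (series s) - limn (series s).
    by apply: cvgB; [exact: cvg_cst|].
  by rewrite subrr in h1.
move=> j m.
have -> : \sum_(k < m) s (j + k)%N = \sum_(j <= k < j + m) s k.
  rewrite -{1}[j in RHS]add0n big_addn addKn big_mkord.
  by apply: eq_bigr => k _; rewrite addnC.
have := nondecreasing_cvgn_le nd cv (j + m)%N.
by rewrite {1}/series/= (big_cat_nat (n := j))//= ?leq_addr// -lerBrDl.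
Qed.

(** The rate [T] is common to all sequences: applied at every centre, it makes the
    convergence of the approximating constants uniform. *)
Lemma summable_increments_limit (d : nat -> R) (M : R) : (forall k, 0 <= d k) ->
  (forall m, \sum_(k < m) d k <= M) ->
  exists T : nat -> R, T k @[k --> \oo] --> (0 : R) /\
    forall a : nat -> R, a 0%N = 0 -> (forall k, `|a k.+1 - a k| <= d k) ->
    exists l, `|l| <= M /\ forall k, `|a k - l| <= T k.
Proof.
move=> d0 dM; have [T [T0 hT]] := bounded_series_tails d0 dM; exists T; split=> // a a0 ad.
have incr j m : `|a (j + m)%N - a j| <= \sum_(k < m) d (j + k)%N.
  elim: m => [|m IH]; first by rewrite addn0 subrr normr0 big_ord0.
  rewrite big_ord_recr/= addnS -(subrKA (a (j + m)%N)) addrC.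
  by apply: le_trans (ler_normD _ _) _; rewrite lerD.
have cva : cvgn a.
  have aE : a = series (telescope a).
    by apply/funext => k; rewrite telescopeK/= a0 subr0.
  rewrite aE; apply: normed_cvg.
  apply: (series_le_cvg _ d0 ad) => [k|]; first exact: normr_ge0.
  apply: nondecreasing_is_cvgn.
    by apply/nondecreasing_seqP => m; rewrite /series /= big_nat_recr//= lerDl.
  by exists M => _ [m _ <-]; rewrite /series /= big_mkord.
have lim_le k B : (forall m, `|a (k + m)%N - a k| <= B) -> `|a k - limn a| <= B.
  move=> hB; have h : `|a k - a p| @[p --> \oo] --> `|a k - limn a|.
    by apply: cvg_norm; apply: cvgB => //; exact: cvg_cst.
  rewrite -(cvg_lim _ h)//; apply: limr_le; first by apply/cvg_ex; eexists; exact: h.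
  near=> p; have kp : (k <= p)%N by near: p; exact: nbhs_infty_ge.
  by rewrite distrC -(subnKC kp).
exists (limn a); split.
  rewrite -normrN -[- _]add0r -a0; apply: lim_le => m; apply: le_trans (incr 0%N m) _.
  exact: dM.
by move=> k; apply: lim_le => m; exact: le_trans (incr k m) (hT k m).
Unshelve. all: by end_near.
Qed.

End bounded_series.

Section supremum.
Context (R : realType) (n : nat).
Local Notation E := 'rV[R]_n.
Local Notation mu := (lebesgue_rV R n).

Lemma Linfty_norm_le (Om' : set E) (u : E -> R) (M : R) : 0 <= M ->
  {ae mu, forall x, Om' x -> `|u x| <= M} -> (Linfty_norm Om' u <= M%:E)%E.
Proof.
move=> M0 hM; rewrite /Linfty_norm Lnorm.unlock /=; case: ifP => _; last by rewrite lee_fin.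
apply/ess_supP; apply: filterS hM => x hx /=; rewrite lee_fin patchE.
by case: ifPn => [|_]; [rewrite inE => /hx|rewrite normr0].
Qed.

End supremum.

Section interior.
Context (R : realType) (n : nat).
Local Notation E := 'rV[R]_n.
Local Notation mu := (lebesgue_rV R n).
Variables (C0 lam delta0 : R).
Hypothesis hC : @approximation_constants R n C0 lam delta0.
Hypothesis n2 : (2 <= n)%N.
Variables (Om Om' : set E) (V : (E -> R) -> (E -> R) -> R) (f : E -> E)
  (g : (E -> R) -> R) (u : E -> R) (r X M2 : R) (m1 m2 : nat -> R).
Hypotheses (oO : open Om) (bO : bounded_set Om) (r0 : 0 < r).
Hypothesis BO : forall x, Om' x -> eball x r `<=` Om.
Hypotheses (hV : W12multiplier Om V) (Lf : L2vec Om f)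
  (hf : admissible Om (fun x => enorm (f x) ^+ 2)) (hg : W12dual Om g)
  (hw : weak_solution Om V f g u).
Hypotheses (m10 : forall k, 0 <= m1 k) (m20 : forall k, 0 <= m2 k) (X0 : 0 < X).
Hypothesis small : forall x k, Om' x ->
  local_bounds Om V f g x (r * lam ^+ k) (m1 k) (m2 k).
Hypothesis m1_small : forall k, 2 * m1 k <= delta0.
Hypothesis m1_sum : forall m, C0 * (cst1 n delta0 * \sum_(k < m) m1 k) <= 1 / 4.
Hypothesis m2_sum : forall m, \sum_(k < m) m2 k <= M2.
Hypothesis hX : L2norm Om u <= X * Num.sqrt (vol (eball (0 : E) r)).

(** The approximating constants at the points of [Om'] form Cauchy sequences, at a rate
    independent of the point. *)
Lemma interior_continuity_estimate : exists ut : E -> R,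
  [/\ {within Om', continuous ut}, {ae mu, forall x, Om' x -> u x = ut x} &
    forall x, Om' x -> `|ut x| <= 4 * C0 * (X + cst2 n delta0 * M2)].
Proof.
have [C00 /andP[lam0 lam1] d0 _] := hC.
have c1 := cst1_gt0 hC; have c2 := cst2_gt0 hC.
pose al k := cst2 n delta0 * m2 k; pose be k := cst1 n delta0 * m1 k.
have al0 k : 0 <= al k by rewrite mulr_ge0// ltW.
have be0 k : 0 <= be k by rewrite mulr_ge0// ltW.
pose N := Nseq C0 X al be; pose D := Dseq C0 lam X al be.
have N0 k : 0 <= N k by rewrite ltW// Nseq_gt0.
have D0 k : 0 <= D k by exact: Dseq_ge0.
have be_sum m : C0 * \sum_(k < m) be k <= 1 / 4 by rewrite -mulr_sumr.
pose M := 4 * (X + cst2 n delta0 * M2).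
have NM m : \sum_(k < m) N k <= M.
  apply: le_trans (Nseq_sum C00 X0 al0 be0 be_sum m) _.
  by rewrite ler_wpM2l// lerD2l -mulr_sumr ler_wpM2l// ltW.
have DM m : \sum_(k < m) D k <= (1 - lam)^-1 * (C0 * M).
  rewrite mulrC ler_pdivlMr ?subr_gt0// mulrC.
  apply: le_trans (Dseq_sum C00 lam0 lam1 X0 al0 be0 m) _.
  by rewrite ler_wpM2l ?NM// ltW.
have CN0 k : 0 <= C0 * N k by rewrite mulr_ge0// ltW.
have CNM m : \sum_(k < m) C0 * N k <= C0 * M by rewrite -mulr_sumr ler_wpM2l ?NM// ltW.
have [T [Tcvg hT]] := summable_increments_limit CN0 CNM.
have /boolp.choice[F hF] (x : E) : exists al : (nat -> R) * R, Om' x ->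
    [/\ `|al.2| <= C0 * M, forall k, `|al.1 k - al.2| <= T k &
      forall k, L2norm (eball x (r * lam ^+ k)) (fun y => u y - al.1 k) ^+ 2 <=
        2 * (N k ^+ 2 + D k ^+ 2) * vol (eball x (r * lam ^+ k))].
  have [Ox|nOx] := pselect (Om' x); last by exists (fun=> 0, 0).
  have hXx : L2norm Om u <= X * Num.sqrt (vol (eball x r)).
    by rewrite (@vol_eball R n x r r0) -(@vol_eball R n 0 r r0).
  have [a [a00 ainc aapp]] := approximating_constants hC n2 oO bO r0 (BO Ox) hV Lf hf hg hw
    m10 m20 X0 (fun k => @small x k Ox) m1_small hXx.
  by have [l [lM hl]] := hT a a00 ainc; exists (a, l).
pose ut x := (F x).2; pose a k x := (F x).1 k.
pose e k := 2 * (N k + D k).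
have e0 k : 0 <= e k by rewrite mulr_ge0// addr_ge0.
have e_cvg : e k @[k --> \oo] --> (0 : R).
  rewrite -(mulr0 (2 : R)); apply: cvgMl_tmp; rewrite -(addr0 (0 : R)).
  exact: cvgD (bounded_series_cvg0 N0 NM) (bounded_series_cvg0 D0 DM).
have rad0 k : 0 < r * lam ^+ k by rewrite mulr_gt0// exprn_gt0.
have rad1 k : r * lam ^+ k <= r by rewrite ler_piMr ?(ltW r0)// exprn_ile1// ltW.
have Lu : L2 Om u by have [[]] := hw.
have ball_sub x k : Om' x -> eball x (r * lam ^+ k) `<=` Om.
  by move=> Ox; apply: subset_trans (le_eball (rad1 k)) (BO Ox).
have approx x k : Om' x ->
    L2norm (eball x (r * lam ^+ k)) (fun y => u y - a k x) ^+ 2 <=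
    e k ^+ 2 * vol (eball x (r * lam ^+ k)).
  move=> Ox; have [_ _ h] := hF x Ox; apply: le_trans (h k) _.
  rewrite ler_wpM2r ?(ltW (vol_eball_gt0 _ _))// /e.
  have := mulr_ge0 (N0 k) (D0 k); have := sqr_ge0 (N k); have := sqr_ge0 (D k).
  have -> : (2 * (N k + D k)) ^+ 2 = 4 * (N k ^+ 2) + 8 * (N k * D k) + 4 * (D k ^+ 2) by ring.
  lra.
have a_ut x k : Om' x -> `|a k x - ut x| <= T k by move=> Ox; have [_ h _] := hF x Ox; exact: h.
exists ut; split.
- exact: limit_continuous Lu rad0 e0 e_cvg Tcvg ball_sub approx a_ut.
- exact: limit_ae oO bO Lu rad0 e0 e_cvg Tcvg ball_sub approx a_ut.
- move=> x Ox; have [h _ _] := hF x Ox; apply: le_trans h _.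
  by rewrite /M mulrA [C0 * 4]mulrC.
Qed.

End interior.

Theorem corollary1p4 (R : realType) (n : nat) (hn : (3 <= n)%N)
    (C0 lam delta0 : R) (hC : @approximation_constants R n C0 lam delta0)
    (Om : set 'rV[R]_n) (hOm : bounded_domain Om) (hOm0 : Om 0)
    (R0 : R) (hR0 : 0 < R0) (hR1 : R0 <= 1)
    (omega1 : R -> R) (homega1 : modulus omega1) (hdini1 : dini omega1 R0) :
  exists C : R -> R,
  forall (Om' : set 'rV[R]_n)
    (V : ('rV[R]_n -> R) -> ('rV[R]_n -> R) -> R)
    (f : 'rV[R]_n -> 'rV[R]_n) (g : ('rV[R]_n -> R) -> R)
    (omega2 : R -> R) (u : 'rV[R]_n -> R),
  compactly_contained Om' Om ->
  W12multiplier Om V ->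
  L2vec Om f -> admissible Om (fun x => enorm (f x) ^+ 2) ->
  W12dual Om g ->
  (R0%:E <= dist Om' (bdry Om))%E ->
  (forall x0, Om' x0 -> eball x0 R0 `<=` Om) ->
  modulus omega2 -> dini omega2 R0 ->
  (forall (x0 : 'rV[R]_n) (r : R) (psi phi : 'rV[R]_n -> R),
     Om' x0 -> 0 < r -> r <= R0 / 2 ->
     W12 Om psi -> W120 Om phi ->
     esupp Om phi `<=` closure (eball x0 r) ->
     [/\ forall s : R, r < s -> s <= 2 * r ->
           `|V psi phi| <= omega1 s * L12norm Om x0 r s psi *
                           gradnorm Om (eball x0 r) phi,
         (\int[lebesgue_rV R n]_(x in eball x0 r)
             (enorm (f x) ^+ 2 * `|phi x| ^+ 2)%:E
          <= (omega2 r ^+ 2)%:E *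
             \int[lebesgue_rV R n]_(x in eball x0 r)
                (enorm (grad Om phi x) ^+ 2)%:E)%E &
         `|g phi| <= omega2 r / r ^+ 2 *
             vol (eball (0 : 'rV[R]_n) r) `^ ((n%:R + 2) / (2 * n%:R)) *
             gradnorm Om (eball x0 r) phi]) ->
  weak_solution Om V f g u ->
  [/\ exists ut : 'rV[R]_n -> R,
        {within Om', continuous ut} /\
        {ae lebesgue_rV R n, forall x, Om' x -> u x = ut x},
      (Linfty_norm Om' u < +oo)%E &
      forall rbar : R, 0 < rbar -> rbar <= R0 ->
        C0 * vol (eball (0 : 'rV[R]_n) 1) `^ ((n%:R + 2) / (2 * n%:R)) *
          (omega1 rbar + 1 / (1 - lam) * dini_integral omega1 rbar)
          = delta0 / 128 ->
        (Linfty_norm Om' u <=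
         (C rbar * (L2norm Om u / vol (eball (0 : 'rV[R]_n) rbar) `^ (1 / 2) +
                    omega2 R0 + dini_integral omega2 R0))%:E)%E].
Proof.
have [C00 /andP[lam0 lam1] d0 _] := hC.
have lam01 : 0 < lam < 1 by rewrite lam0.
have n2 : (2 <= n)%N by exact: ltnW.
have [oO _ bO] := hOm.
have c1 := cst1_gt0 hC; have c2 := cst2_gt0 hC.
have x0 k : 0 <= R0 * lam ^+ k by rewrite mulr_ge0 ?exprn_ge0// ltW.
have s10 k : 0 <= omega1 (R0 * lam ^+ k) by exact: modulus_ge0.
have [T [T0 hT]] := bounded_series_tails s10 (dini_sum homega1 hdini1 hR0 lam01).
(* the starting radius [R0 * lam ^+ j], chosen in terms of [omega1] only: below it the
   terms of the recursion that involve [omega1] are absorbed *)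
have [j [hj1 hj2]] : exists j, C0 * (cst1 n delta0 * T j) <= 1 / 4 /\ 2 * T j <= delta0.
  pose eps := Num.min (1 / 4 / (C0 * cst1 n delta0)) (delta0 / 2).
  have eps0 : 0 < eps by rewrite lt_min !divr_gt0// mulr_gt0.
  have [j _ hj] : \forall k \near \oo, T k < eps by exact: (cvgr_lt 0).
  have := hj j (leqnn j); rewrite /= lt_min => /andP[/ltW h1 /ltW h2]; exists j; split.
    by rewrite mulrA mulrC -ler_pdivlMr// mulr_gt0.
  by rewrite mulrC -ler_pdivlMr.
pose r := R0 * lam ^+ j.
have r0 : 0 < r by rewrite mulr_gt0// exprn_gt0.
have rR : r <= R0 by rewrite ler_piMr ?(ltW hR0)// exprn_ile1// ltW.
have rk0 k : 0 <= r * lam ^+ k by rewrite mulr_ge0 ?exprn_ge0// ltW.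
have rk1 k : r * lam ^+ k <= R0.
  by apply: le_trans rR; rewrite ler_piMr ?(ltW r0)// exprn_ile1// ltW.
pose sr := Num.sqrt (vol (eball (0 : 'rV[R]_n) r)).
have sr0 : 0 < sr by rewrite sqrtr_gt0 vol_eball_gt0.
(* the errors are normalized on the ball of radius [r]; the first term converts this
   normalization to the radius [rbar] *)
exists (fun rbar => 4 * C0 * (vol (eball (0 : 'rV[R]_n) rbar) `^ (1 / 2) / sr +
  cst2 n delta0 + cst2 n delta0 / (1 - lam))).
move=> Om' V f g omega2 u _ hV Lf hf hg _ BO homega2 hdini2 hloc hw.
have [_ mono1 _ _] := homega1; have [_ mono2 _ _] := homega2.
pose m1 k := omega1 (r * lam ^+ k); pose m2 k := omega2 (r * lam ^+ k).
have m10 k : 0 <= m1 k by exact: modulus_ge0.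
have m20 k : 0 <= m2 k by exact: modulus_ge0.
have m1_sum m : \sum_(k < m) m1 k <= T j.
  apply: le_trans (hT j m); apply: eq_ler.
  by apply: eq_bigr => k _; rewrite /m1 /r exprD mulrA.
have m1_small k : 2 * m1 k <= delta0.
  apply: le_trans hj2; rewrite ler_wpM2l//; apply: le_trans (m1_sum k.+1).
  by rewrite big_ord_recr/= lerDr sumr_ge0.
have m1_sum4 m : C0 * (cst1 n delta0 * \sum_(k < m) m1 k) <= 1 / 4.
  apply: le_trans hj1; rewrite ler_wpM2l ?(ltW C00)// ler_wpM2l ?(ltW c1)//.
pose M2 := omega2 R0 + (1 - lam)^-1 * dini_integral omega2 R0.
have m2_sum m : \sum_(k < m) m2 k <= M2.
  apply: le_trans (dini_sum homega2 hdini2 hR0 lam01 m).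
  by apply: ler_sum => k _; rewrite mono2// ler_wpM2r ?exprn_ge0// ltW.
have small x k : Om' x -> local_bounds Om V f g x (r * lam ^+ k) (m1 k) (m2 k).
  move=> Ox rho psi phi rho0 rhor Wpsi Wphi sphi.
  have rho2 : 2 * rho <= r * lam ^+ k by rewrite mulrC -ler_pdivlMr.
  have rhok : rho <= r * lam ^+ k by apply: le_trans rho2; rewrite ler_peMl ?ler1n// ltW.
  have rhoR : rho <= R0 / 2 by apply: le_trans rhor _; rewrite ler_pM2r ?invr_gt0.
  have w2 : omega2 rho <= m2 k by rewrite mono2// ltW.
  have w20 : 0 <= omega2 rho by rewrite modulus_ge0// ltW.
  have BOm : eball x rho `<=` Om.
    by apply: subset_trans (BO x Ox); apply: le_eball; exact: le_trans rhok (rk1 k).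
  have [h1 h2 h3] := hloc x rho psi phi Ox rho0 rhoR Wpsi Wphi sphi; split.
  - move=> s rs s2; apply: le_trans (h1 s rs s2) _.
    rewrite -2!mulrA ler_wpM2r ?mulr_ge0 ?gradnorm_ge0 ?L12norm_ge0//.
    by rewrite mono1 ?(le_trans s2)// ltW// (lt_trans rho0).
  - rewrite integral_grad_sqr// in h2; last 2 first.
    + exact: measurable_eball.
    + by have [] := Wphi.
    under eq_integral do rewrite -[phi _ ^+ 2]real_normK ?num_real//.
    apply: le_trans h2 _; rewrite -EFinM lee_fin ler_wpM2r ?sqr_ge0//.
    by rewrite ler_pXn2r ?nnegrE.
  - apply: le_trans h3 _; rewrite -!mulrA ler_wpM2r//.
    by rewrite !mulr_ge0 ?gradnorm_ge0 ?powR_ge0 ?invr_ge0 ?exprn_ge0// ltW.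
have key X : 0 < X -> L2norm Om u <= X * sr -> exists ut : 'rV[R]_n -> R,
    [/\ {within Om', continuous ut}, {ae lebesgue_rV R n, forall x, Om' x -> u x = ut x} &
      forall x, Om' x -> `|ut x| <= 4 * C0 * (X + cst2 n delta0 * M2)].
  move=> X0 hX; apply: (interior_continuity_estimate hC n2 oO bO r0 _ hV Lf hf hg hw m10 m20
    X0 small m1_small m1_sum4 m2_sum hX).
  by move=> x Ox; apply: subset_trans (BO x Ox); exact: le_eball.
have w2R0 : 0 <= omega2 R0 by rewrite modulus_ge0// ltW.
have I20 := dini_integral_ge0 R0 homega2.
have l10 : 0 < 1 - lam by rewrite subr_gt0.
have M20 : 0 <= M2 by rewrite addr_ge0// mulr_ge0// invr_ge0 ltW.
have Linf X : 0 < X -> L2norm Om u <= X * sr ->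
    (Linfty_norm Om' u <= (4 * C0 * (X + cst2 n delta0 * M2))%:E)%E.
  move=> X0 hX; have [ut [_ uut hut]] := key X X0 hX.
  apply: Linfty_norm_le.
    have QM : 0 <= cst2 n delta0 * M2 by rewrite mulr_ge0// ltW.
    by apply: mulr_ge0; [rewrite mulr_ge0// ltW|rewrite addr_ge0// ltW].
  by apply: filterS uut => x uutx Ox; rewrite uutx//; exact: hut.
(* the normalization of the errors requires a positive bound, also when [u] vanishes *)
pose X e := L2norm Om u / sr + e.
have X0 e : 0 < e -> 0 < X e by move=> e0; rewrite ltr_wpDl// divr_ge0 ?L2norm_ge0// ltW.
have hX e : 0 < e -> L2norm Om u <= X e * sr.
  by move=> e0; rewrite mulrDl divfK ?gt_eqF// lerDl mulr_ge0// ltW.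
split.
- by have [ut [h1 h2 _]] := key _ (X0 1 ltr01) (hX 1 ltr01); exists ut.
- by apply: le_lt_trans (Linf _ (X0 1 ltr01) (hX 1 ltr01)) _; rewrite ltry.
move=> rbar rbar0 _ _; apply/lee_addgt0Pr => e e0.
have e40 : 0 < e / (4 * C0) by rewrite divr_gt0// mulr_gt0.
apply: le_trans (Linf _ (X0 _ e40) (hX _ e40)) _; rewrite -EFinD lee_fin.
set v := vol (eball (0 : 'rV[R]_n) rbar) `^ (1 / 2).
have v0 : 0 < v by rewrite powR_gt0// vol_eball_gt0.
have nu0 := L2norm_ge0 Om u.
have -> : 4 * C0 * (X (e / (4 * C0)) + cst2 n delta0 * M2) =
    4 * C0 * (L2norm Om u / sr + cst2 n delta0 * M2) + e.
  by rewrite /X; field; rewrite gt_eqF// gt_eqF.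
rewrite lerD2r -[leRHS]mulrA ler_pM2l ?mulr_gt0//.
have -> : L2norm Om u / sr = v / sr * (L2norm Om u / v) by field; rewrite !gt_eqF.
rewrite /M2; set Q := cst2 n delta0 in c2 *; set I2 := dini_integral _ _ in I20 *.
have -> : Q * (omega2 R0 + (1 - lam)^-1 * I2) = Q * omega2 R0 + Q / (1 - lam) * I2.
  by rewrite mulrDr mulrA.
have p0 : 0 <= v / sr by rewrite divr_ge0// ltW.
have q0 : 0 <= Q / (1 - lam) by rewrite divr_ge0// ltW.
have y0 : 0 <= L2norm Om u / v by rewrite divr_ge0// ltW.
have Q0 := ltW c2.
move: p0 q0 y0 w2R0 I20 Q0; clearbody Q I2.
move: (v / sr) (Q / (1 - lam)) (L2norm Om u / v) (omega2 R0) => p q y w p0 q0 y0 w0 I0 Q0.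
have := mulr_ge0 p0 w0; have := mulr_ge0 p0 I0; have := mulr_ge0 Q0 y0; have := mulr_ge0 Q0 I0.
have := mulr_ge0 q0 y0; have := mulr_ge0 q0 w0; have -> : (p + Q + q) * (y + w + I2) =
  p * y + p * w + p * I2 + (Q * y + Q * w + Q * I2) + (q * y + q * w + q * I2) by ring.
lra.
Qed.
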